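(* Let $U,V,W\subset\mathbb{C}$ be nonempty compact sets and let $p\in[1,\infty]$, with the bi-infinite and semi-infinite matrices below acting on $\ell^p(\mathbb{Z})$ and $\ell^p(\mathbb{N})$, respectively. The following are equivalent: (a) the full finite section method (FSM) applies to one operator in $\Psi E(U,V,W)$; (b) the full FSM applies to one operator in $\Psi E_+(U,V,W)$; (c) all operators in $M_+(U,V,W)$ are invertible; (d) all operators in $M_+(U,V,W)$ are invertible, and the inverses are uniformly bounded; (e) one operator in $\Psi E_+(U,V,W)$ is invertible; (f) $0\notin\Sigma_+$; (g) one operator in $\Psi E_+(U,V,W)$ is Fredholm with index $0$; (h) all operators in $M_+(U,V,W)$ are Fredholm with index $0$; (i) $(U,V,W)$ is compatible and $\kappa(U,V,W)=0$; (j) the full FSM applies to all operators in $M(U,V,W)$; (k) the full FSM applies to all operators in $M_+(U,V,W)$.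
   Context: $\mathbb{N}=\{1,2,\dots\}$. $M(U,V,W)$ is the set of bi-infinite tridiagonal matrices $A=(a_{ij})_{i,j\in\mathbb{Z}}$ with $a_{i,i-1}\in U$, $a_{i,i}\in V$, $a_{i,i+1}\in W$ for all $i$, all other entries zero. $M_+(U,V,W)$ is the set of semi-infinite tridiagonal matrices $(a_{ij})_{i,j\in\mathbb{N}}$ with subdiagonal entries in $U$, diagonal entries in $V$, superdiagonal entries in $W$, all other entries zero. $M_n(U,V,W)$ is the set of $n\times n$ matrices of the same kind. Invertibility, spectra, Fredholmness and Fredholm index of the bi- and semi-infinite ones do not depend on $p$. The index of a Fredholm operator is the dimension of its null space minus the codimension of its image. $A\in M(U,V,W)$ is pseudoergodic, $A\in \Psi E(U,V,W)$, if for every $n\in\mathbb N$, every $B\in M_n(U,V,W)$ and every $\varepsilon>0$ there is a submatrix $C$ of $A$ composed of rows and columns $k+1,\dots,k+n$ of $A$, for some integer $k$, with $\|B-C\|<\varepsilon$; $\Psi E_+(U,V,W)\subset M_+(U,V,W)$ is defined in the same way. $(U,V,W)$ is compatible if all operators in $M(U,V,W)$ are invertible; it is known that this is equivalent to each of: one operator in $\Psi E(U,V,W)$ is Fredholm; one operator in $\Psi E(U,V,W)$ is invertible; all operators in $M(U,V,W)$ are Fredholm; one operator in $\Psi E_+(U,V,W)$ is Fredholm; all operators in $M_+(U,V,W)$ are Fredholm. If $(U,V,W)$ is compatible, all $B_+\in M_+(U,V,W)$ are Fredholm with one and the same index, denoted $\kappa(U,V,W)\in\{-1,0,1\}$. $\Sigma_+:=\bigcup_{C_+\in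 M_+(U,V,W)}\operatorname{spec}C_+$, which equals $\operatorname{spec}B_+$ for every $B_+\in\Psi E_+(U,V,W)$. FSM: for $A=(a_{ij})_{i,j\in\mathbb Z}$ and integer cut-off sequences $l_n\to-\infty$, $r_n\to+\infty$, the equation $Ax=b$ is replaced by $\sum_{l_n\le j\le r_n}a_{ij}x_n(j)=b(i)$, $l_n\le i\le r_n$. The FSM applies to $A$ if $A$ is invertible, the truncated systems are uniquely solvable for all sufficiently large $n$ and every right-hand side $b$, and, for every $b$, the solutions $x_n$ (extended by zero) approximate the solution $x$ of $Ax=b$: $\|x_n-x\|\to0$ if $p<\infty$; $\|x_n\|=O(1)$ and $x_n(j)\to x(j)$ for every $j$ if $p=\infty$. Equivalently, $A$ is invertible and the finite sections $A_n=(a_{ij})_{i,j=l_n}^{r_n}$ are invertible for all large $n$ with $\limsup_n\|A_n^{-1}\|<\infty$. For semi-infinite matrices the same definition is used with $l_n=1$. The full FSM is the choice $l_n=-n$, $r_n=n$ for bi-infinite matrices, and $l_n=1$, $r_n=n$ for semi-infinite matrices. *)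

(* Defs.v *)
From HB Require Import structures.
From mathcomp Require Import all_boot all_order all_algebra complex.
From mathcomp Require Import all_classical all_reals all_analysis.
Set Implicit Arguments.
Unset Strict Implicit.
Unset Printing Implicit Defensive.
Import Order.TTheory GRing.Theory Num.Theory numFieldNormedType.Exports.
Import ComplexField.Normc.
Local Open Scope complex_scope.
Local Open Scope classical_set_scope.
Local Open Scope ring_scope.

(* The index type I is int for l^p(Z), nat for l^p(N) and 'I_n for C^n. *)
Section Lp.
Variables (R : realType) (I : choiceType) (p : \bar R).
Implicit Types (x : I -> R[i]) (T S : (I -> R[i]) -> (I -> R[i])).

(* Only used for 1 <= p <= +oo; the value at -oo is irrelevant. *)
Definition lpnorm x : \bar R :=
  (match p with
   | r%:E => (\esum_(i in [set: I]) (normc (x i) `^ r)%:E) `^ r^-1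
   | +oo => ereal_sup (range (fun i => (normc (x i))%:E))
   | -oo => 0
   end)%E.

Definition lp : set (I -> R[i]) := [set x | (lpnorm x < +oo)%E].

(* Operators on l^p are total maps on I -> R[i] that are only constrained,
   and only considered, on l^p. *)
Definition opnorm T : \bar R :=
  ereal_sup [set lpnorm (T x) | x in [set x | (lpnorm x <= 1)%E]].

Definition bounded_operator T : Prop :=
  [/\ forall x, lp x -> lp (T x),
      forall (a : R[i]) x y, lp x -> lp y -> T (a *: x + y) = a *: T x + T y &
      (opnorm T < +oo)%E].

Definition is_inverse T S : Prop :=
  bounded_operator S /\ forall x, lp x -> T (S x) = x /\ S (T x) = x.

Definition invertible T : Prop :=
  bounded_operator T /\ exists S, is_inverse T S.

(* For a subspace Y of X: the quotient X / Y has a basis of n elements, namely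
   the classes of e 0, ..., e (n - 1). *)
Definition quotient_dim (X Y : set (I -> R[i])) (n : nat) : Prop :=
  exists e : 'I_n -> (I -> R[i]),
    (forall k, X (e k)) /\
    (forall x, X x ->
       exists! c : 'I_n -> R[i], Y (x - \sum_(k < n) c k *: e k)).

Definition null_space T : set (I -> R[i]) := [set x | lp x /\ T x = 0].

Definition fredholm_of_index T (k : int) : Prop :=
  bounded_operator T /\
  exists a b : nat,
    [/\ quotient_dim (null_space T) [set 0] a,
        quotient_dim lp (T @` lp) b &
        k = a%:Z - b%:Z].

(* The operator x |-> (sum_j a_ij x_j)_i. The sum is a finite-support sum: it is
   the right one for banded matrices, whose rows have finite support. *)
Definition mxop (A : I -> I -> R[i]) : (I -> R[i]) -> (I -> R[i]) :=
  fun x i => \sum_(j \in [set: I]) A i j * x j.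

Definition spec (A : I -> I -> R[i]) : set R[i] :=
  [set lambda |
    ~ invertible (mxop (fun i j => A i j - (if i == j then lambda else 0)))].

End Lp.

Section FSM.
Variables (R : realType) (I : choiceType) (p : \bar R).

(* The truncated system on the finite window D, its solution being extended
   by zero. *)
Definition trunc_sol (A : I -> I -> R[i]) (D : set I) (b x : I -> R[i]) : Prop :=
  (forall i, D i -> \sum_(j \in D) A i j * x j = b i) /\
  (forall i, ~ D i -> x i = 0).

Definition fsm_cvg (xn : nat -> I -> R[i]) (x : I -> R[i]) : Prop :=
  if p == +oo%E then
    (exists c : R, \forall n \near \oo, (lpnorm p (xn n) <= c%:E)%E) /\
    (forall j, (fun n => (xn n j : R[i]^o)) @ \oo --> (x j : R[i]^o))
  else (fun n => lpnorm p (xn n - x)) @ \oo --> 0%E.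

(* The FSM with cut-offs l n, r n; lab i is the integer that the index i
   stands for. *)
Definition fsm_applies (lab : I -> int) (l r : nat -> int)
    (A : I -> I -> R[i]) : Prop :=
  let D n := [set i | l n <= lab i <= r n] in
  [/\ invertible p (mxop A),
      \forall n \near \oo, forall b, lp p b -> exists! x, trunc_sol A (D n) b x &
      forall (b x : I -> R[i]) (xn : nat -> I -> R[i]),
        lp p b -> lp p x -> mxop A x = b ->
        (\forall n \near \oo, trunc_sol A (D n) b (xn n)) -> fsm_cvg xn x].

End FSM.

(* N = {1, 2, ...} is encoded by nat, and {1, ..., n} by 'I_n, the index i
   standing for i + 1. *)
Definition labZ (i : int) : int := i.
Definition labN (i : nat) : int := i.+1%:Z.
Definition labI (n : nat) (i : 'I_n) : int := i.+1%:Z.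

Section Jacobi.
Variables (R : realType) (p : \bar R).
Implicit Types (U V W : set R[i]).

Definition tridiagonal (I : Type) (lab : I -> int) U V W :
    set (I -> I -> R[i]) :=
  [set A | forall i j,
     [/\ lab j = lab i - 1 -> U (A i j),
         lab j = lab i -> V (A i j),
         lab j = lab i + 1 -> W (A i j) &
         `|lab i - lab j| > 1 -> A i j = 0]].

Definition M U V W := tridiagonal labZ U V W.
Definition Mplus U V W := tridiagonal labN U V W.
Definition Mfin (n : nat) U V W := tridiagonal (@labI n) U V W.

(* The norm of a finite matrix is its operator norm on C^n with the p-norm. *)
Definition PsiE U V W : set (int -> int -> R[i]) :=
  [set A | M U V W A /\
    forall (n : nat) (B : 'I_n -> 'I_n -> R[i]) (eps : R),
      (0 < n)%N -> Mfin U V W B -> 0 < eps ->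
      exists k : int,
        (opnorm p (mxop (fun i j : 'I_n =>
           (B i j - A (k + labI i) (k + labI j))%R)) < eps%:E)%E].

(* Under labN, rows k + 1, ..., k + n are the nat indices k, ..., k + n - 1. *)
Definition PsiEplus U V W : set (nat -> nat -> R[i]) :=
  [set A | Mplus U V W A /\
    forall (n : nat) (B : 'I_n -> 'I_n -> R[i]) (eps : R),
      (0 < n)%N -> Mfin U V W B -> 0 < eps ->
      exists k : nat,
        (opnorm p (mxop (fun i j : 'I_n =>
           (B i j - A (k + i)%N (k + j)%N)%R)) < eps%:E)%E].

Definition compatible U V W : Prop :=
  forall A, M U V W A -> invertible p (mxop A).

(* The common index of all operators in Mplus U V W, which exists (and is unique)
   when U, V, W are nonempty, compact and compatible; 0 if there is none. *)
Definition kappa U V W : int :=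
  xget 0 [set k : int |
    forall B, Mplus U V W B -> fredholm_of_index p (mxop B) k].

Definition Sigma_plus U V W : set R[i] :=
  \bigcup_(A in Mplus U V W) spec p A.

Definition full_fsm (A : int -> int -> R[i]) : Prop :=
  fsm_applies p labZ (fun n => - n%:Z) (fun n => n%:Z) A.

Definition full_fsm_plus (A : nat -> nat -> R[i]) : Prop :=
  fsm_applies p labN (fun=> 1) (fun n => n%:Z) A.

End Jacobi.

(* Main.v *)
Require Import Defs.
From HB Require Import structures.
From mathcomp Require Import all_boot all_order all_algebra complex.
From mathcomp Require Import all_classical all_reals all_analysis.
From mathcomp Require Import zify ring lra.
Set Implicit Arguments.
Unset Strict Implicit.
Unset Printing Implicit Defensive.
Import Order.TTheory GRing.Theory Num.Theory numFieldNormedType.Exports.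
Import ComplexField.Normc.
Local Open Scope complex_scope.
Local Open Scope classical_set_scope.
Local Open Scope ring_scope.

(** A tridiagonal matrix with entries in U, V, W is tested on an interval D of Z by
    asking whether it has a bounded null vector supported in D.  If no matrix has one, for
    all translates and limits of D, then compactness of U, V, W (limits of translates along
    an ultrafilter) gives a uniform lower bound, and perturbing by the weights q^|i-j| an
    exponentially weighted one.  By duality in finite dimension the transposed system is
    then solvable with an exponentially decaying kernel, hence boundedly on all l^p at
    once.  Transposition followed by the reflection i |-> -i preserves the class of
    matrices, so that injectivity on left half-lines gives surjectivity on right ones, and
    vice versa.

    A null vector on a left half-line and one on a right half-line can be pasted to a null
    vector on Z (Coburn's lemma).  So if Z is free of null vectors, three cases remain:
    both kinds of half-lines are free of them (index 0), only the left one is (index 1),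
    or only the right one is (index -1).  In the first case finite intervals are free of
    null vectors too, because a null vector of a finite matrix can be repeated periodically
    along a half-line; this bounds all finite sections and all half-line inverses uniformly.

    Conversely, a pseudoergodic matrix contains approximations of every finite pattern.  A
    bounded null vector on Z thus yields infinitely many almost annihilated functionals
    with disjoint supports, so that the range has infinite codimension.  The cases of index
    1 and -1 are excluded by the index in (g) and (i), and in (a) because the kernel vector
    of a half-line matrix decays faster than a suitable solution of the whole system: its
    truncations are almost null vectors of the finite sections, and make the solutions of
    the sections blow up at the opposite end. *)

(** Null vectors are tested in sup norm only, and every estimate is kept in one form: if
    [q ^+ dst i j] times the j-th datum is at most s for all j, then the i-th value is at most C s.
    This form contains no p, survives duality, solution and truncation, and yields a bound on every
    l^p by a Schur test ([lple_dom]); an unweighted sup bound would serve p = oo alone. Operators on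
    Z and N and finite sections must share their constants. They are therefore all compressions to
    subsets D of Z, the missing entries being filled from U, V, W, and the constants depend only on
    U, V, W and the kind of D. In the converse direction two obstacles occur. A bounded null vector
    need not lie in the dual of l^p, so it is cut off by slowly varying weights, with q close to 1:
    the commutator with the weights is of order 1 - q. And Fredholmness is stated through a finite
    algebraic codimension, so infinite codimension must follow although no functional annihilates
    the range exactly; lacunary sums of test vectors achieve this, with coefficients 2^-n against
    functionals of order 4^-n on the image of a ball. *)

Section Normc.
Variable R : realType.
Implicit Types x y z : R[i].

Lemma normcE' z : `|z| = (normc z)%:C.
Proof. by case: z => a b; rewrite normc_def. Qed.

Lemma normc_ge0 z : 0 <= normc z.
Proof. by case: z => a b; rewrite /= sqrtr_ge0. Qed.

Lemma normc_eq0 z : (normc z == 0) = (z == 0).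
Proof. by apply/eqP/eqP => [/eq0_normc //|->]; rewrite normc0. Qed.

Lemma normc_gt0 z : (0 < normc z) = (z != 0).
Proof. by rewrite lt_def normc_ge0 normc_eq0 andbT. Qed.

Lemma le_normcB x y : normc (x - y) <= normc x + normc y.
Proof. by rewrite -(normcN y) le_normcD. Qed.

Lemma normc_distC x y : normc (x - y) = normc (y - x).
Proof. by rewrite -normcN opprB. Qed.

Lemma normc_real (a : R) : normc a%:C = `|a|.
Proof. by rewrite /= expr0n /= addr0 sqrtr_sqr. Qed.

Lemma normcX x n : normc (x ^+ n) = normc x ^+ n.
Proof. by elim: n => [|n IH]; rewrite ?expr0 ?normc1 // !exprS normcM IH. Qed.

Lemma le_normc_sum (I : Type) (r : seq I) (P : pred I) (F : I -> R[i]) :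
  normc (\sum_(i <- r | P i) F i) <= \sum_(i <- r | P i) normc (F i).
Proof.
elim/big_ind2: _ => [|x a y b hx hy|//]; first by rewrite normc0.
by apply: le_trans (le_normcD _ _) (lerD hx hy).
Qed.

Lemma normc_add3 x y z : normc (x + y + z) <= normc x + normc y + normc z.
Proof. exact: le_trans (le_normcD _ _) (lerD (le_normcD _ _) (lexx _)). Qed.

Lemma normc_le_Re_Im z : normc z <= `|complex.Re z| + `|complex.Im z|.
Proof.
case: z => a b /=.
rewrite -(ler_pXn2r (n:=2)) ?nnegrE ?sqrtr_ge0 ?addr_ge0 //.
rewrite sqr_sqrtr ?addr_ge0 ?sqr_ge0 // sqrrD !real_normK ?num_real //.
by rewrite -addrA lerD2l lerDr mulrn_wge0 // mulr_ge0.
Qed.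

Lemma Re_le_normc z : `|complex.Re z| <= normc z.
Proof.
case: z => a b /=; rewrite -sqrtr_sqr ler_wsqrtr // lerDl sqr_ge0 //.
Qed.

Lemma Im_le_normc z : `|complex.Im z| <= normc z.
Proof.
case: z => a b /=; rewrite -sqrtr_sqr ler_wsqrtr // lerDr sqr_ge0 //.
Qed.

End Normc.

(** * Limits along an ultrafilter *)

Section UltraLimit.
Variables (R : realType) (F : set_system nat).
Implicit Types (z t : nat -> R[i]) (l m : R[i]).

(** A single ultrafilter handles all sites of Z at the same time, so limits of translates need no
    diagonal choice of subsequences. *)
Definition ulim z l := forall e : R, 0 < e -> F [set k | normc (z k - l) < e].

Lemma ulim_cst l {FF : Filter F} : ulim (fun=> l) l.
Proof. by move=> e e0; apply: filterE => k /=; rewrite subrr normc0. Qed.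

Lemma ulimD z t l m {FF : Filter F} :
  ulim z l -> ulim t m -> ulim (fun k => z k + t k) (l + m).
Proof.
move=> zl tm e e0; have e20 : 0 < e / 2 by rewrite divr_gt0.
apply: filterS2 (zl _ e20) (tm _ e20) => k /= h1 h2.
have -> : z k + t k - (l + m) = (z k - l) + (t k - m) by ring.
by apply: le_lt_trans (le_normcD _ _) _; lra.
Qed.

Lemma ulimM z t l m {FF : Filter F} :
  ulim z l -> ulim t m -> ulim (fun k => z k * t k) (l * m).
Proof.
move=> zl tm e e0; pose c := normc l + normc m + 1.
have c0 : 0 < c by rewrite /c; have := normc_ge0 l; have := normc_ge0 m; lra.
pose d := Num.min 1 (e / (2 * c)).
have d0 : 0 < d by rewrite lt_min ltr01 divr_gt0 // mulr_gt0.
apply: filterS2 (zl _ d0) (tm _ d0) => k /= h1 h2.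
have -> : z k * t k - l * m = (z k - l) * (t k - m) + ((z k - l) * m + l * (t k - m)) by ring.
have hd1 : d <= 1 by rewrite ge_min lexx.
have hd2 : d * (2 * c) <= e by rewrite -ler_pdivlMr ?mulr_gt0 // ge_min lexx orbT.
apply: le_lt_trans (le_normcD _ _) _; rewrite normcM.
have := le_normcD ((z k - l) * m) (l * (t k - m)); rewrite !normcM.
move: (normc_ge0 (z k - l)) (normc_ge0 (t k - m)) (normc_ge0 l) (normc_ge0 m) h1 h2.
rewrite /c in c0 hd2 *.
move: (normc (z k - l)) (normc (t k - m)) (normc l) (normc m) (normc _) c0 hd2 => a b A B X.
by nra.
Qed.

Lemma ulim_le z l (M : R) {FF : ProperFilter F} :
  ulim z l -> F [set k | normc (z k) <= M] -> normc l <= M.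
Proof.
move=> zl zM; apply/ler_addgt0Pr => e e0.
have [k [/= h1 h2]] := filter_ex (filterI (zl _ e0) zM).
have -> : l = z k - (z k - l) by ring.
by apply: le_trans (le_normcB _ _) _; lra.
Qed.

Lemma ulim_unique z l m {FF : ProperFilter F} : ulim z l -> ulim z m -> l = m.
Proof.
move=> zl zm; apply/eqP; rewrite -subr_eq0 -normc_eq0 eq_le normc_ge0 andbT.
apply/ler_addgt0Pr => e e0; rewrite add0r.
have e20 : 0 < e / 2 by rewrite divr_gt0.
have [k [/= h1 h2]] := filter_ex (filterI (zl _ e20) (zm _ e20)).
have -> : l - m = (z k - m) - (z k - l) by ring.
by apply: le_trans (le_normcB _ _) _; lra.
Qed.

Lemma ulim_near z t l {FF : Filter F} :
  F [set k | z k = t k] -> ulim z l -> ulim t l.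
Proof. by move=> zt zl e /zl; apply: filterS2 zt => k /= ->. Qed.

(** The image of F is an ultrafilter, so a cluster point of it is a limit: if F did not contain the
    indices that fall into a ball around l, it would contain the complement, against clustering. *)
Lemma ulim_compact (U : set R[i]) z {FF : UltraFilter F} :
  compact (U : set R[i]^o) -> (forall k, U (z k)) -> exists2 l, U l & ulim z l.
Proof.
move=> Uc Uz; have zU : (z @ F) U by exact: (@filterE _ F _ [set k | U (z k)]).
have [l [Ul cl]] := Uc (z @ F) (fmap_proper_filter z ultra_proper) zU; exists l => // e e0.
have [//|hn] := in_ultra_setVsetC [set k | normc (z k - l) < e] FF.
have hb : nbhs (l : R[i]^o) [set y | normc (y - l) < e].
  apply/nbhs_ballP; exists e%:C; first by rewrite /= ltcR.
  move=> y /=; rewrite /ball /= normcE' ltcR normc_distC //.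
have hn' : (z @ F) [set y | ~ (normc (y - l) < e)] by exact: hn.
by have [y [h1 h2]] := cl [set y | ~ (normc (y - l) < e)] [set y | normc (y - l) < e] hn' hb.
Qed.

Lemma ulim_bounded z (M : R) {FF : UltraFilter F} :
  (forall k, normc (z k) <= M) -> exists2 l, normc l <= M & ulim z l.
Proof.
move=> zM.
have real_lim (a : nat -> R) : (forall k, `|a k| <= M) ->
    exists l : R, forall e : R, 0 < e -> F [set k | `|a k - l| < e].
  move=> aM.
  have aF : (a @ F) `[- M, M]%classic.
    by apply: (@filterE _ F _ [set k | _]) => k /=; rewrite in_itv /= -ler_norml.
  have [l [_ cl]] := @segment_compact R (- M) M (a @ F)
    (fmap_proper_filter a ultra_proper) aF.
  exists l => e e0.
  have [//|hn] := in_ultra_setVsetC [set k | `|a k - l| < e] FF.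
  have hb : nbhs l [set y | `|y - l| < e].
    by apply/nbhs_ballP; exists e => // y; rewrite /ball /= distrC.
  have hn' : (a @ F) [set y | ~ (`|y - l| < e)] by exact: hn.
  by have [y [h1 h2]] := cl [set y | ~ (`|y - l| < e)] [set y | `|y - l| < e] hn' hb.
have [a ha] := real_lim (fun k => complex.Re (z k)) (fun k => le_trans (Re_le_normc _) (zM k)).
have [b hb] := real_lim (fun k => complex.Im (z k)) (fun k => le_trans (Im_le_normc _) (zM k)).
have zl : ulim z (a +i* b).
  move=> e e0; have e20 : 0 < e / 2 by rewrite divr_gt0.
  apply: filterS2 (ha _ e20) (hb _ e20) => k /= h1 h2.
  apply: le_lt_trans (normc_le_Re_Im _) _.
  by case: (z k) h1 h2 => x y /= h1 h2; lra.
exists (a +i* b) => //; apply: ulim_le zl _.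
by apply: filterE => k /=.
Qed.

End UltraLimit.

Lemma ultra_eventually : exists F : set_system nat,
  UltraFilter F /\ forall n, F [set k | (n <= k)%N].
Proof.
have [F [FU hF]] := ultraFilterLemma eventually_filter.
by exists F; split=> // n; apply: hF; exists n.
Qed.

(** * Null vectors and exponential bounds *)

Section Jacobi.
Variable R : realType.
Implicit Types (u v w x y : int -> R[i]) (U V W : set R[i]) (D : set int).

Definition jac u v w x (i : int) : R[i] :=
  u i * x (i - 1) + v i * x i + w i * x (i + 1).

Definition coefs U V W u v w := forall i, [/\ U (u i), V (v i) & W (w i)].

Definition bdd x (M : R) := forall i, normc (x i) <= M.

Definition supp D x := forall i, ~ D i -> x i = 0.

(** With DD equal to [[set setT]], [upc], [downc] or [convc], the compressions to D are the
    operators on Z, on right and left half-lines, and on intervals. Boundedness, unlike membership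
    in l^p, survives limits of translates. *)
Definition nullfree U V W (DD : set (set int)) := forall u v w D x M,
  coefs U V W u v w -> DD D -> bdd x M -> supp D x ->
  (forall i, D i -> jac u v w x i = 0) -> forall i, x i = 0.

(** Closure under what [lower_bound] does to D: the translation to a near-maximal site and the limit
    along F. *)
Definition admissible (DD : set (set int)) :=
  (forall D k, DD D -> DD [set i | D (i + k)]) /\
  (forall F, UltraFilter F -> forall Dn : nat -> set int, (forall k, DD (Dn k)) ->
     DD [set i | F [set k | Dn k i]]).

(** Besides the right half-lines this contains Z and the empty set, which occur as limits of
    half-lines whose end points go to infinity. *)
Definition upc : set (set int) := [set D | forall i j, D i -> i <= j -> D j].
Definition downc : set (set int) := [set D | forall i j, D i -> j <= i -> D j].
Definition convc : set (set int) :=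
  [set D | forall i j k, D i -> D k -> i <= j <= k -> D j].

Lemma admissibleT : admissible [set setT].
Proof.
split=> [D k -> //|F FU Dn Dn1]; apply/seteqP; split=> // i _ /=.
by apply: (@filterE _ F _ [set k | _]) => k /=; rewrite Dn1.
Qed.

Lemma admissible_upc : admissible upc.
Proof.
split=> [D k DD i j /= Di ij|F FU Dn Dn1 i j /= Fi ij].
  by apply: DD Di _; lia.
by apply: filterS Fi => k /= h; exact: Dn1 h ij.
Qed.

Lemma admissible_downc : admissible downc.
Proof.
split=> [D k DD i j /= Di ij|F FU Dn Dn1 i j /= Fi ij].
  by apply: DD Di _; lia.
by apply: filterS Fi => k /= h; exact: Dn1 h ij.
Qed.

Lemma admissible_convc : admissible convc.
Proof.
split=> [D k DD i j l /= Di Dl ij|F FU Dn Dn1 i j l /= Fi Fl ij].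
  by apply: DD Di Dl _; lia.
by apply: filterS2 Fi Fl => k /= h h'; exact: Dn1 h h' ij.
Qed.

(** A substitute for the maximum, which a bounded family on an infinite set need not attain. *)
Lemma near_sup (T : Type) (f : T -> R) M t0 :
  (forall t, f t <= M) -> 0 < f t0 -> exists t1, forall t, f t <= 2 * f t1.
Proof.
move=> fM ft0; have hs : has_sup (range f).
  by split; [exists (f t0), t0|exists M => _ [t _ <-]].
have hub t : f t <= sup (range f) by apply: sup_upper_bound => //; exists t.
have s0 : 0 < sup (range f) / 2 by rewrite divr_gt0 // (lt_le_trans ft0).
have [_ [t1 _ <-] h] := sup_adherent s0 hs.
by exists t1 => t; have := hub t; lra.
Qed.

(** Counterexamples to the constants 2(k + 1) are translated so that a near-maximal entry lies at 0,
    and scaled to 1 there. Their limit along F is bounded by 2, has value 1 at 0, and is a null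
    vector on the limit of the sets D. *)
Lemma lower_bound U V W DD :
  compact (U : set R[i]^o) -> compact (V : set R[i]^o) ->
  compact (W : set R[i]^o) -> admissible DD -> nullfree U V W DD ->
  exists2 c : R, 0 < c & forall u v w D x M s,
    coefs U V W u v w -> DD D -> bdd x M -> supp D x -> 0 <= s ->
    (forall i, D i -> normc (jac u v w x i) <= s) ->
    forall i, normc (x i) <= c * s.
Proof.
move=> Uc Vc Wc [DDt DDl] nf; apply: contrapT => hn.
have H (k : nat) : exists d : (int -> R[i]) * (int -> R[i]) * (int -> R[i]) *
    set int * (int -> R[i]), let: (u, v, w, D, y) := d in
    [/\ coefs U V W u v w /\ DD D, supp D y, y 0 = 1, bdd y 2 &
      forall i, D i -> normc (jac u v w y i) <= k.+1%:R^-1].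
  (* The factor 2 pays for the entry at j being only half of the supremum. *)
  apply: contrapT => hk; apply: hn; exists (2 * k.+1%:R) => //.
  move=> u v w D x M s cf DD0 xM xD s0 hs i; rewrite leNgt; apply/negP => hi.
  have xi0 : 0 < normc (x i) by apply: le_lt_trans hi; rewrite !mulr_ge0.
  have [j hj] := near_sup (f := fun i => normc (x i)) xM xi0.
  have xj0 : 0 < normc (x j) by have := hj i; lra.
  have xj1 : x j != 0 by rewrite -normc_gt0.
  apply: hk; exists (fun i => u (i + j), fun i => v (i + j), fun i => w (i + j),
    [set i | D (i + j)], fun i => x (i + j) / x j); split.
  - by split; [move=> l; exact: cf|exact: DDt].
  - by move=> l /= Dl; rewrite xD // mul0r.
  - by rewrite add0r divff.
  - by move=> l; rewrite normcM normcV ler_pdivrMr.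
  - move=> l /= Dl.
    have -> : jac (fun i => u (i + j)) (fun i => v (i + j)) (fun i => w (i + j))
      (fun i => x (i + j) / x j) l = jac u v w x (l + j) / x j.
      by rewrite /jac (addrAC l (-1)) (addrAC l 1) !mulrDl !mulrA.
    rewrite normcM normcV ler_pdivrMr // (le_trans (hs _ Dl)) //.
    rewrite mulrC ler_pdivlMr ?ltr0Sn //.
    by have := hj i; move: hi; rewrite -mulrA (mulrC s) => hi hi'; lra.
have {}[d hd] := choice H.
pose us k := (d k).1.1.1.1; pose vs k := (d k).1.1.1.2; pose ws k := (d k).1.1.2.
pose Ds k := (d k).1.2; pose ys k := (d k).2.
have {}hd k : [/\ coefs U V W (us k) (vs k) (ws k) /\ DD (Ds k), supp (Ds k) (ys k),
    ys k 0 = 1, bdd (ys k) 2 &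
    forall i, Ds k i -> normc (jac (us k) (vs k) (ws k) (ys k) i) <= k.+1%:R^-1].
  by move: (hd k); rewrite /us /vs /ws /Ds /ys; case: (d k) => [[[[]]]].
have [F [FU Fn]] := ultra_eventually.
have cu i : exists l, U l /\ ulim F (fun k => us k i) l.
  have [|l] := ulim_compact (F := F) (z := fun k => us k i) Uc; last by exists l.
  by move=> k; have [[/(_ i)[]]] := hd k.
have cv i : exists l, V l /\ ulim F (fun k => vs k i) l.
  have [|l] := ulim_compact (F := F) (z := fun k => vs k i) Vc; last by exists l.
  by move=> k; have [[/(_ i)[]]] := hd k.
have cw i : exists l, W l /\ ulim F (fun k => ws k i) l.
  have [|l] := ulim_compact (F := F) (z := fun k => ws k i) Wc; last by exists l.
  by move=> k; have [[/(_ i)[]]] := hd k.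
have cy i : exists l, normc l <= 2 /\ ulim F (fun k => ys k i) l.
  have [|l] := ulim_bounded (F := F) (z := fun k => ys k i) (M := 2); last by exists l.
  by move=> k; have [_ _ _ /(_ i)] := hd k.
have [u hu] := choice cu; have [v hv] := choice cv; have [w hw] := choice cw.
have [y hy] := choice cy.
have y0 : y 0 = 1.
  apply: (ulim_unique (F := F)) (hy 0).2 _.
  by apply: ulim_near (ulim_cst 1); apply: filterE => k /=; have [] := hd k.
suff : y 0 = 0 by rewrite y0 => /eqP; rewrite oner_eq0.
apply: (nf u v w [set i | F [set k | Ds k i]] y 2).
- by move=> i; split; [case: (hu i)|case: (hv i)|case: (hw i)].
- by apply: DDl => k; have [[]] := hd k.
- by move=> i; case: (hy i).
(* If i is outside of the limit set, F-almost all D miss i, and y i is a limit of zeros. *)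
- move=> i /= nF; have [//|Fi] := in_ultra_setVsetC [set k | Ds k i] FU.
  apply: (ulim_unique (F := F)) (hy i).2 _; apply: ulim_near (ulim_cst 0).
  by apply: filterS Fi => k /= h; have [_ /(_ i h) ->] := hd k.
- move=> i /= Fi; apply/eqP; rewrite -normc_eq0 eq_le normc_ge0 andbT.
  apply/ler_addgt0Pr => e e0; rewrite add0r.
  have lj : ulim F (fun k => jac (us k) (vs k) (ws k) (ys k) i) (jac u v w y i).
    exact: ulimD (ulimD (ulimM (hu _).2 (hy _).2) (ulimM (hv _).2 (hy _).2))
      (ulimM (hw _).2 (hy _).2).
  apply: ulim_le lj _.
  have := Fn (Num.truncn e^-1); apply: filterS2 Fi => k /= Dk hk.
  have [_ _ _ _ /(_ i Dk)] := hd k => /le_trans; apply.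
  rewrite -[leRHS]invrK lef_pV2 ?posrE ?ltr0Sn ?invr_gt0 //.
  apply: le_trans (ltW (truncnS_gt _)) _; by rewrite ler_nat ltnS.
Qed.

End Jacobi.

Local Notation dst a b := (absz (a - b)%R) (only parsing).

Lemma dst_near (i j k : int) : (dst k j <= 1)%N -> (dst j i <= (dst k i).+1)%N.
Proof. lia. Qed.

Lemma dst_near' (i j k : int) : (dst k j <= 1)%N -> (dst k i <= (dst j i).+1)%N.
Proof. lia. Qed.

Lemma dst_subr1 (j : int) : (dst (j - 1) j <= 1)%N.
Proof. lia. Qed.

Lemma dst_addr1 (j : int) : (dst (j + 1) j <= 1)%N.
Proof. lia. Qed.

Section ExpBound.
Variable R : realType.
Implicit Types (u v w x y : int -> R[i]) (U V W : set R[i]) (D E : set int).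

Lemma compact_normc_bounded U : compact (U : set R[i]^o) ->
  exists2 K : R, 0 < K & forall z, U z -> normc z <= K.
Proof.
move=> Uc; apply: contrapT => hn.
have H (k : nat) : exists z, U z /\ k.+1%:R < normc z.
  apply: contrapT => hk; apply: hn; exists k.+1%:R => // z Uz.
  by rewrite leNgt; apply/negP => h; apply: hk; exists z.
have {}[z hz] := choice H.
have [F [FU Fn]] := ultra_eventually.
have [l _ zl] := ulim_compact (F := F) Uc (fun k => (hz k).1).
have [k [/= h1 h2]] := filter_ex (filterI (zl _ ltr01) (Fn (Num.truncn (normc l + 1)))).
have := (hz k).2; have := truncnS_gt (normc l + 1).
have : (Num.truncn (normc l + 1)).+1%:R <= k.+1%:R :> R by rewrite ler_nat ltnS.
have := le_normcD (z k - l) l; rewrite subrK; lra.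
Qed.

(** The relative change of the weight between neighbours is largest for a step towards the centre, b
    = a + 1, where equality holds. *)
Lemma expr_dist_le (q : R) (a b : nat) : 0 < q < 1 -> (a <= b.+1)%N -> (b <= a.+1)%N ->
  `|q ^+ b - q ^+ a| <= (q^-1 - 1) * q ^+ b.
Proof.
case/andP=> q0 q1 ab ba; have qV : q^-1 * q = 1 by rewrite mulVf ?gt_eqF.
have hV : 1 <= q^-1 by rewrite invf_ge1 // ltW.
have [->|[->|->]] : a = b \/ a = b.+1 \/ b = a.+1 by lia.
- by rewrite subrr normr0 mulr_ge0 ?subr_ge0 // exprn_ge0 // ltW.
- have := exprn_gt0 b q0; rewrite exprS; move: (q ^+ b) => t t0.
  rewrite ger0_norm; last by nra.
  have : 1 - q <= q^-1 - 1 by nra.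
  by nra.
- have := exprn_gt0 a q0; rewrite exprS; move: (q ^+ a) => t t0.
  by rewrite ler0_norm ?mulrBl ?mulrA ?qV; nra.
Qed.

(** The vector with entries q^|i - i0| x i satisfies the same equations up to the commutator with
    the weight, whose relative size is q^-1 - 1. For q close to 1 the bound of [lower_bound], taken
    at a near-maximal entry, absorbs it. *)
Lemma exp_bound U V W DD :
  compact (U : set R[i]^o) -> compact (V : set R[i]^o) ->
  compact (W : set R[i]^o) -> admissible DD -> nullfree U V W DD ->
  exists C q : R, [/\ 0 < C, 0 < q, q < 1 & forall u v w D x M s i0,
    coefs U V W u v w -> DD D -> bdd x M -> supp D x -> 0 <= s ->
    (forall j, D j -> q ^+ (dst j i0) * normc (jac u v w x j) <= s) ->
    normc (x i0) <= C * s].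
Proof.
move=> Uc Vc Wc DDa nf; have [c c0 lb] := lower_bound Uc Vc Wc DDa nf.
have [K1 K10 UK] := compact_normc_bounded Uc.
have [K2 K20 WK] := compact_normc_bounded Wc.
pose K := K1 + K2; have K0 : 0 < K by rewrite /K; lra.
(* With q^-1 - 1 = eta the commutator contributes at most c * eta * K * 2|z j1| = |z j1| / 4. Only
   off-diagonal entries enter K, as the diagonal commutes with the weight. *)
pose eta := (8 * K * c)^-1.
have eta0 : 0 < eta by rewrite invr_gt0 !mulr_gt0.
have etaE : eta * (8 * K * c) = 1 by rewrite mulVf // gt_eqF // !mulr_gt0.
pose q := (1 + eta)^-1.
have q0 : 0 < q by rewrite invr_gt0; lra.
have q1 : q < 1 by rewrite invf_lt1; lra.
have qe : q^-1 - 1 = eta by rewrite invrK; lra.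
exists (4 * c), q; split => // [|u v w D x M s i0 cf DD0 xM xD s0 hs].
  by rewrite mulr_gt0.
have [xi0|xi0] := eqVneq (x i0) 0; first by rewrite xi0 normc0 !mulr_ge0 // ltW.
pose z (i : int) : R[i] := (q ^+ (dst i i0))%:C * x i.
have zE i : normc (z i) = q ^+ (dst i i0) * normc (x i).
  by rewrite normcM normc_real ger0_norm // exprn_ge0 // ltW.
have q01 : 0 < q < 1 by rewrite q0.
have zM i : normc (z i) <= M.
  rewrite zE; apply: le_trans (xM i).
  by rewrite ler_piMl ?normc_ge0 // exprn_ile1 // ltW.
have z0 : 0 < normc (z i0) by rewrite zE subrr /= mul1r normc_gt0.
have [j1 hj1] := near_sup (f := fun i => normc (z i)) zM z0.
have zi0 : normc (z i0) = normc (x i0) by rewrite zE subrr mul1r.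
suff hz : normc (z j1) <= c * (s + eta * K * (2 * normc (z j1))).
  have : normc (z j1) <= c * s + (eta * (8 * K * c)) * (normc (z j1) / 4) by move: hz; lra.
  by rewrite etaE -zi0; have := hj1 i0; lra.
apply: (lb u v w D z M _ cf DD0 zM).
- by move=> i nD; rewrite /z xD // mulr0.
- by rewrite addr_ge0 // !mulr_ge0 ?normc_ge0 // ltW.
move=> j Dj; have [Uj _ Wj] := cf j.
have hd (k : int) : (dst k j <= 1)%N ->
    normc ((q ^+ (dst k i0) - q ^+ (dst j i0))%:C * x k) <= eta * (2 * normc (z j1)).
  move=> kj; rewrite normcM normc_real.
  have := @expr_dist_le q (dst j i0) (dst k i0) q01 (dst_near i0 kj) (dst_near' i0 kj).
  rewrite qe => h; apply: le_trans (ler_wpM2r (normc_ge0 _) h) _.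
  by rewrite -mulrA -zE ler_wpM2l ?(ltW eta0).
have -> : jac u v w z j = (q ^+ (dst j i0))%:C * jac u v w x j +
    u j * ((q ^+ (dst (j - 1) i0) - q ^+ (dst j i0))%:C * x (j - 1)) +
    w j * ((q ^+ (dst (j + 1) i0) - q ^+ (dst j i0))%:C * x (j + 1)).
  by rewrite /jac /z !rmorphB /=; ring.
apply: le_trans (normc_add3 _ _ _) _.
rewrite !normcM normc_real ger0_norm ?exprn_ge0 ?(ltW q0) //.
rewrite -!normcM.
have h1 := ler_pM (normc_ge0 _) (normc_ge0 _) (UK _ Uj) (hd (j - 1) (dst_subr1 j)).
have h2 := ler_pM (normc_ge0 _) (normc_ge0 _) (WK _ Wj) (hd (j + 1) (dst_addr1 j)).
move: h1 h2 (hs j Dj); rewrite -!normcM /K; lra.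
Qed.

End ExpBound.

(** * Reflection and transposition *)

Section Symmetry.
Variable R : realType.
Implicit Types (u v w x y : int -> R[i]) (U V W : set R[i]) (D E : set int).

Lemma jac_opp u v w x i :
  jac (fun i => w (- i)) (fun i => v (- i)) (fun i => u (- i)) (fun i => x (- i)) i =
  jac u v w x (- i).
Proof.
have e1 : - (i - 1) = - i + 1 by lia.
have e2 : - (i + 1) = - i - 1 by lia.
by rewrite /jac e1 e2 [LHS]addrC [LHS]addrA [LHS]addrAC.
Qed.

Lemma coefs_opp U V W u v w : coefs U V W u v w ->
  coefs W V U (fun i => w (- i)) (fun i => v (- i)) (fun i => u (- i)).
Proof. by move=> cf i; have [] := cf (- i). Qed.

Definition oppc (DD : set (set int)) : set (set int) :=
  [set D | DD [set i | D (- i)]].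

Lemma nullfree_opp U V W (DD : set (set int)) :
  nullfree U V W DD -> nullfree W V U (oppc DD).
Proof.
move=> nf u v w D x M /coefs_opp cf DDD xM xD hj i.
rewrite -(opprK i); apply: (nf _ _ _ _ (fun i => x (- i)) M cf DDD).
- by move=> j; apply: xM.
- by move=> j /= nD; apply: xD.
- by move=> j /= Dj; rewrite jac_opp hj.
Qed.

Lemma coefs_tr U V W u v w : coefs U V W u v w ->
  coefs W V U (fun i => w (i - 1)) v (fun i => u (i + 1)).
Proof. by move=> cf i; split; [case: (cf (i - 1))|case: (cf i)|case: (cf (i + 1))]. Qed.

(** Row i of the transpose: its off-diagonal entries come from the rows i - 1 and i + 1, hence the
    shifts in [w] and [u]. *)
Definition jacT u v w := jac (fun i => w (i - 1)) v (fun i => u (i + 1)).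

Lemma nullfree_sub U V W (DD EE : set (set int)) :
  DD `<=` EE -> nullfree U V W EE -> nullfree U V W DD.
Proof. by move=> DE nf u v w D x M cf /DE; exact: nf. Qed.

Lemma oppcT : [set setT] `<=` oppc [set setT].
Proof. by move=> D -> /=; apply/seteqP. Qed.

Lemma oppc_upc : upc `<=` oppc downc.
Proof. by move=> D Du i j /= Di ij; apply: Du Di _; lia. Qed.

Lemma oppc_downc : downc `<=` oppc upc.
Proof. by move=> D Du i j /= Di ij; apply: Du Di _; lia. Qed.

Lemma oppc_convc : convc `<=` oppc convc.
Proof. by move=> D Du i j k /= Di Dk ij; apply: Du Dk Di _; lia. Qed.

End Symmetry.

(** * Duality and solvability *)

Section DualSolve.
Variable R : realType.

Lemma mulr_conjc (z : R[i]) : z * z^*%C = (normc z ^+ 2)%:C.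
Proof. by rewrite -sqr_normc normcE' rmorphXn. Qed.

Lemma normc_conjc (z : R[i]) : normc z^*%C = normc z.
Proof. by apply: (@complexI R); rewrite -!normcE' normcJ. Qed.

(** The vector [g] is the solution of A g = e_j for which the sum of |g_i / om_i|^2 is least; it has
    the form D A^H y^H, with D the squared weights. For t_i = |g_i| / om_i this gives sum t_i^2 =
    |y_j| <= c max t, hence max t <= c: the constant of the dual bound is reproduced. Zero columns
    of A give zero entries of g, which later confines supports. *)
Lemma dual_solve m n (A : 'M[R[i]]_(m, n)) (j : 'I_m) (om : 'I_n -> R) (c : R) :
  0 <= c -> (forall i, 0 < om i) ->
  (forall (y : 'rV_m) s, 0 <= s ->
     (forall i, om i * normc ((y *m A) 0 i) <= s) -> normc (y 0 j) <= c * s) ->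
  exists g : 'cV_n, [/\ A *m g = delta_mx j 0,
    forall i, normc (g i 0) <= c * om i & forall i, col i A = 0 -> g i 0 = 0].
Proof.
move=> c0 om0 H.
pose D : 'rV_n := \row_i ((om i) ^+ 2)%:C.
pose G := diag_mx D *m (map_mx (conjc (R := R)) A)^T.
have GE (y : 'rV_m) i : (G *m (map_mx (conjc (R := R)) y)^T) i 0 =
    ((om i) ^+ 2)%:C * ((y *m A) 0 i)^*%C.
  rewrite -mulmxA -trmx_mul mul_diag_mx !mxE; congr (_ * _).
  by rewrite rmorph_sum; apply: eq_bigr => k _; rewrite !mxE rmorphM.
have QE (y : 'rV_m) : (y *m A *m (G *m (map_mx (conjc (R := R)) y)^T)) 0 0 =
    (\sum_i (om i * normc ((y *m A) 0 i)) ^+ 2)%:C.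
  rewrite mxE rmorph_sum; apply: eq_bigr => i _.
  by rewrite GE mulrCA mulr_conjc -rmorphM exprMn.
have [y yE] : exists y : 'rV_m, A *m (G *m (map_mx (conjc (R := R)) y)^T) = delta_mx j 0.
  (* The unit vector is in the range of A D A^H: a left null vector z of this matrix has zA = 0, and
     the hypothesis with s = 0 gives z_j = 0. *)
  suff /submxP[B hB] : ((delta_mx j 0 : 'cV_m)^T <= (A *m G)^T)%MS.
    exists (map_mx (conjc (R := R)) B); rewrite -[RHS]trmxK hB trmx_mul trmxK.
    rewrite (_ : map_mx _ _ = B) ?[LHS]mulmxA //.
    by apply/matrixP => a b; rewrite !mxE conjcK.
  rewrite submxE; apply/eqP/matrixP => a b; rewrite [RHS]mxE ord1.
  pose z : 'rV_m := (col b (cokermx (A *m G)^T))^T.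
  have zA : z *m (A *m G) = 0.
    apply: trmx_inj; rewrite trmx_mul trmx0.
    by rewrite trmxK colE mulmxA mulmx_coker mul0mx.
  have := QE z; rewrite mulmxA -(mulmxA z) zA mul0mx mxE => /esym/eqP.
  rewrite -(rmorph0 (real_complex R)) (inj_eq (@complexI R)) psumr_eq0; last first.
    by move=> i _; exact: sqr_ge0.
  move=> /allP h.
  have := H z 0 (lexx _); rewrite mulr0 => hz.
  have : normc (z 0 j) <= 0.
    apply: hz => i; have := h i (mem_index_enum i).
    by rewrite sqrf_eq0 => /eqP ->.
  rewrite le_eqVlt ltNge normc_ge0 orbF normc_eq0 => /eqP zj.
  rewrite mxE (bigD1 j) //= big1 ?addr0 => [|k kj].
    by move: zj; rewrite !mxE !eqxx mul1r.
  by rewrite !mxE (negbTE kj) mul0r.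
pose t i := om i * normc ((y *m A) 0 i).
exists (G *m (map_mx (conjc (R := R)) y)^T).
have gE i : normc ((G *m (map_mx (conjc (R := R)) y)^T) i 0) = om i * t i.
  rewrite GE normcM normc_conjc normc_real ger0_norm ?sqr_ge0 //.
  by rewrite expr2 -mulrA.
have t0 i : 0 <= t i by rewrite mulr_ge0 ?normc_ge0 // ltW.
split=> // i; last first.
  move=> /matrixP ci; rewrite GE mxE big1 ?conjc0 ?mulr0 // => k _.
  by have := ci k 0; rewrite !mxE => ->; rewrite mulr0.
rewrite gE mulrC ler_wpM2r ?(ltW (om0 _)) //.
have yj : normc (y 0 j) = \sum_i t i ^+ 2.
  have := QE y; rewrite -mulmxA yE mxE (bigD1 j) //= big1 ?addr0 => [|k kj].
    rewrite mxE !eqxx mulr1 => ->; rewrite normc_real ger0_norm //.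
    by apply: sumr_ge0 => k _; exact: sqr_ge0.
  by rewrite mxE (negbTE kj) mulr0.
pose i1 := [arg max_(k > i) t k]%O.
have ti1 k : t k <= t i1 by rewrite /i1; case: arg_maxP => // l _; apply.
apply: le_trans (ti1 i) _.
have := H y (t i1) (t0 _) ti1; rewrite yj (bigD1 i1) //= => h.
have h2 : 0 <= \sum_(k | k != i1) t k ^+ 2 by apply: sumr_ge0 => k _; exact: sqr_ge0.
have [->//|ti0] := eqVneq (t i1) 0.
have tp : 0 < t i1 by rewrite lt_def ti0 t0.
by rewrite -(ler_pM2r tp) -expr2; move: h; lra.
Qed.

End DualSolve.

Section Geometric.
Variable R : realType.

(** Distinct integers take each absolute value at most twice. *)
Lemma geometric_abs_le (q : R) (s : seq int) : 0 < q -> q < 1 -> uniq s ->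
  \sum_(k <- s) q ^+ absz k <= 2 / (1 - q).
Proof.
move=> q0 q1 us; pose N := (\max_(k <- s) absz k).+1.
have sN k : k \in s -> (absz k < N)%N by move=> ks; rewrite ltnS leq_bigmax_seq.
have -> : \sum_(k <- s) q ^+ absz k =
    \sum_(k <- s) \sum_(n < N | n == absz k :> nat) q ^+ n.
  rewrite !big_seq; apply: eq_bigr => k ks.
  rewrite (big_pred1 (Ordinal (sN k ks))) //.
rewrite (exchange_big_dep predT) //=.
apply: (@le_trans _ _ (\sum_(n < N) 2 * q ^+ n)).
  apply: ler_sum => n _; rewrite big_const_seq iter_addr_0 -(mulr_natl (q ^+ n) (count _ _)).
  rewrite ler_wpM2r ?exprn_ge0 ?(ltW q0) // ler_nat.
  have -> : count (fun k : int => n == absz k :> nat) s =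
      size [seq k <- s | n == absz k :> nat] by rewrite size_filter.
  apply: (@uniq_leq_size _ _ [:: n%:Z; - n%:Z]); first exact: filter_uniq.
  by move=> k; rewrite mem_filter !inE => /andP[/eqP -> _]; lia.
rewrite -mulr_sumr ler_pM2l // -[leRHS]mul1r ler_pdivlMr ?subr_gt0 //.
by have := subrX1 q N; have := exprn_ge0 N (ltW q0); lra.
Qed.

Lemma geometric_dst_le (q : R) (i : int) (s : seq int) : 0 < q -> q < 1 -> uniq s ->
  \sum_(k <- s) q ^+ dst i k <= 2 / (1 - q).
Proof.
move=> q0 q1 us; rewrite -(big_map (fun k => i - k) predT (fun k => q ^+ absz k)).
by apply: geometric_abs_le => //; rewrite map_inj_uniq // => a b /addrI /oppr_inj.
Qed.

End Geometric.

Section Solve.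
Variable R : realType.
Implicit Types (u v w x y : int -> R[i]) (U V W : set R[i]) (D E : set int).

Definition entry u v w (i k : int) : R[i] :=
  (k == i - 1)%:R * u i + (k == i)%:R * v i + (k == i + 1)%:R * w i.

Lemma sum_window (lo k : int) n (F : int -> R[i]) :
  \sum_(b < n) (lo + b%:Z == k)%:R * F (lo + b%:Z) =
  if (lo <= k) && (k < lo + n%:Z) then F k else 0.
Proof.
case: ifP => [/andP[h1 h2]|h].
  have hb : (absz (k - lo) < n)%N by lia.
  rewrite (bigD1 (Ordinal hb)) //= big1 ?addr0 => [|b bk].
    have -> : lo + absz (k - lo) = k by lia.
    by rewrite eqxx mulr1n mul1r.
  case: (lo + b%:Z =P k) => [e|]; rewrite ?mul0r //; case/negP: bk; apply/eqP/val_inj => /=; lia.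
rewrite big1 // => b _; case: (lo + b%:Z =P k) => [e|]; rewrite ?mul0r //.
by have := ltn_ord b; lia.
Qed.

Lemma sum_entry u v w (x : int -> R[i]) (lo i : int) n :
  lo <= i - 1 -> i + 1 < lo + n%:Z ->
  \sum_(b < n) entry u v w i (lo + b%:Z) * x (lo + b%:Z) = jac u v w x i.
Proof.
move=> h1 h2; rewrite /entry.
under eq_bigr do rewrite !mulrDl -!mulrA.
rewrite !big_split /= (sum_window _ _ _ (fun k => u i * x k)).
rewrite (sum_window _ _ _ (fun k => v i * x k)) (sum_window _ _ _ (fun k => w i * x k)).
by rewrite /jac !ifT //; apply/andP; split; lia.
Qed.

Lemma sum_entryT u v w (y : int -> R[i]) (lo k : int) n :
  (forall i, ~ (lo <= i < lo + n%:Z) -> y i = 0) ->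
  \sum_(a < n) y (lo + a%:Z) * entry u v w (lo + a%:Z) k = jacT u v w y k.
Proof.
move=> ys.
rewrite (eq_bigr (fun a : 'I_n => (lo + a%:Z == k + 1)%:R * (y (lo + a%:Z) * u (lo + a%:Z)) +
  (lo + a%:Z == k)%:R * (y (lo + a%:Z) * v (lo + a%:Z)) +
  (lo + a%:Z == k - 1)%:R * (y (lo + a%:Z) * w (lo + a%:Z)))); last first.
  move=> a _; rewrite /entry.
  have -> : (k == lo + a%:Z - 1) = (lo + a%:Z == k + 1) by lia.
  have -> : (k == lo + a%:Z) = (lo + a%:Z == k) by lia.
  have -> : (k == lo + a%:Z + 1) = (lo + a%:Z == k - 1) by lia.
  by rewrite !mulrDr !(mulrCA (y _)).
rewrite !big_split /= (sum_window _ _ _ (fun k => y k * u k)).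
rewrite (sum_window _ _ _ (fun k => y k * v k)) (sum_window _ _ _ (fun k => y k * w k)).
have e j (f : int -> R[i]) : (if (lo <= j) && (j < lo + n) then y j * f j else 0) = f j * y j.
  by case: ifPn => [_|/negP h]; [rewrite mulrC|rewrite ys // mulr0].
by rewrite !e /jacT /jac [LHS]addrC [LHS]addrA [LHS]addrAC.
Qed.

(** D indexes the equations to be solved and E the unknowns: this is the a priori bound for the
    transposed system, in which the two roles are exchanged. *)
Definition dual_bound u v w D E (C q : R) := forall y M s j,
  bdd y M -> supp D y -> 0 <= s ->
  (forall i, E i -> q ^+ dst i j * normc (jacT u v w y i) <= s) ->
  normc (y j) <= C * s.

(** Imposing only the equations within distance m of j makes the problem finite-dimensional; the
    bound on g does not depend on m. *)
Lemma solve_delta_window u v w D E C q (j : int) (m : nat) :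
  0 < C -> 0 < q -> dual_bound u v w D E C q -> D j ->
  exists g, [/\ supp E g, forall i, normc (g i) <= C * q ^+ dst i j &
    forall i, D i -> (dst i j <= m)%N -> jac u v w g i = (i == j)%:R].
Proof.
move=> C0 q0 HT Dj.
pose r (a : nat) : int := j - m%:Z + a%:Z; pose cc (b : nat) : int := j - m%:Z - 1 + b%:Z.
(* The columns reach one site further than the rows on both sides, so that each row keeps its three
   entries. Columns outside of E are zeroed, and [dual_solve] then gives g = 0 there. *)
pose A : 'M[R[i]]_((m + m).+1, (m + m).+3) := \matrix_(a, b)
  (`[< D (r a) >]%:R * `[< E (cc b) >]%:R * entry u v w (r a) (cc b)).
pose om (b : 'I_(m + m).+3) := q ^+ dst (cc b) j.
have om0 b : 0 < om b by exact: exprn_gt0.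
have rj : r m = j by rewrite /r; lia.
have jm : (m < (m + m).+1)%N by lia.
have HA (y : 'rV_((m + m).+1)) s : 0 <= s ->
     (forall i, om i * normc ((y *m A) 0 i) <= s) -> normc (y 0 (Ordinal jm)) <= C * s.
  move=> s0 hy.
  pose ye (i : int) : R[i] := if (j - m%:Z <= i) && (i < j - m%:Z + (m + m).+1%:Z)
    then `[< D i >]%:R * y 0 (inord (dst i (j - m%:Z))) else 0.
  have yer (a : 'I_(m + m).+1) : ye (r a) = `[< D (r a) >]%:R * y 0 a.
    have := ltn_ord a => ha; rewrite /ye ifT; last by rewrite /r; lia.
    congr (_ * y 0 _); apply: val_inj; rewrite /= inordK /r; lia.
  have -> : y 0 (Ordinal jm) = ye j.
    by have := yer (Ordinal jm); rewrite /= rj asboolT // mulr1n mul1r.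
  apply: (HT ye (\sum_a normc (y 0 a))) => // [i|i nD|i Ei].
  - rewrite /ye; case: ifP => _; last by rewrite normc0 sumr_ge0 // => *; exact: normc_ge0.
    rewrite (bigD1 (inord (dst i (j - m%:Z)))) //= normcM.
    apply: ler_wpDr; first by rewrite sumr_ge0 // => *; exact: normc_ge0.
    by case: `[< _ >]; rewrite ?mulr1n ?mulr0n ?normc1 ?normc0 ?mul1r ?mul0r ?normc_ge0.
  - by rewrite /ye asboolF // mulr0n mul0r if_same.
  have eT := sum_entryT u v w (y := ye) (lo := j - m%:Z)
    (n := (m + m).+1) i.
  rewrite -eT => [|k hk]; last by rewrite /ye; case: ifP.
  have [hi|hi] := boolP ((j - m%:Z - 1 <= i) && (i < j - m%:Z - 1 + (m + m).+3%:Z)); last first.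
    rewrite big1 ?normc0 ?mulr0 // => a _; have := ltn_ord a => ha.
    have e1 : (i == j - m%:Z + a%:Z - 1) = false by move: hi ha; clear; lia.
    have e2 : (i == j - m%:Z + a%:Z) = false by move: hi ha; clear; lia.
    have e3 : (i == j - m%:Z + a%:Z + 1) = false by move: hi ha; clear; lia.
    by rewrite /entry e1 e2 e3 mulr0n !mul0r !addr0 mulr0.
  have hib : (dst i (j - m%:Z - 1) < (m + m).+3)%N by lia.
  have := hy (Ordinal hib); rewrite /om /= (_ : cc _ = i); last by rewrite /cc; lia.
  rewrite mxE; congr (_ * normc _ <= _); apply: eq_bigr => a _.
  rewrite -[j - m%:Z + a]/(r a) yer mxE /= (_ : cc _ = i); last by rewrite /cc; lia.
  by rewrite (asboolT Ei) mulr1n mulr1 mulrA [_ * y 0 a]mulrC.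
have [g [gA gb gE]] := dual_solve (ltW C0) om0 HA.
pose ge (i : int) : R[i] := if (j - m%:Z - 1 <= i) && (i < j - m%:Z - 1 + (m + m).+3%:Z)
    then g (inord (dst i (j - m%:Z - 1))) 0 else 0.
have gec (b : 'I_(m + m).+3) : ge (cc b) = g b 0.
  have := ltn_ord b => hb; rewrite /ge ifT; last by rewrite /cc; lia.
  congr (g _ 0); apply: val_inj; rewrite /= inordK /cc; lia.
have cci i : (j - m%:Z - 1 <= i) && (i < j - m%:Z - 1 + (m + m).+3%:Z) ->
    exists b : 'I_(m + m).+3, i = cc b.
  move=> hi; have hib : (dst i (j - m%:Z - 1) < (m + m).+3)%N by lia.
  by exists (Ordinal hib); rewrite /cc /=; lia.
have geE i : ~ E i -> ge i = 0.
  move=> nE; have [/cci[b ib]|/negbTE hi] :=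
    boolP ((j - m%:Z - 1 <= i) && (i < j - m%:Z - 1 + (m + m).+3%:Z)); last by rewrite /ge hi.
  rewrite ib gec gE //; apply/matrixP => a k; rewrite !mxE -ib (asboolF nE).
  by rewrite mulr0n mulr0 mul0r.
exists ge; split=> // [i|i Di im].
  have [/cci[b ->]|/negbTE hi] :=
    boolP ((j - m%:Z - 1 <= i) && (i < j - m%:Z - 1 + (m + m).+3%:Z)).
    by rewrite gec gb.
  by rewrite /ge hi normc0 mulr_ge0 ?exprn_ge0 // ltW.
have hia : (dst i (j - m%:Z) < (m + m).+1)%N by lia.
have ria : r (Ordinal hia) = i by rewrite /r /=; lia.
rewrite -(@sum_entry u v w ge (j - m%:Z - 1) i (m + m).+3); [|lia|lia].
have /matrixP/(_ (Ordinal hia) 0) := gA; rewrite !mxE andbT => h.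
transitivity ((Ordinal hia == Ordinal jm)%:R : R[i]); last first.
  congr (_%:R); congr nat_of_bool; apply/eqP/eqP => [/(congr1 val) /= e|e].
    by move: e ria; rewrite /r /=; clear; lia.
  by apply: val_inj => /=; move: e; clear; lia.
rewrite -h; apply: eq_bigr => b _; rewrite -[j - m%:Z - 1 + b]/(cc b) gec mxE ria.
rewrite (asboolT Di) mulr1n mul1r; have [Eb|nE] := pselect (E (cc b)).
  by rewrite asboolT // mulr1n mul1r.
have gb0 : g b 0 = 0 by rewrite -gec geE.
by rewrite gb0 !mulr0.
Qed.

Lemma ulim_jac F u v w (xk : nat -> int -> R[i]) x i : Filter F ->
  (forall i, ulim F (fun k => xk k i) (x i)) ->
  ulim F (fun k => jac u v w (xk k) i) (jac u v w x i).
Proof.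
move=> FF h; rewrite /jac.
exact: (ulimD (ulimD (ulimM (ulim_cst _) (h _)) (ulimM (ulim_cst _) (h _)))
  (ulimM (ulim_cst _) (h _))).
Qed.

(** The equation in row i holds for all windows with m at least |i - j|, hence for their limit. *)
Lemma solve_delta u v w D E C q (j : int) :
  0 < C -> 0 < q -> q < 1 -> dual_bound u v w D E C q -> D j ->
  exists g, [/\ supp E g, forall i, normc (g i) <= C * q ^+ dst i j &
    forall i, D i -> jac u v w g i = (i == j)%:R].
Proof.
move=> C0 q0 q1 HT Dj.
have /choice[g hg] := fun m => solve_delta_window m C0 q0 HT Dj.
have [F [FU Fn]] := ultra_eventually.
have H i : exists l, normc l <= C * q ^+ dst i j /\ ulim F (fun k => g k i) l.
  have [|l] := ulim_bounded (F := F) (z := fun k => g k i) (M := C * q ^+ dst i j).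
    by move=> k; have [_ ] := hg k.
  by exists l.
have {H}[l hl] := choice H.
exists l; split=> [i nE|i|i Di]; last 1 first.
- have lj : ulim F (fun k => jac u v w (g k) i) (jac u v w l i).
    by apply: ulim_jac => k; exact: (hl k).2.
  apply: (ulim_unique lj); apply: ulim_near (ulim_cst _).
  by apply: filterS (Fn (dst i j)) => k /= hk; have [_ _ ->] := hg k.
- apply: (ulim_unique (hl i).2); apply: ulim_near (ulim_cst _).
  by apply: filterE => k /=; have [->] := hg k.
- by case: (hl i).
Qed.

Lemma jac_sum u v w (I : Type) (s : seq I) (c : I -> R[i]) (g : I -> int -> R[i]) i :
  jac u v w (fun i => \sum_(k <- s) c k * g k i) i = \sum_(k <- s) c k * jac u v w (g k) i.
Proof.
rewrite /jac !mulr_sumr -!big_split /=; apply: eq_bigr => k _; ring.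
Qed.

(** Superposition of the responses g j to unit data. Half of their decay is spent on summing over j,
    the other half on pairing with the weighted bound on b. *)
Lemma solve u v w D E C q :
  0 < C -> 0 < q -> q < 1 -> dual_bound u v w D E C q ->
  forall (b : int -> R[i]) B, bdd b B -> exists x, [/\ supp E x,
    forall i s, 0 <= s -> (forall j, D j -> ((1 + q) / 2) ^+ dst i j * normc (b j) <= s) ->
      normc (x i) <= (C * (2 / (1 - (1 + q) / 2))) * s &
    forall i, D i -> jac u v w x i = b i].
Proof.
move=> C0 q0 q1 HT b B bB.
have H j : exists g, D j -> [/\ supp E g, forall i, normc (g i) <= C * q ^+ dst i j &
    forall i, D i -> jac u v w g i = (i == j)%:R].
  have [Dj|nD] := pselect (D j); last by exists (fun=> 0) => /nD.
  by have [g hg] := solve_delta C0 q0 q1 HT Dj; exists g.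
have {H}[g hg] := choice H.
(* The arithmetic mean of 1 and q satisfies q2^2 >= q: one factor q2 is summed, the other is matched
   with s. *)
set q2 := (1 + q) / 2.
have q20 : 0 < q2 by rewrite /q2; lra.
have q21 : q2 < 1 by rewrite /q2; lra.
have qq : q <= q2 ^+ 2 by rewrite /q2 expr2; have := sqr_ge0 (1 - q); rewrite expr2; lra.
pose win (m : nat) : seq int := [seq a%:Z - m%:Z | a <- iota 0 (m + m).+1].
have uwin m : uniq (win m).
  by rewrite map_inj_uniq ?iota_uniq // => a c /addIr [].
have mwin m i : (absz i <= m)%N -> i \in win m.
  move=> im; apply/mapP; exists (absz (i + m%:Z)); last lia.
  by rewrite mem_iota; lia.
pose c j := `[< D j >]%:R * b j.
(* The series is an ultrafilter limit of partial sums, in which the equation of row i is exact once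
   i lies in the window. *)
pose xm m i := \sum_(j <- win m) c j * g j i.
have xmb m i s : 0 <= s -> (forall j, D j -> q2 ^+ dst i j * normc (b j) <= s) ->
    normc (xm m i) <= (C * (2 / (1 - q2))) * s.
  move=> s0 hs; apply: le_trans (le_normc_sum _ _ _) _.
  apply: (@le_trans _ _ (\sum_(j <- win m) (C * s) * q2 ^+ dst i j)).
    apply: ler_sum => j _; rewrite /c !normcM.
    have [Dj|nD] := pselect (D j); last first.
      rewrite (asboolF nD) mulr0n normc0 !mul0r; apply: mulr_ge0; last by rewrite exprn_ge0 // ltW.
      by rewrite mulr_ge0 // ltW.
    rewrite (asboolT Dj) mulr1n normc1 mul1r.
    have [_ /(_ i) gi _] := hg j Dj.
    apply: le_trans (ler_wpM2l (normc_ge0 _) gi) _.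
    have h1 : q ^+ dst i j <= q2 ^+ dst i j * q2 ^+ dst i j.
      rewrite -expr2 -exprM mulnC exprM; apply: lerXn2r => //; rewrite nnegrE.
        exact: ltW.
      by apply: exprn_ge0; exact: ltW.
    have h2 := hs j Dj; have h3 := exprn_ge0 (dst i j) (ltW q20).
    have h4 := normc_ge0 (b j).
    move: (q ^+ _) (q2 ^+ _) (normc (b j)) h1 h2 h3 h4 => t r z h1 h2 h3 h4.
    have h5 : z * t <= z * (r * r) by rewrite ler_wpM2l.
    have h6 : (r * z) * r <= s * r by rewrite ler_wpM2r.
    rewrite mulrCA -mulrA ler_pM2l //; lra.
  rewrite -mulr_sumr [leRHS]mulrAC ler_wpM2l //; last exact: geometric_dst_le.
  by rewrite mulr_ge0 // ltW.
have bB0 : 0 <= B by apply: le_trans (normc_ge0 (b 0)) (bB 0).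
have xmB i m : normc (xm m i) <= (C * (2 / (1 - q2))) * B.
  apply: xmb => // j _; rewrite -[leRHS]mul1r; apply: ler_pM; rewrite ?normc_ge0 //.
    by rewrite exprn_ge0 // ltW.
  by rewrite exprn_ile1 // ltW.
have [F [FU Fn]] := ultra_eventually.
have H i : exists l, ulim F (fun k => xm k i) l.
  by have [l _] := ulim_bounded (F := F) (xmB i); exists l.
have {H}[x hx] := choice H.
exists x; split=> [i nE|i s s0 hs|i Di].
- apply: (ulim_unique (hx i)); apply: ulim_near (ulim_cst _).
  apply: filterE => k /=; rewrite /xm big1 // => j _; rewrite /c.
  have [Dj|nD] := pselect (D j); last by rewrite (asboolF nD) mulr0n !mul0r.
  by have [-> //] := hg j Dj; rewrite mulr0.
- by apply: ulim_le (hx i) _; apply: filterE => k /=; exact: xmb.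
have lj : ulim F (fun k => jac u v w (xm k) i) (jac u v w x i).
  by apply: ulim_jac => k; exact: hx.
apply: (ulim_unique lj); apply: ulim_near (ulim_cst _).
apply: filterS (Fn (absz i)) => k /= hk.
rewrite /xm jac_sum (bigD1_seq i (mwin k i hk) (uwin k)) /= big1_seq => [|j /andP[ji _]].
  by have [_ _ ->] := hg i Di; rewrite // eqxx /c asboolT // !mulr1n mulr1 mul1r addr0.
rewrite /c; have [Dj|nD] := pselect (D j); last by rewrite (asboolF nD) mulr0n !mul0r.
by have [_ _ ->] := hg j Dj; rewrite // eq_sym (negbTE ji) mulr0.
Qed.

End Solve.

(** * Pasting null vectors of half-lines *)

Section Glue.
Variable R : realType.
Implicit Types (u v w x y : int -> R[i]) (U V W : set R[i]) (D E : set int).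

Definition transl k (x : int -> R[i]) (i : int) : R[i] := x (i + k).

Lemma jac_transl k u v w x i :
  jac (transl k u) (transl k v) (transl k w) (transl k x) i = jac u v w x (i + k).
Proof. by rewrite /jac /transl (addrAC i (-1)) (addrAC i 1). Qed.

Lemma coefs_transl k U V W u v w : coefs U V W u v w ->
  coefs U V W (transl k u) (transl k v) (transl k w).
Proof. by move=> cf i; exact: cf. Qed.

Lemma jacZ c u v w x i : jac u v w (fun i => c * x i) i = c * jac u v w x i.
Proof. by rewrite /jac; ring. Qed.

Lemma jacD u v w x y i : jac u v w (fun i => x i + y i) i = jac u v w x i + jac u v w y i.
Proof. by rewrite /jac; ring. Qed.

Lemma suppT x : supp setT x.
Proof. by move=> i /(_ I). Qed.

Lemma least_index (P : set int) (k i : int) : P i -> (forall j, P j -> k <= j) ->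
  exists l, P l /\ forall j, P j -> l <= j.
Proof.
move=> Pi kP; have ex : exists n : nat, `[< P (k + n%:Z) >].
  exists (absz (i - k)); apply/asboolP; have := kP _ Pi => ki.
  by rewrite (_ : k + _ = i) //; lia.
case: (ex_minnP ex) => n /asboolP Pn hn; exists (k + n%:Z); split=> // j Pj.
have kj := kP _ Pj; have : (n <= absz (j - k))%N; last by lia.
by apply: hn; apply/asboolP; rewrite (_ : k + _ = j) //; lia.
Qed.

Lemma greatest_index (P : set int) (k i : int) : P i -> (forall j, P j -> j <= k) ->
  exists l, P l /\ forall j, P j -> j <= l.
Proof.
move=> Pi kP; have [||l [Pl hl]] := @least_index [set j | P (- j)] (- k) (- i).
- by rewrite /= opprK.
- by move=> j /= /kP; lia.
- by exists (- l); split=> // j Pj; have := hl (- j); rewrite /= opprK => /(_ Pj); lia.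
Qed.

Lemma not_nullfree U V W DD : ~ nullfree U V W DD -> exists u v w D x M i,
  [/\ coefs U V W u v w, DD D, bdd x M, supp D x &
      (forall i, D i -> jac u v w x i = 0) /\ x i <> 0].
Proof.
move=> h; apply: contrapT => hn; apply: h => u v w D x M cf DDD xM xD hx i.
by apply: contrapT => xi; apply: hn; exists u, v, w, D, x, M, i.
Qed.

(** Extended by zero, x is null also in row 0 because x 1 = 0, and so on all of Z. Hence a null
    vector on a right half-line is determined by its first entry. *)
Lemma null_up_first U V W u v w x M : nullfree U V W [set setT] ->
  coefs U V W u v w -> bdd x M -> (forall i, i <= 0 -> x i = 0) ->
  (forall i, 1 <= i -> jac u v w x i = 0) -> x 1 = 0 -> forall i, x i = 0.
Proof.
move=> nf cf xM x0 hx x1; apply: (nf u v w setT x M cf erefl xM (suppT x)) => i _.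
have [i1|i1] := leP 1 i; first exact: hx.
rewrite /jac (x0 i) 1?(x0 (i - 1)); [|lia|lia].
have [->|i0] := eqVneq i 0; first by rewrite add0r x1 !mulr0 !addr0.
by rewrite x0 ?mulr0 ?addr0 //; lia.
Qed.

Lemma not_nullfree_upc U V W : nullfree U V W [set setT] -> ~ nullfree U V W upc ->
  exists u v w x M, [/\ coefs U V W u v w, bdd x M, forall i, i <= 0 -> x i = 0,
    forall i, 1 <= i -> jac u v w x i = 0 & x 1 <> 0].
Proof.
move=> nf /not_nullfree[u [v [w [D [x [M [i [cf uD xM xD [hx xi]]]]]]]]].
have Di : D i by apply: contrapT => /xD.
have [k nDk] : exists k, ~ D k.
  apply: contrapT => h; apply: xi; apply: (nf u v w setT x M cf erefl xM (suppT x)) => j _.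
  by apply: hx; apply: contrapT => nDj; apply: h; exists j.
have [|l [Dl hl]] := least_index (k := k) Di.
  by move=> j Dj; rewrite leNgt; apply/negP => jk; apply: nDk; apply: uD Dj _; exact: ltW.
have cf' := coefs_transl (l - 1) cf.
have xM' : bdd (transl (l - 1) x) M by move=> j; exact: xM.
have x0 j : j <= 0 -> transl (l - 1) x j = 0.
  by move=> j0; apply: xD => /hl; lia.
have hx' j : 1 <= j -> jac (transl (l - 1) u) (transl (l - 1) v) (transl (l - 1) w)
    (transl (l - 1) x) j = 0.
  by move=> j1; rewrite jac_transl hx //; apply: uD Dl _; lia.
exists (transl (l - 1) u), (transl (l - 1) v), (transl (l - 1) w), (transl (l - 1) x), M.
split=> // x1; apply: xi; have := null_up_first nf cf' xM' x0 hx' x1 (i - (l - 1)).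
by rewrite /transl subrK.
Qed.

Lemma nullfree_upc_opp U V W : nullfree W V U upc <-> nullfree U V W downc.
Proof.
split=> /nullfree_opp; apply: nullfree_sub; [exact: oppc_downc|exact: oppc_upc].
Qed.

Lemma nullfreeT_opp U V W : nullfree U V W [set setT] -> nullfree W V U [set setT].
Proof. by move=> /nullfree_opp; apply: nullfree_sub; exact: oppcT. Qed.

Lemma not_nullfree_downc U V W : nullfree U V W [set setT] -> ~ nullfree U V W downc ->
  exists u v w x M, [/\ coefs U V W u v w, bdd x M, forall i, 0 <= i -> x i = 0,
    forall i, i <= -1 -> jac u v w x i = 0 & x (-1) <> 0].
Proof.
move=> nf ndown; have nup : ~ nullfree W V U upc by rewrite nullfree_upc_opp.
have [u [v [w [x [M [cf xM x0 hx x1]]]]]] := not_nullfree_upc (nullfreeT_opp nf) nup.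
exists (fun i => w (- i)), (fun i => v (- i)), (fun i => u (- i)), (fun i => x (- i)), M.
split=> [|i|i i0|i i0|].
- exact: coefs_opp.
- exact: xM.
- by apply: x0; lia.
- by rewrite jac_opp hx //; lia.
- by rewrite opprK.
Qed.

Definition join (a b : int -> R[i]) (i : int) : R[i] := if i <= 0 then a i else b i.

Lemma coefs_join U V W uL vL wL uR vR wR :
  coefs U V W uL vL wL -> coefs U V W uR vR wR ->
  coefs U V W (join uL uR) (join vL vR) (join wL wR).
Proof. by move=> cL cR i; rewrite /join; case: ifP => _; [exact: cL|exact: cR]. Qed.

(* A left solution y, the value g at 0 and a right solution x of two different
   operators are pasted into a solution of one bi-infinite operator. *)
Lemma paste_null U V W uL vL wL uR vR wR y x g My Mx :
  nullfree U V W [set setT] ->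
  coefs U V W uL vL wL -> coefs U V W uR vR wR -> bdd y My -> bdd x Mx ->
  (forall i, 0 <= i -> y i = 0) -> (forall i, i <= 0 -> x i = 0) ->
  (forall i, i <= -1 -> jac uL vL wL y i = if i == -1 then - (wL (-1) * g) else 0) ->
  uL 0 * y (-1) + vL 0 * g + wL 0 * x 1 = 0 ->
  (forall i, 1 <= i -> jac uR vR wR x i = if i == 1 then - (uR 1 * g) else 0) ->
  [/\ forall i, y i = 0, g = 0 & forall i, x i = 0].
Proof.
move=> nf cL cR yM xM y0 x0 hy hg hx.
(* Row 0 belongs to the left operator. The value g at 0 enters rows -1 and 1, where it cancels the
   right-hand sides prescribed for y and x. *)
pose X i := y i + x i + (i == 0)%:R * g.
have X0 : forall i, X i = 0.
  apply: (nf (join uL uR) (join vL vR) (join wL wR) setT X (My + Mx + normc g)).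
  - exact: coefs_join.
  - by [].
  - move=> i; apply: le_trans (normc_add3 _ _ _) _; rewrite !lerD //.
    by case: eqP => _; rewrite ?mulr1n ?mulr0n ?mul1r ?mul0r ?normc0 ?normc_ge0.
  - exact: suppT.
  - move=> i _; have [i0|i0] := leP i 0.
      rewrite /jac /join !i0 /X (x0 i) // (x0 (i - 1)); last by lia.
      have -> : (i - 1 == 0) = false by lia.
      move: i0; rewrite le_eqVlt => /orP[/eqP ->|i0].
        rewrite -[0 - 1]/(-1 : int) -[0 + 1]/(1 : int) eqxx (y0 0) // (y0 1) //.
        by rewrite mulr1n !mulr0n mul1r !mul0r !addr0 !add0r.
      rewrite (x0 (i + 1)); last by lia.
      have -> : (i == 0) = false by lia.
      have i1 : i <= -1 by lia.
      have := hy i i1; rewrite /jac.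
      have -> : (i + 1 == 0) = (i == -1) by lia.
      case: (i =P -1) => [-> |_] h; rewrite ?mulr1n !mulr0n !mul0r !addr0 //.
      by rewrite mul1r mulrDr addrA h addNr.
    rewrite /jac /join !(leNgt i) i0 /= /X (y0 i) ?(ltW i0) // (y0 (i + 1)); last by lia.
    have -> : (i + 1 == 0) = false by lia.
    have -> : (i == 0) = false by lia.
    rewrite (y0 (i - 1)); last by lia.
    have i1 : 1 <= i by lia.
    have := hx i i1; rewrite /jac.
    have -> : (i - 1 == 0) = (i == 1) by lia.
    case: (i =P 1) => [-> |_] h; rewrite ?mulr1n !mulr0n !mul0r !addr0 !add0r //.
    rewrite mul1r mulrDr [X in X + _ + _]addrC -!addrA.
    by rewrite -addrA in h; rewrite h addrN.
split=> [i||i].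
- have [i0|i0] := leP 0 i; first exact: y0.
  have := X0 i; rewrite /X x0 ?(ltW i0) // (_ : (i == 0) = false); last by lia.
  by rewrite mulr0n mul0r !addr0.
- by have := X0 0; rewrite /X x0 // y0 // eqxx mulr1n mul1r !add0r.
- have [i0|i0] := leP i 0; first exact: x0.
  have := X0 i; rewrite /X y0 ?(ltW i0) // (_ : (i == 0) = false); last by lia.
  by rewrite mulr0n mul0r addr0 add0r.
Qed.

(** For null vectors y and x on the two sides, a y + b x is null on Z as soon as row 0 vanishes, and
    this is one linear equation for two coefficients. *)
Lemma nullfree_up_or_down U V W : nullfree U V W [set setT] ->
  nullfree U V W upc \/ nullfree U V W downc.
Proof.
move=> nf; have [?|nup] := pselect (nullfree U V W upc); first by left.
right; apply: contrapT => ndown.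
have [uR [vR [wR [x [Mx [cR xM x0 hx x1]]]]]] := not_nullfree_upc nf nup.
have [uL [vL [wL [y [My [cL yM y0 hy y1]]]]]] := not_nullfree_downc nf ndown.
have H (a b : R[i]) : uL 0 * (a * y (-1)) + wL 0 * (b * x 1) = 0 -> a = 0 /\ b = 0.
  move=> hab.
  have [| | | | | | |h1 _ h2] := @paste_null U V W uL vL wL uR vR wR (fun i => a * y i)
    (fun i => b * x i) 0 (normc a * My) (normc b * Mx) nf cL cR.
  - by move=> i; rewrite normcM ler_wpM2l ?normc_ge0.
  - by move=> i; rewrite normcM ler_wpM2l ?normc_ge0.
  - by move=> i i0; rewrite y0 // mulr0.
  - by move=> i i0; rewrite x0 // mulr0.
  - by move=> i i0; rewrite jacZ hy // !mulr0 oppr0 if_same.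
  - by rewrite mulr0 addr0.
  - by move=> i i0; rewrite jacZ hx // !mulr0 oppr0 if_same.
  split; [have := h1 (-1)|have := h2 1] => /eqP; rewrite mulf_eq0 => /orP[/eqP//|/eqP //].
have [|_ /eqP] := H (wL 0 * x 1) (- (uL 0 * y (-1))); first by ring.
rewrite oppr_eq0 => /eqP uy; have [|/eqP] := H 1 0; last by rewrite oner_eq0.
by rewrite mul1r uy mul0r mulr0 addr0.
Qed.

End Glue.

(** * Finite intervals *)

Section Periodic.
Variable R : realType.
Implicit Types (u v w x y : int -> R[i]) (U V W : set R[i]) (D E : set int).

Definition periodize (P : nat) (a : int -> R[i]) (i : int) : R[i] :=
  a (absz i %% P)%N%:Z.

(* A null vector of an n x n matrix is repeated along the half-line, each copy
   being multiplied by t, the ratio that makes the gaps between the copies null. *)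
Lemma finite_null_right U V W u v w x M (n : nat) :
  nullfree U V W upc -> coefs U V W u v w -> bdd x M -> (0 < n)%N ->
  (forall i : int, ~ (1 <= i <= n%:Z) -> x i = 0) ->
  (forall i : int, 1 <= i <= n%:Z -> jac u v w x i = 0) ->
  normc (u 0 * x n%:Z) <= normc (w 0 * x 1) -> forall i, x i = 0.
Proof.
move=> nf cf xM n0 x0 hx le_ux.
(* A period consists of the n sites and one gap, the site 0 modulo P. *)
have [P PE] : exists P, P = n.+1 by exists n.+1.
have P0 : (0 < P)%N by rewrite PE.
(* If w 0 * x 1 = 0, then t = 0 by the convention for division, and the gap row still vanishes
   because the hypothesis forces u 0 * x n = 0. *)
pose t : R[i] := - (u 0 * x n%:Z) / (w 0 * x 1).
have t1 : normc t <= 1.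
  rewrite /t normcM normcN normcV.
  have [w0|w0] := eqVneq (w 0 * x 1) 0; first by rewrite w0 normc0 invr0 mulr0.
  by rewrite ler_pdivrMr ?normc_gt0 // mul1r.
have tE : u 0 * x n%:Z + w 0 * (t * x 1) = 0.
  rewrite mulrCA /t; have [w0|w0] := eqVneq (w 0 * x 1) 0; last first.
    by rewrite divfK // addrN.
  rewrite w0 mulr0 addr0; apply/eqP; rewrite -normc_eq0 eq_le normc_ge0 andbT.
  by apply: le_trans le_ux _; rewrite w0 normc0.
pose y (i : int) : R[i] := if i < 0 then 0 else t ^+ (absz i %/ P)%N * x (absz i %% P)%N%:Z.
have yE k r : (r < P)%N -> y (k * P + r)%N%:Z = t ^+ k * x r%:Z.
  by move=> rP; rewrite /y /= divnMDl // modnMDl divn_small // modn_small // addn0.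
have aE (a : int -> R[i]) k r : (r < P)%N -> periodize P a (k * P + r)%N%:Z = a r%:Z.
  by move=> rP; rewrite /periodize /= modnMDl modn_small.
have y0 : forall i, y i = 0.
  apply: (nf (periodize P u) (periodize P v) (periodize P w) [set i | 1 <= i] y M).
  - by move=> i; exact: cf.
  - by move=> i j /= i1 ij; apply: le_trans ij.
  - move=> i; rewrite /y; case: ifP => _; first by rewrite normc0 (le_trans _ (xM 0)) ?normc_ge0.
    rewrite normcM normcX; apply: le_trans (xM (absz i %% P)%N%:Z).
    by rewrite ler_piMl ?normc_ge0 // exprn_ile1 ?normc_ge0.
  - move=> i /= /negP; rewrite -ltNge => i1; rewrite /y; case: ifPn => // i0.
    have -> : i = 0 by lia.
    by rewrite /= div0n mod0n mul1r x0 //; lia.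
  move=> i /= i1; have [m ->] : exists m : nat, i = m.+1%:Z.
    by exists (absz (i - 1)); lia.
  rewrite /jac; have -> : m.+1%:Z - 1 = m%:Z :> int by lia.
  have -> : m.+1%:Z + 1 = m.+2%:Z :> int by lia.
  have mE := divn_eq m.+1 P; have := ltn_pmod m.+1 P0.
  move: (m.+1 %/ P)%N (m.+1 %% P)%N mE => k [|r] mE rP.
    case: k mE => [|k] mE; first by move: mE; rewrite mul0n.
    have m0 : m = (k * P + n)%N by move: mE; rewrite mulSn; lia.
    have m2 : m.+2 = (k.+1 * P + 1)%N by rewrite mE; lia.
    have h1 : (1 < P)%N by lia.
    have hn : (n < P)%N by lia.
    rewrite m2 mE m0 !yE // !aE // (x0 0) ?mulr0 ?addr0; last by lia.
    by rewrite exprSr -mulrA mulrCA (mulrCA (w 0)) -mulrDr tE mulr0.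
  have m0 : m = (k * P + r)%N by lia.
  have mE2 : m.+2 = (k * P + r.+2)%N by lia.
  have yE2 : y m.+2 = t ^+ k * x r.+2.
    have [rn1|rn1] := ltnP r.+1 n; first by rewrite mE2 yE //; lia.
    have -> : m.+2 = (k.+1 * P + 0)%N by rewrite mE2 mulSn; lia.
    by rewrite yE // (x0 0) ?(x0 r.+2) ?mulr0 //; lia.
  have hr : (r < P)%N by lia.
  rewrite yE2 m0 yE //.
  rewrite -m0 mE yE // !aE //.
  have h : 1 <= r.+1%:Z <= n%:Z by lia.
  have := hx _ h; rewrite /jac.
  have -> : r.+1%:Z - 1 = r%:Z :> int by lia.
  have -> : r.+1%:Z + 1 = r.+2%:Z :> int by lia.
  by move=> e; rewrite !(mulrCA _ (t ^+ k)) -!mulrDr e mulr0.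
move=> i; have [/andP[i1 iN]|/negP] := boolP (1 <= i <= n%:Z); last exact: x0.
have := y0 i; have -> : i = (0 * P + absz i)%N%:Z by lia.
by rewrite yE ?expr0 ?mul1r //; lia.
Qed.

(** The growth condition of [finite_null_right] holds either as it is or for the reflected vector;
    the latter amounts to continuing the copies to the left. *)
Lemma finite_null U V W u v w x M (n : nat) :
  nullfree U V W upc -> nullfree U V W downc -> coefs U V W u v w -> bdd x M -> (0 < n)%N ->
  (forall i : int, ~ (1 <= i <= n%:Z) -> x i = 0) ->
  (forall i : int, 1 <= i <= n%:Z -> jac u v w x i = 0) -> forall i, x i = 0.
Proof.
move=> nup ndown cf xM n0 x0 hx.
have [le_ux|lt_ux] := leP (normc (u 0 * x n%:Z)) (normc (w 0 * x 1)).
  exact: finite_null_right nup cf xM n0 x0 hx le_ux.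
(* The gap row must be row 0 of the reflected operator, hence the modified coefficients. *)
pose u1 i := if i == n.+1%:Z then u 0 else u i.
pose v1 i := if i == n.+1%:Z then v 0 else v i.
pose w1 i := if i == n.+1%:Z then w 0 else w i.
have cf1 : coefs U V W u1 v1 w1.
  by move=> i; rewrite /u1 /v1 /w1; case: ifP.
have cf2 := coefs_opp (coefs_transl n.+1%:Z cf1).
have xM2 : bdd (fun i => transl n.+1%:Z x (- i)) M by move=> i; exact: xM.
have nup' : nullfree W V U upc by apply/nullfree_upc_opp.
move=> i; rewrite (_ : i = - (n.+1%:Z - i) + n.+1%:Z); last by lia.
apply: (finite_null_right nup' cf2 xM2 n0).
- by move=> j hj; apply: x0; lia.
- move=> j hj; rewrite jac_opp jac_transl.
  have e : (- j + n.+1%:Z == n.+1%:Z) = false by lia.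
  have := hx (- j + n.+1%:Z); rewrite /jac /u1 /v1 /w1 e; apply; lia.
- rewrite /transl /w1 /u1 oppr0 add0r eqxx.
  have -> : - n%:Z + n.+1%:Z = 1 :> int by lia.
  have -> : - (1 : int) + n.+1%:Z = n%:Z :> int by lia.
  exact: ltW.
Qed.

(** A convex set without upper bound is in [upc] and one without lower bound is in [downc]; what is
    left are finite intervals. *)
Lemma nullfree_convc U V W :
  nullfree U V W upc -> nullfree U V W downc -> nullfree U V W convc.
Proof.
move=> nup ndown; apply: contrapT => /not_nullfree.
move=> [u [v [w [D [x [M [i [cf Dc xM xD [hx xi]]]]]]]]].
have Di : D i by apply: contrapT => /xD.
have [b bD] : exists b, forall k, D k -> k <= b.
  apply: contrapT => h; apply: xi; apply: (nup u v w D x M) => // a b Da ab.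
  apply: contrapT => nDb; apply: h; exists b => k Dk; rewrite leNgt; apply/negP => bk.
  by apply: nDb; apply: Dc Da Dk _; rewrite ab ltW.
have [a aD] : exists a, forall k, D k -> a <= k.
  apply: contrapT => h; apply: xi; apply: (ndown u v w D x M) => // c d Da dc.
  apply: contrapT => nDb; apply: h; exists d => k Dk; rewrite leNgt; apply/negP => bk.
  by apply: nDb; apply: Dc Dk Da _; rewrite dc ltW.
have [l [Dl hl]] := least_index Di aD; have [r [Dr hr]] := greatest_index Di bD.
have DE k : D k <-> l <= k <= r.
  split=> [Dk|]; last exact: Dc Dl Dr.
  by rewrite hl // hr.
have lr : l <= r := hl _ Dr.
have e : transl (l - 1) x (i - (l - 1)) = x i by rewrite /transl subrK.
apply: xi; rewrite -e.
apply: (finite_null nup ndown (coefs_transl (l - 1) cf) (M := M) (n := (dst r l).+1)) => //.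
- by move=> k; exact: xM.
- by move=> k hk; apply: xD => /DE; lia.
- by move=> k hk; rewrite jac_transl hx //; apply/DE; lia.
Qed.

End Periodic.

(** * Solvability, unsolvability and kernels on half-lines *)

Section Dichotomy.
Variable R : realType.
Implicit Types (u v w x y : int -> R[i]) (U V W : set R[i]) (D E : set int).

Lemma dual_boundW U V W DD :
  compact (U : set R[i]^o) -> compact (V : set R[i]^o) ->
  compact (W : set R[i]^o) -> admissible DD -> nullfree W V U DD ->
  exists C q : R, [/\ 0 < C, 0 < q, q < 1 & forall u v w D,
    coefs U V W u v w -> DD D -> dual_bound u v w D D C q].
Proof.
move=> Uc Vc Wc DDa nf; have [C [q [C0 q0 q1 H]]] := exp_bound Wc Vc Uc DDa nf.
exists C, q; split=> // u v w D cf DDD y M s j yM yD s0 hs.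
exact: H _ _ _ _ _ _ _ _ (coefs_tr cf) DDD yM yD s0 hs.
Qed.

(* Deleting rows (and the columns that these rows alone touch) keeps the bound. *)
Lemma dual_bound_rows u v w D E C q :
  dual_bound u v w setT setT C q ->
  (forall i j, D i -> (dst i j <= 1)%N -> E j) -> dual_bound u v w D E C q.
Proof.
move=> H DE y M s j yM yD s0 hs; apply: (H y M s j yM (@suppT _ y) s0) => i _.
have [Ei|nE] := pselect (E i); first exact: hs.
have y0 k : (dst k i <= 1)%N -> y k = 0.
  by move=> ki; apply: yD => Dk; apply: nE; apply: DE Dk ki.
have dii : (dst i i <= 1)%N by rewrite subrr.
rewrite /jacT /jac (y0 i dii) (y0 _ (dst_subr1 i)) (y0 _ (dst_addr1 i)).
by rewrite !mulr0 !addr0 normc0 mulr0.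
Qed.

Lemma half_line_solve U V W DD : compact (U : set R[i]^o) -> compact (V : set R[i]^o) ->
  compact (W : set R[i]^o) -> admissible DD -> nullfree W V U DD ->
  exists C q : R, [/\ 0 < C, 0 < q, q < 1 & forall u v w D j,
    coefs U V W u v w -> DD D -> D j -> exists g, [/\ supp D g,
      forall i, normc (g i) <= C * q ^+ dst i j &
      forall i, D i -> jac u v w g i = (i == j)%:R]].
Proof.
move=> Uc Vc Wc DDa nf; have [C [q [C0 q0 q1 H]]] := dual_boundW Uc Vc Wc DDa nf.
exists C, q; split=> // u v w D j cf DDD Dj; exact: solve_delta (H _ _ _ _ cf DDD) Dj.
Qed.

Lemma decay_bdd (g : int -> R[i]) (C q : R) j : 0 < C -> 0 < q -> q < 1 ->
  (forall i, normc (g i) <= C * q ^+ dst i j) -> bdd g C.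
Proof.
move=> C0 q0 q1 h i; apply: le_trans (h i) _; rewrite ler_piMr ?(ltW C0) //.
by rewrite exprn_ile1 // ltW.
Qed.

(** Coburn's argument with the value g at 0 as second unknown. Multiples of the null vector y on the
    left, of a response y' to the unit at -1, and of the supposed solution z on the right are pasted
    around g; row 0 is one linear equation in g and the coefficient a of y. *)
Lemma delta_unsolvable U V W : compact (U : set R[i]^o) -> compact (V : set R[i]^o) ->
  compact (W : set R[i]^o) -> nullfree U V W [set setT] -> nullfree U V W upc ->
  ~ nullfree U V W downc -> forall u v w z M, coefs U V W u v w -> bdd z M ->
  (forall i, i <= 0 -> z i = 0) -> ~ (forall i, 1 <= i -> jac u v w z i = (i == 1)%:R).
Proof.
move=> Uc Vc Wc nf nup ndown u v w z M cf zM z0 hz.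
have [uL [vL [wL [y [My [cL yM y0 hy y1]]]]]] := not_nullfree_downc nf ndown.
have ndown' : nullfree W V U downc by apply/nullfree_upc_opp.
have [C [q [C0 q0 q1 H]]] := half_line_solve Uc Vc Wc admissible_downc ndown'.
have dD : downc [set i : int | i <= -1].
  by move=> i j /= i1 ij; apply: le_trans ij i1.
have [y' [y'D y'M hy']] := H _ _ _ _ (-1) cL dD (lexx _).
have y'0 i : 0 <= i -> y' i = 0 by move=> i0; apply: y'D => /=; lia.
have {}y'M := decay_bdd C0 q0 q1 y'M.
have key (a g : R[i]) : uL 0 * (a * y (-1) - wL (-1) * g * y' (-1)) + vL 0 * g +
    wL 0 * (- (u 1 * g) * z 1) = 0 -> a = 0 /\ g = 0.
  move=> hag.
  have [| | | | | | |h1 g0 _] := @paste_null R U V W uL vL wL u v w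
    (fun i => a * y i + - (wL (-1) * g) * y' i) (fun i => - (u 1 * g) * z i) g
    (normc a * My + normc (- (wL (-1) * g)) * C) (normc (- (u 1 * g)) * M) nf cL cf.
  - move=> i; apply: le_trans (le_normcD _ _) _; rewrite !normcM.
    by apply: lerD; rewrite ler_wpM2l ?normc_ge0 -?normcM ?normc_ge0.
  - by move=> i; rewrite normcM ler_wpM2l ?normc_ge0.
  - by move=> i i0; rewrite y0 // y'0 // !mulr0 addr0.
  - by move=> i i0; rewrite z0 // mulr0.
  - move=> i i1; rewrite jacD !jacZ hy // hy' // mulr0 add0r.
    by case: eqP => _; rewrite ?mulr1n ?mulr0n ?mulr1 ?mulr0.
  - by rewrite mulNr.
  - move=> i i1; rewrite jacZ hz //.
    by case: eqP => _; rewrite ?mulr1n ?mulr0n ?mulr1 ?mulr0.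
  split=> //; have := h1 (-1); rewrite g0 mulr0 oppr0 mul0r addr0 => /eqP.
  by rewrite mulf_eq0 => /orP[/eqP //|/eqP].
(* The coefficient of g in row 0. *)
pose c := - (uL 0 * (wL (-1) * y' (-1))) + vL 0 - wL 0 * (u 1 * z 1).
have [|_ /eqP] := key c (- (uL 0 * y (-1))); first by rewrite /c; ring.
rewrite oppr_eq0 => /eqP uy; have [|/eqP] := key 1 0; last by rewrite oner_eq0.
by rewrite !mulr0 !mul0r oppr0 !(mul0r, mulr0, addr0, subr0) mul1r.
Qed.

(* Any right half-line operator has the kernel vector A^-1 delta_0, where A is a
   bi-infinite extension: its left half would otherwise solve an unsolvable equation. *)
Lemma kernel_right U V W : compact (U : set R[i]^o) -> compact (V : set R[i]^o) ->
  compact (W : set R[i]^o) -> nullfree U V W [set setT] -> nullfree U V W downc ->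
  ~ nullfree U V W upc -> exists C q : R, [/\ 0 < C, 0 < q, q < 1 &
    forall u v w j, coefs U V W u v w -> exists z, [/\ forall i, i <= j -> z i = 0,
      forall i, normc (z i) <= C * q ^+ dst i j,
      forall i, j < i -> jac u v w z i = 0 & w j * z (j + 1) = 1]].
Proof.
move=> Uc Vc Wc nf ndown nup.
have [C [q [C0 q0 q1 H]]] := half_line_solve Uc Vc Wc admissibleT (nullfreeT_opp nf).
exists C, q; split=> // u v w j cf.
have [z [_ zM hz]] := H u v w setT j cf erefl I.
have {}zM' := decay_bdd C0 q0 q1 zM.
pose y i : R[i] := if i <= j then z i else 0.
have yM : bdd y C.
  by move=> i; rewrite /y; case: ifP => _ //; rewrite normc0 ltW.
have yz i : i < j -> jac u v w y i = 0.
  move=> ij; transitivity (jac u v w z i); last by rewrite hz // lt_eqF.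
  by rewrite /jac /y !ifT //; lia.
have yj : jac u v w y j = 1 - w j * z (j + 1).
  have e1 : (j - 1 <= j) = true by lia.
  have e2 : (j + 1 <= j) = false by lia.
  have := hz j I; rewrite eqxx mulr1n /jac /y e1 e2 lexx => <-.
  by rewrite mulr0 addr0 addrK.
have cf2 := coefs_opp (coefs_transl (j + 1) cf).
have nup2 : nullfree W V U upc by apply/nullfree_upc_opp.
have ndown2 : ~ nullfree W V U downc by rewrite -nullfree_upc_opp.
(* Otherwise the left part y, scaled and reflected, would solve the equation that [delta_unsolvable]
   excludes. Once the product is 1, y is a null vector on the left half-line, hence 0, and z lives
   to the right of j. *)
have w1 : w j * z (j + 1) = 1.
  apply: contrapT => w1; have d0 : 1 - w j * z (j + 1) != 0.
    by rewrite subr_eq0 eq_sym; apply/eqP.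
  apply: (delta_unsolvable Wc Vc Uc (nullfreeT_opp nf) nup2 ndown2 cf2
    (z := fun i => (1 - w j * z (j + 1))^-1 * transl (j + 1) y (- i))
    (M := normc (1 - w j * z (j + 1))^-1 * C)) => [i|i i0|i i1].
  - by rewrite normcM ler_wpM2l ?normc_ge0 //; exact: yM.
  - by rewrite /transl /y ifF ?mulr0 //; lia.
  rewrite jacZ jac_opp jac_transl; have [->|i2] := eqVneq i 1.
    have -> : -1 + (j + 1) = j by lia.
    by rewrite yj mulVf // eqxx.
  have ij : - i + (j + 1) < j by lia.
  by rewrite yz // mulr0.
have y0 : forall i, y i = 0.
  apply: (ndown u v w [set i | i <= j] y C) => //.
  - by move=> a b /= aj ba; apply: le_trans ba aj.
  - by move=> i /= /negP ij; rewrite /y (negbTE ij).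
  - move=> i /=; rewrite le_eqVlt => /orP[/eqP ->|]; last exact: yz.
    by rewrite yj w1 subrr.
exists z; split=> // i ij; last by rewrite hz // gt_eqF.
by have := y0 i; rewrite /y ij.
Qed.

End Dichotomy.

(** * Operators on l^p *)

Section LpBall.
Variables (R : realType) (I : choiceType) (p : \bar R).
Hypothesis p1 : (1 <= p)%E.
Implicit Types (x y : I -> R[i]) (M N : R).

(** The ball of radius M through finite partial sums of r-th powers, without the root: estimates
    then stay among real numbers. *)
Definition lple x M : Prop :=
  match p with
  | r%:E%E => forall s : seq I, uniq s -> \sum_(i <- s) normc (x i) `^ r <= M `^ r
  | _ => forall i, normc (x i) <= M
  end.

Lemma esum_le_seq (a : I -> R) (y : R) : (forall i, 0 <= a i) ->
  ((\esum_(i in [set: I]) (a i)%:E <= y%:E)%E <->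
   forall s : seq I, uniq s -> \sum_(i <- s) a i <= y).
Proof.
move=> a0; split=> [h s us|h].
  rewrite -lee_fin; apply: le_trans h; rewrite -sumEFin.
  apply: esum_ge; exists [set` s] => //=; last by rewrite -fsbig_seq.
apply: ge_ereal_sup => _ [A [fA _] <-].
rewrite fsbig_finite //= sumEFin lee_fin; exact: h.
Qed.

Lemma le_poweR (a b : \bar R) (r : R) : 0 <= r -> (0 <= a)%E -> (a <= b)%E ->
  (a `^ r <= b `^ r)%E.
Proof.
move=> r0 a0 ab; apply: (gt0_ler_poweR r0) => //; rewrite in_itv /= leey andbT //.
exact: le_trans ab.
Qed.

Lemma lpnorm_le x M : 0 <= M -> (lpnorm p x <= M%:E)%E <-> lple x M.
Proof.
move=> M0; rewrite /lple /lpnorm; case: p p1 => [r||] //; last first.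
  move=> _; split=> [h i|h]; last first.
    by apply: ge_ereal_sup => _ [i _ <-]; rewrite lee_fin.
  by rewrite -lee_fin; apply: le_trans h; apply: ereal_sup_ubound; exists i.
rewrite lee_fin => r1; have r0 : 0 < r by lra.
rewrite -(@esum_le_seq (fun i => normc (x i) `^ r)) => [|i]; last exact: powR_ge0.
set S := esum _ _; have S0 : (0 <= S)%E.
  by apply: esum_ge0 => i _; rewrite lee_fin powR_ge0.
have rV : r * r^-1 = 1 by rewrite divff // gt_eqF.
split=> h.
  have -> : S = ((S `^ r^-1) `^ r)%E by rewrite -poweRrM mulrC rV poweRe1.
  by rewrite -poweR_EFin; exact: le_poweR (ltW r0) (poweR_ge0 _ _) h.
have -> : M%:E = ((M `^ r)%:E `^ r^-1)%E by rewrite poweR_EFin -powRrM rV powRr1.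
by apply: le_poweR S0 h; rewrite invr_ge0 ltW.
Qed.

Lemma lpP x : lp p x <-> exists2 M, 0 <= M & lple x M.
Proof.
split=> [|[M M0 /lpnorm_le h]]; last first.
  by rewrite /lp /=; apply: le_lt_trans (h M0) _; rewrite ltry.
rewrite /lp /= => h; exists (Num.max 0 (fine (lpnorm p x))); first by rewrite le_max lexx.
apply/lpnorm_le; first by rewrite le_max lexx.
move: h; case: (lpnorm p x) => [r _||] //=; last by rewrite leNye.
by rewrite lee_fin le_max lexx orbT.
Qed.

Lemma lple_bdd x M : 0 <= M -> lple x M -> forall i, normc (x i) <= M.
Proof.
rewrite /lple; case: p p1 => [r||] // + M0 h i; rewrite lee_fin => r1.
have := h [:: i] isT; rewrite big_seq1 => {}h.
rewrite leNgt; apply/negP => hM; suff : M `^ r < normc (x i) `^ r by rewrite ltNge h.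
apply: gt0_ltr_powR hM; rewrite ?nnegrE ?normc_ge0 //; lra.
Qed.

Lemma lple_le x y M : (forall i, normc (y i) <= normc (x i)) -> lple x M -> lple y M.
Proof.
rewrite /lple; case: p p1 => [r||] // + yx h => [|_ i]; last exact: le_trans (yx i) (h i).
rewrite lee_fin => r1 s us; apply: le_trans (h s us); apply: ler_sum => i _.
by apply: ge0_ler_powR; rewrite ?nnegrE ?normc_ge0 //; lra.
Qed.

Lemma lpleZ c x M : 0 <= M -> lple x M -> lple (fun i => c * x i) (normc c * M).
Proof.
move=> M0; rewrite /lple; case: p p1 => [r||] // + h => [|_ i]; last first.
  by rewrite normcM ler_wpM2l ?normc_ge0.
rewrite lee_fin => r1 s us; rewrite powRM ?normc_ge0 //.
under eq_bigr do rewrite normcM powRM ?normc_ge0 //.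
by rewrite -mulr_sumr ler_wpM2l ?powR_ge0 // h.
Qed.

(** A Schur test. For each i some j is near-maximal in the weighted supremum, so |y i| <= 2 C
    q^d(i,j) |x j|; after taking r-th powers the sum over i for fixed j is controlled by G. *)
Lemma lple_dom (d : I -> I -> nat) (C q G : R) x y M :
  0 <= C -> 0 <= M -> 0 < q -> q < 1 -> 1 <= G ->
  (forall (s : seq I) j, uniq s -> \sum_(i <- s) q ^+ d i j <= G) ->
  (forall i s, 0 <= s -> (forall j, q ^+ d i j * normc (x j) <= s) -> normc (y i) <= C * s) ->
  lple x M -> lple y (2 * C * G * M).
Proof.
move=> C0 M0 q0 q1 G1 hG hy hx; have xM := lple_bdd M0 hx.
have q01 k : 0 <= q ^+ k <= 1 by rewrite exprn_ge0 ?exprn_ile1 ?ltW.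
have f0 i j : 0 <= q ^+ d i j * normc (x j) by rewrite mulr_ge0 ?normc_ge0 ?exprn_ge0 ?ltW.
have far i : exists j, normc (y i) <= 2 * C * (q ^+ d i j * normc (x j)).
  have [[j0 xj0]|h] := pselect (exists j, x j != 0); last first.
    exists i; have xj j : normc (x j) = 0.
      by apply/eqP; rewrite normc_eq0; apply/negPn/negP => xj; apply: h; exists j.
    rewrite xj !mulr0; have := hy i 0 (lexx _); rewrite mulr0; apply=> j.
    by rewrite xj mulr0.
  have [||j1 hj1] := @near_sup R I (fun j => q ^+ d i j * normc (x j)) M j0.
  - move=> j; apply: le_trans (xM j); rewrite ler_piMl ?normc_ge0 //.
    by have /andP[] := q01 (d i j).
  - by rewrite mulr_gt0 ?exprn_gt0 ?normc_gt0.
  by exists j1; rewrite (mulrC 2) -mulrA; apply: hy hj1; rewrite mulr_ge0.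
move: hx; rewrite /lple; case: p p1 => [r||] // + hx => [|_ i]; last first.
  have [j hj] := far i; apply: le_trans hj _.
  rewrite -!mulrA ler_wpM2l // ler_wpM2l //.
  apply: ler_pM; rewrite ?normc_ge0 ?exprn_ge0 ?(ltW q0) //.
  by apply: le_trans G1; have /andP[] := q01 (d i j).
rewrite lee_fin => r1 s us; have r0 : 0 <= r by lra.
have {far}[j hj] := choice far.
have C20 : 0 <= 2 * C by rewrite mulr_ge0.
(* The single term k = j i is enlarged to a sum over all chosen k, so that the order of summation
   can be exchanged; the power r on q^d is dropped because q^d <= 1. *)
apply: (@le_trans _ _ (\sum_(i <- s) \sum_(k <- undup [seq j i | i <- s])
    (2 * C) `^ r * normc (x k) `^ r * q ^+ d i k)).
  rewrite big_seq [leRHS]big_seq; apply: ler_sum => i si.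
  rewrite (bigD1_seq (j i)) ?undup_uniq ?mem_undup ?map_f //=.
  apply: ler_wpDr.
    by apply: sumr_ge0 => k _; rewrite !mulr_ge0 ?powR_ge0 ?exprn_ge0 ?ltW.
  apply: (@le_trans _ _ ((2 * C * (q ^+ d i (j i) * normc (x (j i)))) `^ r)).
    by apply: ge0_ler_powR => //; rewrite nnegrE ?normc_ge0 // mulr_ge0.
  have /andP[e0 e1] := q01 (d i (j i)).
  rewrite !powRM ?normc_ge0 // [_ `^ r * normc _ `^ r]mulrC mulrA.
  rewrite ler_wpM2l ?mulr_ge0 ?powR_ge0 //.
  move: e0; rewrite le_eqVlt => /orP[/eqP <-|e0]; first by rewrite powR0 //; lra.
  by apply: ge1r_powR; rewrite ?e0.
rewrite exchange_big /=.
apply: (@le_trans _ _ (\sum_(k <- undup [seq j i | i <- s])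
    (2 * C) `^ r * normc (x k) `^ r * G)).
  apply: ler_sum => k _; rewrite -mulr_sumr ler_wpM2l ?hG //.
  by rewrite mulr_ge0 ?powR_ge0.
rewrite -mulr_suml -mulr_sumr.
rewrite !powRM ?mulr_ge0 //; last by lra.
rewrite -mulrA [_ * G]mulrC mulrA ler_pM ?mulr_ge0 ?powR_ge0 //.
- by lra.
- by apply: sumr_ge0 => k _; exact: powR_ge0.
- rewrite -powRM // ler_wpM2l ?powR_ge0 //; apply: le1r_powR => //.
- by apply: hx; exact: undup_uniq.
- by lra.
Qed.

(** The constant 4 comes from |a + b|^r <= 2^r (|a|^r + |b|^r) and is not sharp; it serves to show
    that l^p is closed under sums. *)
Lemma lpleD x y M N : 0 <= M -> 0 <= N -> lple x M -> lple y N ->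
  lple (fun i => x i + y i) (4 * (M + N)).
Proof.
move=> M0 N0; rewrite /lple; case: p p1 => [r||] // + hx hy => [|_ i]; last first.
  apply: le_trans (le_normcD _ _) (le_trans (lerD (hx i) (hy i)) _); lra.
rewrite lee_fin => r1 s us; have r0 : 0 <= r by lra.
apply: (@le_trans _ _ (\sum_(i <- s) 2 `^ r * (normc (x i) `^ r + normc (y i) `^ r))).
  apply: ler_sum => i _; pose m := Num.max (normc (x i)) (normc (y i)).
  have m0 : 0 <= m by rewrite le_max normc_ge0.
  apply: (@le_trans _ _ ((2 * m) `^ r)).
    apply: ge0_ler_powR; rewrite ?nnegrE ?normc_ge0 ?mulr_ge0 //.
    apply: le_trans (le_normcD _ _) _; rewrite mulr2n mulrDl mul1r lerD //.
      by rewrite le_max lexx.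
    by rewrite le_max lexx orbT.
  rewrite powRM // ler_wpM2l ?powR_ge0 // /m; case: (leP (normc (x i))) => _.
    by rewrite lerDr powR_ge0.
  by rewrite lerDl powR_ge0.
rewrite -mulr_sumr big_split /=.
apply: (@le_trans _ _ (2 `^ r * (M `^ r + N `^ r))).
  by rewrite ler_wpM2l ?powR_ge0 // lerD // ?hx ?hy.
apply: (@le_trans _ _ (2 `^ r * (2 * (M + N) `^ r))).
  rewrite ler_wpM2l ?powR_ge0 // mulr2n mulrDl mul1r lerD //.
    by apply: ge0_ler_powR; rewrite ?nnegrE ?addr_ge0 // lerDl.
  by apply: ge0_ler_powR; rewrite ?nnegrE ?addr_ge0 // lerDr.
have -> : 4 * (M + N) = 2 * 2 * (M + N) by lra.
rewrite [leRHS]powRM ?mulr_ge0 ?addr_ge0 // powRM // -mulrA.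
rewrite !ler_wpM2l ?powR_ge0 //.
by rewrite ler_wpM2r ?powR_ge0 // le1r_powR //; lra.
Qed.

Lemma lp_delta (i0 : I) : lple (fun i => (i == i0)%:R) 1.
Proof.
rewrite /lple; case: p p1 => [r||] // => [|_ i]; last first.
  by case: eqP => _; rewrite ?normc1 ?normc0.
rewrite lee_fin => r1 s us; have r0 : r != 0 by lra.
rewrite powR1; have [i0s|i0s] := boolP (i0 \in s); last first.
  rewrite big1_seq // => i /andP[_ si].
  by case: eqP => [e|_]; [move: i0s; rewrite -e si|rewrite normc0 powR0].
rewrite (bigD1_seq i0) //= eqxx normc1 powR1 big1_seq ?addr0 // => i /andP[ii0 _].
by rewrite (negbTE ii0) normc0 powR0.
Qed.

End LpBall.

Section Operators.
Variables (R : realType) (I : choiceType) (p : \bar R).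
Hypothesis p1 : (1 <= p)%E.
Implicit Types (x y b : I -> R[i]) (M N C : R) (T S : (I -> R[i]) -> (I -> R[i])).

Lemma lpD (a : R[i]) x y : lp p x -> lp p y -> lp p (a *: x + y).
Proof.
move=> /lpP[//|M M0 xM] /lpP[//|N N0 yN]; apply/lpP => //.
exists (4 * (normc a * M + N)).
  by rewrite mulr_ge0 // addr_ge0 // mulr_ge0 ?normc_ge0.
by apply: (@lpleD _ _ _ p1 (fun i => a * x i)) => //; [rewrite mulr_ge0 ?normc_ge0|exact: lpleZ].
Qed.

Lemma opnorm_le T C : 0 <= C -> (forall x, lple p x 1 -> lple p (T x) C) ->
  (opnorm p T <= C%:E)%E.
Proof.
move=> C0 h; apply: ge_ereal_sup => _ [x /= x1 <-].
by apply/lpnorm_le => //; apply: h; apply/lpnorm_le.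
Qed.

Lemma bounded_operator_of T C : 0 <= C ->
  (forall x M, 0 <= M -> lple p x M -> lple p (T x) (C * M)) ->
  (forall (a : R[i]) x y, T (a *: x + y) = a *: T x + T y) -> bounded_operator p T.
Proof.
move=> C0 h lin; split=> [x /lpP[//|M M0 xM]||//].
- by apply/lpP => //; exists (C * M); [exact: mulr_ge0|exact: h].
- by [].
apply: le_lt_trans (ltry C); apply: opnorm_le => // x x1.
by rewrite -(mulr1 C); apply: h.
Qed.

Lemma invertible_of T C : bounded_operator p T -> 0 <= C ->
  (forall b M, 0 <= M -> lple p b M -> exists2 x, lple p x (C * M) & T x = b) ->
  (forall x, lp p x -> T x = 0 -> x = 0) -> invertible p T.
Proof.
move=> Tb C0 surj inj; split=> //.
have Tlin := let: And3 _ h _ := Tb in h.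
have inj2 x y : lp p x -> lp p y -> T x = T y -> x = y.
  move=> xl yl Txy; have := inj (- 1 *: y + x) (lpD _ yl xl).
  rewrite Tlin // Txy !scaleN1r addNr => /(_ erefl) h.
  by apply/eqP; rewrite -subr_eq0 addrC h.
have E b : exists x, lp p b -> lp p x /\ T x = b.
  have [/lpP[//|M M0 bM]|nb] := pselect (lp p b); last by exists 0.
  have [x xM Tx] := surj b M M0 bM; exists x => _; split=> //.
  by apply/lpP => //; exists (C * M); first exact: mulr_ge0.
have [S hS] := choice E; exists S.
have SM b M : 0 <= M -> lple p b M -> lple p (S b) (C * M).
  move=> M0 bM; have bl : lp p b by apply/lpP => //; exists M.
  have [Sl TS] := hS b bl; have [x xM Tx] := surj b M M0 bM.
  rewrite (inj2 (S b) x) ?TS ?Tx //; apply/lpP => //.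
  by exists (C * M); first exact: mulr_ge0.
split; first split.
- by move=> b /hS[].
- move=> a x y xl yl; have [Sx Tx] := hS x xl; have [Sy Ty] := hS y yl.
  have [Sxy Txy] := hS _ (lpD a xl yl).
  by apply: inj2 => //; [exact: lpD|rewrite Txy Tlin // Tx Ty].
- apply: le_lt_trans (ltry C); apply: opnorm_le => // x x1.
  by rewrite -(mulr1 C); apply: SM.
move=> x xl; have [Sx Tx] := hS x xl; split=> //.
have Tl : lp p (T x) by case: Tb => + _ _; exact.
by have [STl TST] := hS _ Tl; apply: inj2.
Qed.

End Operators.

(** * Z and N as index sets inside the integers *)

Section IndexSpace.
Variables (R : realType) (I : choiceType) (lab : I -> int) (unlab : int -> option I).
Implicit Types (x y : I -> R[i]) (A : I -> I -> R[i]) (U V W : set R[i]).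

(** The map [unlab] is the partial inverse of [lab]; through it Z and N are both treated as subsets
    of the integers, and vectors are extended by 0. *)
Definition labelling := (forall i, unlab (lab i) = Some i) /\
  (forall k i, unlab k = Some i -> lab i = k).

Definition extend x (k : int) : R[i] := oapp x 0 (unlab k).
Definition res (y : int -> R[i]) (i : I) : R[i] := y (lab i).
Definition domain : set int := [set k | unlab k <> None].

(* The default value c0 is used for the entries outside of the index set. *)
Definition diag (d : int) (c0 : R[i]) A (k : int) : R[i] :=
  if unlab k is Some i then if unlab (k + d) is Some j then A i j else c0 else c0.

Hypothesis labP : labelling.

Lemma lab_inj : injective lab.
Proof. by move=> i j e; have := labP.1 i; rewrite e labP.1 => -[]. Qed.

Lemma ext_lab x i : extend x (lab i) = x i.
Proof. by rewrite /extend labP.1. Qed.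

Lemma supp_ext x : supp domain (extend x).
Proof.
move=> k nk; rewrite /extend; case E: (unlab k) => [i|//]; case: nk.
by rewrite /domain /= E.
Qed.

Lemma dom_lab i : domain (lab i).
Proof. by rewrite /domain /= labP.1. Qed.

Lemma domP k : domain k -> exists i, k = lab i.
Proof. by rewrite /domain /=; case E: (unlab k) => [i|//] _; exists i; rewrite (labP.2 _ _ E). Qed.

Lemma ext_res (y : int -> R[i]) : supp domain y -> extend (res y) =1 y.
Proof.
move=> yD k; rewrite /extend; case E: (unlab k) => [i|] /=; last by rewrite yD // /domain /= E.
by rewrite /res (labP.2 _ _ E).
Qed.

(** Defaults from U, V and W extend the matrix to all of Z within its class, so that the bounds for
    bi-infinite coefficients apply to it. *)
Lemma coefs_diag U V W A u0 v0 w0 : U u0 -> V v0 -> W w0 -> tridiagonal lab U V W A ->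
  coefs U V W (diag (-1) u0 A) (diag 0 v0 A) (diag 1 w0 A).
Proof.
move=> U0 V0 W0 AM k; rewrite /diag; split.
- case E: (unlab k) => [i|] //; case F: (unlab (k - 1)) => [j|] //.
  by have [h _ _ _] := AM i j; apply: h; rewrite (labP.2 _ _ E) (labP.2 _ _ F).
- rewrite addr0; case E: (unlab k) => [i|] //.
  by have [_ h _ _] := AM i i; apply: h.
- case E: (unlab k) => [i|] //; case F: (unlab (k + 1)) => [j|] //.
  by have [_ _ h _] := AM i j; apply: h; rewrite (labP.2 _ _ E) (labP.2 _ _ F).
Qed.

Lemma mxop_jac U V W A u0 v0 w0 x i : tridiagonal lab U V W A ->
  mxop A x i = jac (diag (-1) u0 A) (diag 0 v0 A) (diag 1 w0 A) (extend x) (lab i).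
Proof.
move=> AM; pose l := [:: lab i - 1; lab i; lab i + 1].
pose s := pmap unlab l.
have us : uniq s.
  apply: (@pmap_uniq _ _ _ lab); last by rewrite /l /= !inE; lia.
  by move=> k; rewrite /ocancel /=; case E: (unlab k) => [j|//] /=; rewrite (labP.2 _ _ E).
rewrite /mxop -(@fsbig_widen _ _ _ _ [set` s]) //; last first.
  move=> j [_ /= js]; have [_ _ _ h] := AM i j; rewrite h ?mul0r //.
  rewrite ltNge; apply/negP => hij; apply: js; rewrite mem_pmap; apply/mapP.
  by exists (lab j); [rewrite !inE; lia|rewrite labP.1].
rewrite -fsbig_seq //.
have sumE (F : I -> R[i]) l' : \sum_(j <- pmap unlab l') F j = \sum_(k <- l') oapp F 0 (unlab k).
  elim: l' => [|k l' IH] /=; first by rewrite !big_nil.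
  by rewrite [RHS]big_cons -IH; case: unlab => [j|] /=; rewrite ?big_cons ?add0r.
rewrite sumE /l !big_cons big_nil addr0 addrA /jac /diag /extend labP.1 addr0 labP.1 /=.
by congr (_ + _ + _); case: unlab => [j|] //=; rewrite mulr0.
Qed.

Definition mat (u v w : int -> R[i]) (i j : I) : R[i] := entry u v w (lab i) (lab j).

Lemma mat_tridiagonal U V W (u v w : int -> R[i]) :
  coefs U V W u v w -> tridiagonal lab U V W (mat u v w).
Proof.
move=> cf i j; have [Ui Vi Wi] := cf (lab i); rewrite /mat /entry; split.
- move=> e; have -> : (lab j == lab i - 1) = true by lia.
  have -> : (lab j == lab i) = false by lia.
  have -> : (lab j == lab i + 1) = false by lia.
  by rewrite mulr1n !mulr0n mul1r !mul0r !addr0.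
- move=> e; have -> : (lab j == lab i - 1) = false by lia.
  have -> : (lab j == lab i) = true by lia.
  have -> : (lab j == lab i + 1) = false by lia.
  by rewrite mulr1n !mulr0n mul1r !mul0r addr0 add0r.
- move=> e; have -> : (lab j == lab i - 1) = false by lia.
  have -> : (lab j == lab i) = false by lia.
  have -> : (lab j == lab i + 1) = true by lia.
  by rewrite mulr1n !mulr0n mul1r !mul0r !add0r.
- move=> e; have -> : (lab j == lab i - 1) = false by lia.
  have -> : (lab j == lab i) = false by lia.
  have -> : (lab j == lab i + 1) = false by lia.
  by rewrite !mulr0n !mul0r !addr0.
Qed.

Variable p : \bar R.
Hypothesis p1 : (1 <= p)%E.

Lemma lple_dom_lab (C q : R) x y M : 0 <= C -> 0 <= M -> 0 < q -> q < 1 ->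
  (forall i s, 0 <= s -> (forall j, q ^+ dst (lab i) (lab j) * normc (x j) <= s) ->
     normc (y i) <= C * s) ->
  lple p x M -> lple p y (2 * C * (2 / (1 - q)) * M).
Proof.
move=> C0 M0 q0 q1 h; apply: (@lple_dom _ _ _ p1 (fun i j => dst (lab i) (lab j)) _ q) => //.
  by rewrite ler_pdivlMr; lra.
move=> s j us; rewrite -(big_map lab predT (fun k => q ^+ dst k (lab j))).
rewrite (eq_bigr (fun k => q ^+ dst (lab j) k)); last by move=> k _; congr (_ ^+ _); lia.
by apply: geometric_dst_le => //; rewrite map_inj_uniq //; exact: lab_inj.
Qed.

End IndexSpace.

Definition inj_bound (R : realType) (u v w : int -> R[i]) (D : set int) (C q : R) :=
  forall (x : int -> R[i]) M s i,
  bdd x M -> supp D x -> 0 <= s ->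
  (forall j, D j -> q ^+ dst j i * normc (jac u v w x j) <= s) -> normc (x i) <= C * s.

(** * Tridiagonal operators on l^p *)

Section JacobiOperators.
Variables (R : realType) (I : choiceType) (lab : I -> int) (unlab : int -> option I).
Hypothesis labP : labelling lab unlab.
Variable p : \bar R.
Hypothesis p1 : (1 <= p)%E.
Variables (U V W : set R[i]) (u0 v0 w0 : R[i]).
Hypotheses (Uc : compact (U : set R[i]^o)) (Vc : compact (V : set R[i]^o))
  (Wc : compact (W : set R[i]^o)) (Uu : U u0) (Vv : V v0) (Ww : W w0).
Implicit Types (x y b : I -> R[i]) (A : I -> I -> R[i]).

Local Notation ext := (extend unlab).
Local Notation dom := (domain unlab).
Local Notation jacA A := (jac (diag unlab (-1) u0 A) (diag unlab 0 v0 A) (diag unlab 1 w0 A)).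

Lemma coefs_bounded : exists2 K : R, 0 < K & forall u v w, coefs U V W u v w ->
  forall (x : int -> R[i]) (s : R) k,
  normc (x (k - 1)) <= s -> normc (x k) <= s -> normc (x (k + 1)) <= s ->
  normc (jac u v w x k) <= K * s.
Proof.
have [K1 K10 hU] := compact_normc_bounded Uc.
have [K2 K20 hV] := compact_normc_bounded Vc.
have [K3 K30 hW] := compact_normc_bounded Wc.
exists (K1 + K2 + K3); first lra.
move=> u v w cf x s k h1 h2 h3; have [Uk Vk Wk] := cf k.
apply: le_trans (normc_add3 _ _ _) _; rewrite !normcM !mulrDl !lerD //.
- by apply: ler_pM; rewrite ?normc_ge0 // hU.
- by apply: ler_pM; rewrite ?normc_ge0 // hV.
- by apply: ler_pM; rewrite ?normc_ge0 // hW.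
Qed.

Lemma ext_linear (a : R[i]) x y k : ext (a *: x + y) k = a * ext x k + ext y k.
Proof. by rewrite /extend; case: unlab => [i|] //=; rewrite mulr0 addr0. Qed.

Lemma normc_ext_le (s : R) x : 0 <= s -> (forall i, normc (x i) <= s) ->
  forall k, normc (ext x k) <= s.
Proof.
move=> s0 h k; rewrite /extend; case: (unlab k) => [i|]; first exact: h.
by rewrite -[oapp _ _ _]/(0 : R[i]) normc0.
Qed.

Lemma mxop_linear A (a : R[i]) x y : tridiagonal lab U V W A ->
  mxop A (a *: x + y) = a *: mxop A x + mxop A y.
Proof.
move=> AM; apply: funext => i; rewrite [RHS](_ : _ = a * mxop A x i + mxop A y i) //.
rewrite !(mxop_jac labP u0 v0 w0 _ _ AM) /jac !ext_linear; ring.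
Qed.

Lemma bounded_mxop A : tridiagonal lab U V W A -> bounded_operator p (mxop A).
Proof.
move=> AM; have [K K0 hK] := coefs_bounded.
have cf := coefs_diag labP Uu Vv Ww AM.
(* Boundedness is read off from [lple_dom_lab] with q = 1/2: a row sees sites at distance at most 1,
   whose weights are at least 1/2. *)
apply: (@bounded_operator_of _ _ _ p1 _ (2 * (K * 2) * (2 / (1 - 2^-1)))).
- have h : 0 <= 2 / (1 - 2^-1) :> R by rewrite divr_ge0 // subr_ge0 invf_le1 // ler1n.
  by apply: mulr_ge0 h; rewrite !mulr_ge0 // ltW.
- move=> x M M0; apply: (lple_dom_lab labP p1 (q := 2^-1)); rewrite ?mulr_ge0 ?(ltW K0) //.
    by rewrite invf_lt1 // ltr1n.
  move=> i s s0 h; rewrite (mxop_jac labP u0 v0 w0 _ _ AM) -mulrA.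
  have hx k : (dst (lab i) k <= 1)%N -> normc (ext x k) <= 2 * s.
    move=> ik; rewrite /extend; case E: (unlab k) => [j|]; last first.
      by rewrite -[oapp _ _ _]/(0 : R[i]) normc0 mulr_ge0.
    rewrite -[oapp _ _ _]/(x j).
    have := h j; rewrite (labP.2 _ _ E); move: ik; case: (dst (lab i) k) => [|[|]] // _.
      by rewrite expr0; lra.
    by rewrite expr1; lra.
  by apply: hK => //; apply: hx; lia.
move=> a x y; exact: mxop_linear.
Qed.

Lemma inj_mxop A C q x : tridiagonal lab U V W A ->
  inj_bound (diag unlab (-1) u0 A) (diag unlab 0 v0 A) (diag unlab 1 w0 A) dom C q ->
  lp p x -> mxop A x = 0 -> x = 0.
Proof.
move=> AM H /lpP[//|M M0 xM] Ax; have xb := lple_bdd p1 M0 xM.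
apply: funext => i; apply/eqP; rewrite -normc_eq0 eq_le normc_ge0 andbT.
rewrite -(ext_lab labP) -(mulr0 C).
apply: (H (ext x) M 0 (lab i)) => // [k||k /(domP labP)[j ->]].
- exact: normc_ext_le.
- exact: supp_ext.
- by rewrite -(mxop_jac labP _ _ _ _ _ AM) Ax normc0 mulr0.
Qed.

Lemma surj_mxop A C q : tridiagonal lab U V W A -> 0 < C -> 0 < q -> q < 1 ->
  dual_bound (diag unlab (-1) u0 A) (diag unlab 0 v0 A) (diag unlab 1 w0 A) dom dom C q ->
  exists2 C', 0 <= C' & forall b M, 0 <= M -> lple p b M ->
    exists2 x, lple p x (C' * M) & mxop A x = b.
Proof.
move=> AM C0 q0 q1 HT; pose q2 := (1 + q) / 2.
have q20 : 0 < q2 by rewrite /q2; lra.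
have q21 : q2 < 1 by rewrite /q2; lra.
have q2G : 0 <= 2 / (1 - q2) by rewrite divr_ge0 //; lra.
have C20 : 0 <= C * (2 / (1 - q2)) by rewrite mulr_ge0 // ltW.
exists (2 * (C * (2 / (1 - q2))) * (2 / (1 - q2))).
  by rewrite !mulr_ge0 // ?ltW // invr_gt0; lra.
move=> b M M0 bM; have bb := lple_bdd p1 M0 bM.
have [x [xD xs hx]] := solve C0 q0 q1 HT (normc_ext_le M0 bb).
exists (res lab x); last first.
  apply: funext => i; rewrite (mxop_jac labP u0 v0 w0 _ _ AM).
  have := hx (lab i) (@dom_lab _ _ _ labP i); rewrite (ext_lab labP) => <-.
  by rewrite /jac !(ext_res labP xD).
apply: (lple_dom_lab labP p1 C20 M0 q20 q21 _ bM) => i s s0 h; rewrite /res.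
apply: xs => // j /(domP labP)[k ->]; rewrite (ext_lab labP); exact: h.
Qed.

Lemma invertible_mxop A C q C' q' : tridiagonal lab U V W A -> 0 < C' -> 0 < q' -> q' < 1 ->
  inj_bound (diag unlab (-1) u0 A) (diag unlab 0 v0 A) (diag unlab 1 w0 A) dom C q ->
  dual_bound (diag unlab (-1) u0 A) (diag unlab 0 v0 A) (diag unlab 1 w0 A) dom dom C' q' ->
  invertible p (mxop A).
Proof.
move=> AM C0 q0 q1 hI hD; have [C2 C20 hs] := surj_mxop AM C0 q0 q1 hD.
apply: (@invertible_of _ _ _ p1 _ C2) => //; first exact: bounded_mxop.
by move=> x; apply: inj_mxop hI.
Qed.

Lemma inverse_bound A S C q : tridiagonal lab U V W A -> 0 < C -> 0 < q -> q < 1 ->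
  inj_bound (diag unlab (-1) u0 A) (diag unlab 0 v0 A) (diag unlab 1 w0 A) dom C q ->
  is_inverse p (mxop A) S -> (opnorm p S <= (2 * C * (2 / (1 - q)))%:E)%E.
Proof.
move=> AM C0 q0 q1 H [Sb hS]; apply: opnorm_le => // [|x x1].
  by rewrite !mulr_ge0 ?invr_ge0 ?subr_ge0 // ltW.
have xl : lp p x by apply/lpP => //; exists 1.
have [TS _] := hS x xl; have Sl : lp p (S x) by case: Sb => + _ _; exact.
rewrite -[_ * _]mulr1; apply: (lple_dom_lab labP p1 (ltW C0) ler01 q0 q1 _ x1) => i s s0 h.
have /lpP[//|M M0 SM] := Sl; rewrite -(ext_lab labP).
apply: (H _ M) => // [k||k /(domP labP)[j ->]].
- by apply: normc_ext_le => //; exact: lple_bdd SM.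
- exact: supp_ext.
- rewrite -(mxop_jac labP _ _ _ _ _ AM) TS; have := h j.
  by rewrite (_ : dst (lab i) (lab j) = dst (lab j) (lab i)) //; lia.
Qed.

End JacobiOperators.

(** * The finite section method *)

Section FiniteSections.
Variables (R : realType) (I : choiceType) (lab : I -> int) (unlab : int -> option I).
Hypothesis labP : labelling lab unlab.
Variable p : \bar R.
Hypothesis p1 : (1 <= p)%E.
Implicit Types (x y b : I -> R[i]) (A : I -> I -> R[i]).

Lemma lpnorm_ge0 x : p != +oo%E -> (0 <= lpnorm p x)%E.
Proof. by rewrite /lpnorm; case: p p1 => [r||] // _ _; exact: poweR_ge0. Qed.

Lemma cvg0_of_le (f : nat -> \bar R) : (forall n, (0 <= f n)%E) ->
  (forall e : R, 0 < e -> \forall n \near \oo, (f n <= e%:E)%E) -> f @ \oo --> 0%E.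
Proof.
move=> f0 h; apply/fine_cvgP; split.
  near=> n; rewrite fin_numE gt_eqF ?(lt_le_trans _ (f0 n)) ?ltNye //= lt_eqF //.
  by apply: (@le_lt_trans _ _ 1%:E); [near: n; exact: h|rewrite ltry].
apply/cvgrPdist_le => e e0; near=> n.
have fe : (f n <= e%:E)%E by near: n; exact: h.
rewrite sub0r normrN /comp; have := f0 n; case: (f n) fe => [a||] //=.
by rewrite !lee_fin => ae a0; rewrite ger0_norm.
Unshelve. all: by end_near.
Qed.

Lemma expr_small (q e : R) : 0 < q -> q < 1 -> 0 < e -> exists m, q ^+ m <= e.
Proof.
move=> q0 q1 e0; have := @cvg_expr R q; rewrite gtr0_norm // => /(_ q1).
move=> /cvgrPdist_le/(_ e e0)[m _ hm]; exists m; have := hm m (leqnn m).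
by rewrite /= sub0r normrN ger0_norm // exprn_ge0 // ltW.
Qed.

(** Some finite family carries the supremum of the partial sums up to e^r, so whatever is dominated
    by x and lives beyond the labels of this family has norm at most e. *)
Lemma lple_tail x M e : p != +oo%E -> 0 <= M -> lple p x M -> 0 < e ->
  exists k : nat, forall y, (forall i, normc (y i) <= normc (x i)) ->
    (forall i, (absz (lab i) <= k)%N -> y i = 0) -> lple p y e.
Proof.
move=> pr M0; rewrite /lple; case: p p1 pr => [r||] //; rewrite lee_fin => r1 _ xM e0.
have r0 : 0 < r by lra.
pose S := [set t : R | exists2 s : seq I, uniq s & t = \sum_(i <- s) normc (x i) `^ r].
have hS : has_sup S.
  split; first by exists 0, [::] => //; rewrite big_nil.
  by exists (M `^ r) => _ [s us ->]; exact: xM.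
have er0 : 0 < e `^ r by rewrite powR_gt0.
have [_ [s0 us0 ->] hs0] := sup_adherent er0 hS.
exists (\max_(i <- s0) absz (lab i))%N => y yx y0 s us.
pose s1 := [seq i <- s | i \notin s0].
have us1 : uniq (s0 ++ s1).
  rewrite cat_uniq us0 filter_uniq // andbT; apply/hasPn => i.
  by rewrite mem_filter => /andP[].
have : \sum_(i <- s0 ++ s1) normc (x i) `^ r <= sup S.
  by apply: sup_upper_bound => //; exists (s0 ++ s1).
rewrite big_cat /= => h.
apply: (@le_trans _ _ (\sum_(i <- s1) normc (x i) `^ r)); last lra.
rewrite big_filter [leRHS]big_mkcond /=; apply: ler_sum => i _.
case: ifPn => [_|/negPn si].
  by apply: ge0_ler_powR; rewrite ?nnegrE ?normc_ge0 //; lra.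
rewrite y0 ?normc0 ?powR0 ?gt_eqF //.
exact: (@leq_bigmax_seq _ s0 predT (fun i => absz (lab i))).
Qed.

Variables (U V W : set R[i]) (u0 v0 w0 : R[i]).
Hypotheses (Uc : compact (U : set R[i]^o)) (Vc : compact (V : set R[i]^o))
  (Wc : compact (W : set R[i]^o)) (Uu : U u0) (Vv : V v0) (Ww : W w0).

Local Notation ext := (extend unlab).
Local Notation dom := (domain unlab).
Local Notation jacA A := (jac (diag unlab (-1) u0 A) (diag unlab 0 v0 A) (diag unlab 1 w0 A)).

Variables (l r : nat -> int).
Hypotheses (lr_dom : forall n k, l n <= k <= r n -> dom k)
  (lr_large : forall k : nat, \forall n \near \oo, forall i, (absz (lab i) <= k)%N ->
     l n <= lab i <= r n).

Let D n : set I := [set i | l n <= lab i <= r n].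
Let Dz n : set int := [set k | l n <= k <= r n].

Lemma trunc_solP A b x n : tridiagonal lab U V W A ->
  trunc_sol A (D n) b x <-> supp (Dz n) (ext x) /\
    forall k, Dz n k -> jacA A (ext x) k = ext b k.
Proof.
move=> AM; have E : (forall i, ~ D n i -> x i = 0) ->
    forall i, \sum_(j \in D n) A i j * x j = jacA A (ext x) (lab i).
  move=> xD i; rewrite -(mxop_jac labP _ _ _ _ _ AM) /mxop.
  by apply: fsbig_widen => // j [_ /= nD]; rewrite xD ?mulr0.
split=> [[h1 h2]|[h1 h2]].
  split=> [k nk|k Dk].
    rewrite /extend; case F: (unlab k) => [i|//]; rewrite /= h2 //.
    by rewrite /D /= (labP.2 _ _ F).
  have [i ik] := domP labP (lr_dom Dk).
  by rewrite ik -E // (ext_lab labP) h1 // /D /= -ik.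
have xD i : ~ D n i -> x i = 0 by move=> nD; rewrite -(ext_lab labP) h1.
split=> // i Di; rewrite E // h2 //; exact: (ext_lab labP).
Qed.

Lemma window_bounded (a c : int) (z : int -> R[i]) : supp [set k | a <= k <= c] z ->
  exists2 M, 0 <= M & bdd z M.
Proof.
move=> zD; pose M := \sum_(k < (absz (c - a)).+1) normc (z (a + k%:Z)).
have M0 : 0 <= M by apply: sumr_ge0 => k _; exact: normc_ge0.
exists M => // k; have [/andP[ak kc]|/negP nk] := boolP (a <= k <= c); last first.
  by rewrite zD // normc0.
have hk : (absz (k - a) < (absz (c - a)).+1)%N by lia.
rewrite /M (bigD1 (Ordinal hk)) //= (_ : a + absz (k - a) = k); last by lia.
by apply: ler_wpDr => //; apply: sumr_ge0 => j _; exact: normc_ge0.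
Qed.

Lemma inj_bound_zero (u v w z : int -> R[i]) E C q M : inj_bound u v w E C q ->
  bdd z M -> supp E z -> (forall j, E j -> jac u v w z j = 0) -> forall k, z k = 0.
Proof.
move=> H zM zE hz k; apply/eqP; rewrite -normc_eq0 eq_le normc_ge0 andbT -(mulr0 C).
by apply: (H z M 0 k zM zE) => // j Ej; rewrite hz // normc0 mulr0.
Qed.

(** Let t be the part of x outside of the window. Then y - x + t lives in the window and is mapped
    there to the image of t, so the error is controlled, in weighted form, by the discarded part of
    x alone. *)
Lemma trunc_error A C q : tridiagonal lab U V W A -> 0 < C -> 0 < q -> q < 1 ->
  (forall n, inj_bound (diag unlab (-1) u0 A) (diag unlab 0 v0 A)
     (diag unlab 1 w0 A) (Dz n) C q) ->
  exists2 C2, 0 < C2 & forall x y n, trunc_sol A (D n) (mxop A x) y ->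
    (exists M, forall j, normc (x j) <= M) ->
    forall i s, 0 <= s ->
    (forall j, ~ D n j -> q ^+ dst (lab i) (lab j) * normc (x j) <= s) ->
    normc (y i - x i) <= C2 * s.
Proof.
move=> AM C0 q0 q1 hI; have [K K0 hK] := coefs_bounded Uc Vc Wc.
have cf := coefs_diag labP Uu Vv Ww AM.
(* C K / q bounds y - x + t, with 1 / q for the change of the weight between neighbouring sites; the
   summand 1 is for t itself. *)
exists (C * K / q + 1); first by rewrite addr_gt0 // divr_gt0 // mulr_gt0.
move=> x y n /(trunc_solP _ _ _ AM)[yD hy] [M xM] i s s0 hs.
pose t j := if `[< D n j >] then 0 else x j.
have tD j : D n j -> t j = 0 by rewrite /t => /asboolT ->.
have tnD j : ~ D n j -> t j = x j by rewrite /t => /asboolF ->.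
have ht j : q ^+ dst (lab i) (lab j) * normc (t j) <= s.
  have [Dj|nD] := pselect (D n j); first by rewrite tD // normc0 mulr0.
  by rewrite tnD //; exact: hs.
have hte k : q ^+ dst k (lab i) * normc (ext t k) <= s.
  rewrite /extend; case E: (unlab k) => [j|]; last first.
    by rewrite -[oapp _ _ _]/(0 : R[i]) normc0 mulr0.
  rewrite -[oapp _ _ _]/(t j) -(labP.2 _ _ E).
  by rewrite (_ : dst (lab j) (lab i) = dst (lab i) (lab j)) //; lia.
pose z k := ext y k - ext x k + ext t k.
have zD : supp (Dz n) z.
  move=> k nk; rewrite /z yD // sub0r /extend; case E: (unlab k) => [j|].
    rewrite -[oapp _ _ (Some j)]/(x j) -[oapp _ _ (Some j)]/(t j) tnD ?addNr //.
    by rewrite /D /= (labP.2 _ _ E).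
  by rewrite -[oapp _ _ _]/(0 : R[i]) -[oapp _ _ None]/(0 : R[i]) addr0 oppr0.
have [Mz _ zM] := window_bounded zD.
have hz k : Dz n k -> jacA A z k = jacA A (ext t) k.
  move=> Dk; have := hy k Dk; have [j kj] := domP labP (lr_dom Dk).
  rewrite {2}kj (ext_lab labP) (mxop_jac labP u0 v0 w0 _ _ AM) -kj => e.
  transitivity (jacA A (ext y) k - jacA A (ext x) k + jacA A (ext t) k).
    by rewrite /jac /z; ring.
  by rewrite e addrN add0r.
have zi : normc (z (lab i)) <= C * (K * (s / q)).
  apply: (hI n z Mz) => //; first by rewrite !mulr_ge0 ?invr_ge0 // ltW.
  move=> k Dk; rewrite hz //.
  have qk : 0 < q ^+ dst k (lab i) by exact: exprn_gt0.
  rewrite mulrC -ler_pdivlMr // -mulrA.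
  have hk m : (dst m k <= 1)%N -> normc (ext t m) <= s / q / q ^+ dst k (lab i).
    move=> mk; rewrite !ler_pdivlMr // -mulrA -exprSr mulrC.
    apply: le_trans (hte m); rewrite ler_wpM2r ?normc_ge0 //.
    apply: ler_wiXn2l; rewrite ?(ltW q0) ?(ltW q1) //; exact: dst_near'.
  apply: hK => //; apply: hk; [exact: dst_subr1| |exact: dst_addr1].
  by rewrite subrr.
have -> : y i - x i = z (lab i) - t i by rewrite /z !(ext_lab labP); ring.
apply: le_trans (le_normcB _ _) _; rewrite mulrDl mul1r; apply: lerD.
  by apply: le_trans zi _; rewrite !mulrA -(mulrA _ s) (mulrC s) !mulrA.
by have := ht i; rewrite subrr mul1r.
Qed.

Lemma fsm_of_bounds A C q C' q' : tridiagonal lab U V W A -> 0 < C' -> 0 < q' -> q' < 1 ->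
  0 < C -> 0 < q -> q < 1 -> convc dom ->
  (forall D, convc D -> inj_bound (diag unlab (-1) u0 A) (diag unlab 0 v0 A)
     (diag unlab 1 w0 A) D C q) ->
  (forall D, convc D -> dual_bound (diag unlab (-1) u0 A) (diag unlab 0 v0 A)
     (diag unlab 1 w0 A) D D C' q') ->
  fsm_applies p lab l r A.
Proof.
move=> AM C'0 q'0 q'1 C0 q0 q1 domc hI hD; rewrite /fsm_applies -/D.
have Dzc n : convc (Dz n).
  move=> i j k /= /andP[i1 i2] /andP[k1 k2] /andP[ij jk]; apply/andP; split.
    exact: le_trans i1 ij.
  exact: le_trans jk k2.
split.
- exact: (invertible_mxop labP p1 Uc Vc Wc Uu Vv Ww AM C'0 q'0 q'1 (hI _ domc) (hD _ domc)).
- near=> n => b /lpP[//|M M0 bM]; have bb := lple_bdd p1 M0 bM.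
  have [x [xD _ hx]] := solve C'0 q'0 q'1 (hD _ (Dzc n)) (normc_ext_le unlab M0 bb).
  have xdom : supp dom x by move=> k nk; apply: xD => /lr_dom.
  exists (res lab x); split=> [|y /(trunc_solP _ _ _ AM)[yD hy]].
    apply/(trunc_solP _ _ _ AM); split=> [k nk|k Dk].
      by rewrite (ext_res labP xdom) xD.
    by rewrite /jac !(ext_res labP xdom) -hx.
  pose z k := x k - ext y k.
  have zD : supp (Dz n) z by move=> k nk; rewrite /z xD // yD // subr0.
  have [Mz _ zM] := window_bounded zD.
  have z0 : forall k, z k = 0.
    apply: (inj_bound_zero (hI _ (Dzc n)) zM zD) => k Dk.
    transitivity (jacA A x k - jacA A (ext y) k); first by rewrite /jac /z; ring.
    by rewrite hx // hy // subrr.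
  apply: funext => i; have := z0 (lab i); rewrite /z (ext_lab labP) => /eqP.
  by rewrite subr_eq0 => /eqP.
have [C2 C20 err] := trunc_error AM C0 q0 q1 (fun n => hI _ (Dzc n)).
move=> b x xn bl /lpP[//|M M0 xM] Axb; rewrite -Axb => hxn.
have xb := lple_bdd p1 M0 xM.
have ex : exists M, forall j, normc (x j) <= M by exists M.
have errM n i : trunc_sol A (D n) (mxop A x) (xn n) -> normc (xn n i - x i) <= C2 * M.
  move=> hn; apply: (err x (xn n) n hn ex) => // j _.
  rewrite -[leRHS]mul1r; apply: ler_pM; rewrite ?normc_ge0 ?exprn_ge0 ?(ltW q0) //.
  by rewrite exprn_ile1 // ltW.
rewrite /fsm_cvg; case: eqP => [pE|/eqP pE].
  split.
    exists (C2 * M + M); near=> n.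
    have hn : trunc_sol A (D n) (mxop A x) (xn n) by near: n.
    rewrite lpnorm_le //; last by rewrite addr_ge0 // mulr_ge0 // ltW.
    rewrite /lple pE => i; have -> : xn n i = (xn n i - x i) + x i by rewrite subrK.
    by apply: le_trans (le_normcD _ _) _; rewrite lerD // errM.
  move=> j; apply/cvgrPdist_lt => -[e e'].
  rewrite ltcE /= => /andP[/eqP -> e0].
  have e20 : 0 < e / (2 * C2 * (M + 1)).
    by rewrite divr_gt0 // !mulr_gt0 // ltr_wpDl.
  (* For fixed j and large n all sites outside of the window are further than m from j, so the
     discarded part of x enters with a factor q^m. *)
  have [m hm] := expr_small q0 q1 e20.
  near=> n.
  have hn : trunc_sol A (D n) (mxop A x) (xn n) by near: n.
  have hl : forall i, (absz (lab i) <= absz (lab j) + m)%N -> l n <= lab i <= r n.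
    by near: n; exact: lr_large.
  rewrite normcE' ltcR normc_distC.
  apply: le_lt_trans (err x (xn n) n hn ex j (e / (2 * C2 * (M + 1)) * M) _ _) _.
  - by rewrite mulr_ge0 // ltW.
  - move=> i nD; apply: ler_pM; rewrite ?normc_ge0 ?exprn_ge0 ?(ltW q0) //.
    apply: le_trans hm; apply: ler_wiXn2l; rewrite ?(ltW q0) ?(ltW q1) //.
    rewrite leqNgt; apply/negP => im; apply: nD; apply: hl.
    by move: im; clear; lia.
  have hC : C2 * (e / (2 * C2 * (M + 1)) * M) = e * (M / (M + 1)) / 2.
    by field; rewrite ?gt_eqF //; lra.
  rewrite hC ltr_pdivrMr // ltr_pM2l // ltr_pdivrMr; lra.
apply: cvg0_of_le => [n|e e0]; first exact: lpnorm_ge0.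
pose C3 := 2 * C2 * (2 / (1 - q)).
have C30 : 0 < C3 by rewrite !mulr_gt0 // invr_gt0 subr_gt0.
have e20 : 0 < e / C3 by rewrite divr_gt0.
have [k hk] := lple_tail pE M0 xM e20.
near=> n.
have hn : trunc_sol A (D n) (mxop A x) (xn n) by near: n.
have hl : forall i, (absz (lab i) <= k)%N -> l n <= lab i <= r n.
  by near: n; exact: lr_large.
apply/lpnorm_le; [by []|exact: ltW|].
(* For p < oo the discarded part is small in norm, and the weighted error bound turns this into a
   norm bound. *)
pose t i := if `[< D n i >] then 0 else x i.
have tM : lple p t (e / C3).
  apply: hk => i; rewrite /t; first by case: asboolP => _; rewrite ?normc0 ?normc_ge0.
  by move=> /hl Di; rewrite asboolT.
have -> : e = C3 * (e / C3) by rewrite mulrC divfK // gt_eqF.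
apply: (lple_dom_lab labP p1 (ltW C20) (ltW e20) q0 q1 _ tM) => i s s0 h.
apply: (err x (xn n) n hn ex i s s0) => j nD.
by have := h j; rewrite /t asboolF.
Unshelve. all: by end_near.
Qed.

End FiniteSections.

(** * Ranges of infinite codimension *)

Section Codimension.
Variables (R : realType) (I : choiceType) (lab : I -> int) (unlab : int -> option I).
Hypothesis labP : labelling lab unlab.
Variable p : \bar R.
Hypothesis p1 : (1 <= p)%E.
Implicit Types (x y z b : I -> R[i]) (T : (I -> R[i]) -> (I -> R[i])).

Local Notation ext := (extend unlab).
Local Notation dom := (domain unlab).

(* Stands in for a null vector of the adjoint of a limit of translates of T: far enough
   from each other, infinitely many such f are independent modulo the range of T. *)
Definition almost_annihilated T (Phi : R -> R) := forall (e : R) (K : nat), 0 < e ->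
  exists a n (Y f : int -> R[i]),
  [/\ forall m, (m < n)%N -> (K < absz (a + m%:Z)%R)%N,
      forall k, ~ (a <= k < a + n%:Z) -> f k = 0,
      supp dom f /\ lple p (res lab f) 1,
      \sum_(m < n) Y (a + m%:Z) * f (a + m%:Z) = 1 &
      forall z M, 0 <= M -> lple p z M ->
        normc (\sum_(m < n) Y (a + m%:Z) * ext (T z) (a + m%:Z)) <= e * Phi M].

Lemma row_kernel (m : nat) (c : 'M[R[i]]_(m.+1, m)) : exists2 l : 'rV_m.+1, l != 0 & l *m c = 0.
Proof.
have : kermx c != 0.
  by rewrite -mxrank_eq0 mxrank_ker subn_eq0 -ltnNge ltnS rank_leq_col.
by move=> /rowV0Pn[l /sub_kermxP lc l0]; exists l.
Qed.

(** The layers nu i = n are disjoint, and (2^-n)^r <= 2^-n makes their masses sum to at most 2 <=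
    2^r. *)
Lemma lple_layers (nu : I -> nat) (g : nat -> I -> R[i]) (h : I -> R[i]) :
  (forall n, lple p (g n) 1) ->
  (forall i, normc (h i) <= 2^-1 ^+ nu i * normc (g (nu i) i)) -> lple p h 2.
Proof.
rewrite /lple; case: p p1 => [r||] // + hg hh => [|_ i]; last first.
  apply: le_trans (hh i) _; apply: (@le_trans _ _ (1 * 1)); last by lra.
  by apply: ler_pM; rewrite ?normc_ge0 ?exprn_ge0 ?invr_ge0 ?exprn_ile1 ?invr_ge0 ?invf_le1 ?ler1n.
rewrite lee_fin => r1 s us; have r0 : 0 <= r by lra.
have hV : (0 : R) <= 2^-1 by rewrite invr_ge0.
pose N := (\max_(i <- s) nu i).+1.
have sN i : i \in s -> (nu i < N)%N.
  by move=> si; rewrite ltnS (@leq_bigmax_seq _ s predT nu).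
apply: (@le_trans _ _ (\sum_(i <- s) \sum_(n < N | n == nu i :> nat)
    2^-1 ^+ n * normc (g n i) `^ r)).
  rewrite big_seq [leRHS]big_seq; apply: ler_sum => i si.
  rewrite (big_pred1 (Ordinal (sN i si))) //=.
  apply: (@le_trans _ _ ((2^-1 ^+ nu i * normc (g (nu i) i)) `^ r)).
    by apply: ge0_ler_powR; rewrite ?nnegrE ?normc_ge0 ?mulr_ge0 ?exprn_ge0 ?normc_ge0.
  rewrite powRM ?exprn_ge0 ?normc_ge0 // ler_wpM2r ?powR_ge0 //.
  apply: ge1r_powR => //; rewrite exprn_gt0 ?invr_gt0 //=.
  by rewrite exprn_ile1 // invf_le1 // ler1n.
rewrite (exchange_big_dep predT) //=.
apply: (@le_trans _ _ (\sum_(n < N) 2^-1 ^+ n)).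
  apply: ler_sum => n _; rewrite -mulr_sumr -[leRHS]mulr1 ler_wpM2l ?exprn_ge0 //.
  rewrite -big_filter; have := hg n [seq i <- s | n == nu i :> nat].
  by rewrite powR1; apply; rewrite filter_uniq.
apply: (@le_trans _ _ 2); last by apply: le1r_powR; rewrite ?ler1n.
have := subrX1 (2^-1 : R) N; have := exprn_ge0 N hV.
move: (\sum_(n < N) _) => S; move: (2^-1 ^+ N) => t; lra.
Qed.

(** Test vectors f_n in disjoint windows are superposed with coefficients 2^-n, separately for each
    residue s of n modulo b + 1. If the codimension were b, a nontrivial combination of these b + 1
    vectors would be some T Z, with a coefficient l s0 different from 0. For n in the class of s0,
    the n-th functional has modulus |l s0| 2^-n on it, but at most 4^-n Phi(M) on T Z: impossible
    for large n. *)
Lemma infinite_codim T Phi (b : nat) :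
  (forall (a : R[i]) x y, T (a *: x + y) = a *: T x + T y) ->
  almost_annihilated T Phi -> quotient_dim (lp p) (T @` (lp p)) b -> False.
Proof.
move=> Tlin HT [e [he hq]].
have H (t : nat * nat) : exists d : int * nat * (int -> R[i]) * (int -> R[i]),
    let: (a, n, Y, f) := d in
  [/\ forall m, (m < n)%N -> (t.2 < absz (a + m%:Z)%R)%N,
      forall k, ~ (a <= k < a + n%:Z) -> f k = 0,
      supp dom f /\ lple p (res lab f) 1,
      \sum_(m < n) Y (a + m%:Z) * f (a + m%:Z) = 1 &
      forall z M, 0 <= M -> lple p z M ->
        normc (\sum_(m < n) Y (a + m%:Z) * ext (T z) (a + m%:Z)) <= 4^-1 ^+ t.1 * Phi M].
  have [|a [n [Y [f h]]]] := HT (4^-1 ^+ t.1) t.2; first by rewrite exprn_gt0 ?invr_gt0.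
  by exists (a, n, Y, f).
have {H}[d hd] := choice H.
pose fa nK := (d nK).1.1.1; pose fn nK := (d nK).1.1.2.
pose fY nK := (d nK).1.2; pose ff nK := (d nK).2.
have {}hd nK : [/\ forall m, (m < fn nK)%N -> (nK.2 < absz (fa nK + m%:Z)%R)%N,
      forall k, ~ (fa nK <= k < fa nK + (fn nK)%:Z) -> ff nK k = 0,
      supp dom (ff nK) /\ lple p (res lab (ff nK)) 1,
      \sum_(m < fn nK) fY nK (fa nK + m%:Z) * ff nK (fa nK + m%:Z) = 1 &
      forall z M, 0 <= M -> lple p z M ->
        normc (\sum_(m < fn nK) fY nK (fa nK + m%:Z) * ext (T z) (fa nK + m%:Z)) <=
        4^-1 ^+ nK.1 * Phi M].
  by have := hd nK; rewrite /fa /fn /fY /ff; case: (d nK) => [[[]]].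
(* K n bounds the windows before the n-th one, so the n-th window lies in the shell K n < |k| <= K
   (n + 1); [nu] below is the number of the shell. *)
pose fix K n := if n is n'.+1 then (K n' + absz (fa (n', K n')) + fn (n', K n')).+1 else 0%N.
pose w n := (n, K n).
have Kmono m n : (m <= n)%N -> (K m <= K n)%N.
  elim: n => [|n IH]; first by rewrite leqn0 => /eqP ->.
  rewrite leq_eqVlt => /orP[/eqP -> //|]; rewrite ltnS => /IH /leq_trans; apply.
  by rewrite /=; lia.
have Kn n : (n <= K n)%N by elim: n => // n IH; rewrite /=; lia.
have win n m : (m < fn (w n))%N ->
    (K n < absz (fa (w n) + m%:Z)%R)%N /\ (absz (fa (w n) + m%:Z)%R <= K n.+1)%N.
  move=> hm; have [h _ _ _ _] := hd (w n); split; first exact: h.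
  rewrite /= -/(w n); move: hm; clear; lia.
have ex (k : int) : exists n, (absz k <= K n.+1)%N /\ forall m, (absz k <= K m.+1)%N -> (n <= m)%N.
  have ex : exists n, (absz k <= K n.+1)%N by exists (absz k); have := Kn (absz k).+1; lia.
  by case: (ex_minnP ex) => n h1 h2; exists n.
have {ex}[nu hnu] := choice ex.
have nuE n k : (K n < absz k)%N -> (absz k <= K n.+1)%N -> nu k = n.
  move=> h1 h2; have [h3 h4] := hnu k; apply/eqP; rewrite eqn_leq h4 //=.
  rewrite leqNgt; apply/negP => h5; have := Kmono _ _ h5; lia.
pose F (s : 'I_b.+1) (i : I) : R[i] := if (nu (lab i) %% b.+1 == s)%N
  then (2^-1 ^+ nu (lab i))%:C * ff (w (nu (lab i))) (lab i) else 0.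
have Flp s : lp p (F s).
  apply/lpP => //; exists 2 => //.
  apply: (@lple_layers (fun i => nu (lab i)) (fun n => res lab (ff (w n)))).
    by move=> n; have [_ _ []] := hd (w n).
  move=> i; rewrite /F; case: ifP => _.
    by rewrite normcM normc_real ger0_norm // exprn_ge0 // invr_ge0.
  by rewrite normc0 mulr_ge0 ?exprn_ge0 ?invr_ge0 ?normc_ge0.
have /choice[c hc] : forall s, exists c : 'I_b -> R[i],
    (T @` lp p) (F s - \sum_(k < b) c k *: e k).
  by move=> s; have [c [h _]] := hq _ (Flp s); exists c.
have /choice[z hz] : forall s, exists z, lp p z /\ T z = F s - \sum_(k < b) c s k *: e k.
  by move=> s; have [z zl zE] := hc s; exists z.
(* Modulo the range, b + 1 vectors are given by b coordinates each, hence are dependent. *)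
have [l l0 lc] := row_kernel (\matrix_(s < b.+1, k < b) c s k).
have [s0 ls0] : exists s0, l 0 s0 != 0.
  apply: contrapT => h; move/eqP: l0; apply; apply/rowP => s; rewrite mxE.
  by apply/eqP/negPn/negP => hs; apply: h; exists s.
pose Z := \sum_(s < b.+1) l 0 s *: z s.
have lp0 : lp p (0 : I -> R[i]).
  have /lpP[//|M M0 FM] := Flp ord0; apply/lpP => //; exists M => //.
  by apply: lple_le FM => // i; rewrite normc0 normc_ge0.
have T0 : T 0 = 0.
  by have := Tlin (-1) 0 0; rewrite scaler0 addr0 scaleN1r addNr.
have ZP (r : seq 'I_b.+1) : lp p (\sum_(s <- r) l 0 s *: z s) /\
    T (\sum_(s <- r) l 0 s *: z s) = \sum_(s <- r) l 0 s *: T (z s).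
  elim: r => [|s r [IH1 IH2]]; first by rewrite !big_nil.
  by rewrite !big_cons; split; [apply: lpD => //; case: (hz s)|rewrite Tlin IH2].
have TZ : T Z = \sum_(s < b.+1) l 0 s *: F s.
  rewrite (ZP _).2; under eq_bigr => s _ do rewrite (hz s).2 scalerBr scaler_sumr.
  rewrite sumrB exchange_big /= [X in _ - X]big1 ?subr0 // => k _.
  under eq_bigr => s _ do rewrite scalerA.
  rewrite -scaler_suml; have /rowP/(_ k) := lc; rewrite !mxE.
  by under eq_bigr => s _ do rewrite mxE; move=> ->; rewrite scale0r.
have /lpP[//|M M0 ZM] := (ZP (index_enum _)).1.
have TZw n k : (n %% b.+1 == s0)%N -> fa (w n) <= k < fa (w n) + (fn (w n))%:Z ->
    ext (T Z) k = l 0 s0 * (2^-1 ^+ n)%:C * ff (w n) k.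
  move=> ns0 hk; have [_ _ [fD _] _ _] := hd (w n).
  have [h1 h2] : (K n < absz k)%N /\ (absz k <= K n.+1)%N.
    have hm : (absz (k - fa (w n)) < fn (w n))%N by move: hk; clear; lia.
    have := win n _ hm; rewrite (_ : _ + _ = k) //.
    by move: hk; clear; lia.
  have nuk := nuE _ _ h1 h2.
  rewrite /extend; case E: (unlab k) => [i|]; last first.
    by rewrite -[oapp _ _ _]/(0 : R[i]) fD ?mulr0 // /domain /= E.
  rewrite -[oapp _ _ _]/(T Z i) TZ fct_sumE.
  rewrite (eq_bigr (fun s => l 0 s * F s i)) // (bigD1 s0) //= big1 => [|s ss0].
    by rewrite addr0 /F (labP.2 _ _ E) nuk ns0 -mulrA.
  rewrite /F (labP.2 _ _ E) nuk; case: eqP => [ns|_].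
    by case/negP: ss0; apply/eqP/val_inj; rewrite /= -ns (eqP ns0).
  by rewrite mulr0.
have key n : (n %% b.+1 == s0)%N -> normc (l 0 s0) * 2 ^+ n <= Phi M.
  move=> ns0; have [_ _ _ h1 h2] := hd (w n).
  have := h2 Z M M0 ZM.
  rewrite (eq_bigr (fun m : 'I_(fn (w n)) => l 0 s0 * (2^-1 ^+ n)%:C *
      (fY (w n) (fa (w n) + m%:Z) * ff (w n) (fa (w n) + m%:Z)))); last first.
    move=> m _; rewrite (TZw n) //; last by have := ltn_ord m; clear; lia.
    by rewrite mulrCA.
  rewrite -mulr_sumr h1 mulr1 normcM normc_real ger0_norm ?exprn_ge0 ?invr_ge0 //.
  rewrite [(w n).1]/= => h.
  have e2 : (2^-1 : R) ^+ n * 2 ^+ n = 1 by rewrite -exprMn mulVf // expr1n.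
  have e4 : (4^-1 : R) ^+ n = 2^-1 ^+ n * 2^-1 ^+ n.
    by rewrite -exprMn; congr (_ ^+ _); lra.
  rewrite e4 in h; have t0 : (0 : R) < 2 ^+ n by exact: exprn_gt0.
  have := ler_wpM2r (ltW (mulr_gt0 t0 t0)) h.
  move: e2; move: (2^-1 ^+ n) (2 ^+ n) (normc _) (Phi M) => u v x y e2.
  have -> : x * u * (v * v) = x * v * (u * v) by ring.
  have -> : u * u * y * (v * v) = y * (u * v) * (u * v) by ring.
  by rewrite e2 !mulr1.
have ls : 0 < normc (l 0 s0) by rewrite normc_gt0.
pose m := (Num.truncn (Phi M / normc (l 0 s0))).+1.
have := key (m * b.+1 + s0)%N; rewrite modnMDl modn_small ?ltn_ord // eqxx => /(_ isT).
have h1 : Phi M / normc (l 0 s0) < m%:R by exact: truncnS_gt.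
have h2 : m%:R <= 2 ^+ (m * b.+1 + s0)%N :> R.
  rewrite -natrX ler_nat; apply: leq_trans (ltnW (ltn_expl _ (isT : (1 < 2)%N))) _.
  by rewrite leq_exp2l //; lia.
rewrite ltr_pdivrMr // in h1; rewrite leNgt => /negP; apply.
by apply: lt_le_trans h1 _; rewrite mulrC ler_wpM2l // ltW.
Qed.

End Codimension.

(** * Patterns found in a pseudoergodic matrix *)

Section Windows.
Variables (R : realType) (I : choiceType) (lab : I -> int) (unlab : int -> option I).
Hypothesis labP : labelling lab unlab.
Variables (U V W : set R[i]) (u0 v0 w0 : R[i]).
Implicit Types (A : I -> I -> R[i]).

Local Notation ext := (extend unlab).
Local Notation dom := (domain unlab).
Local Notation du A := (diag unlab (-1) u0 A).
Local Notation dv A := (diag unlab 0 v0 A).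
Local Notation dw A := (diag unlab 1 w0 A).

Definition close (e : R) (u v w u' v' w' : int -> R[i]) (i j : int) :=
  [/\ normc (u i - u' j) <= e, normc (v i - v' j) <= e & normc (w i - w' j) <= e].

(** The entrywise form of pseudoergodicity shared by Z and N, with rows and columns addressed by
    labels. *)
Definition has_windows A := forall (n : nat) (B : 'I_n -> 'I_n -> R[i]) (e : R),
  (0 < n)%N -> Mfin U V W B -> 0 < e ->
  exists k : int, forall i j : 'I_n, exists a b,
    [/\ lab a = k + labI i, lab b = k + labI j & normc (B i j - A a b) <= e].

(** Only the rows 2, ..., n - 1 of a finite pattern carry all three entries, whence the smaller
    range in the second conclusion. *)
Lemma window_close A n u v w e : has_windows A -> (0 < n)%N -> coefs U V W u v w -> 0 < e ->
  exists k : int, (forall i : int, 1 <= i <= n%:Z -> dom (k + i)) /\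
    forall i : int, 2 <= i <= n%:Z - 1 -> close e u v w (du A) (dv A) (dw A) i (k + i).
Proof.
move=> HA n0 cf e0.
have BM : Mfin U V W (mat (@labI n) u v w) := mat_tridiagonal (@labI n) cf.
have [k hk] := HA n _ e n0 BM e0.
have hi (i : int) : 1 <= i <= n%:Z -> exists i' : 'I_n, i = labI i'.
  move=> hi; have h : (absz (i - 1) < n)%N by lia.
  by exists (Ordinal h); rewrite /labI /=; lia.
exists k; split=> [i /hi[i' ->]|i hi2].
  by have [a [_ [<- _ _]]] := hk i' i'; exact: dom_lab.
have [i1 E1] : exists i' : 'I_n, i = labI i' by apply: hi; lia.
have [i2 E2] : exists i' : 'I_n, i - 1 = labI i' by apply: hi; lia.
have [i3 E3] : exists i' : 'I_n, i + 1 = labI i' by apply: hi; lia.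
have ee1 : (i - 1 == i - 1) = true by lia.
have ee2 : (i - 1 == i) = false by lia.
have ee3 : (i - 1 == i + 1) = false by lia.
have ee4 : (i == i - 1) = false by lia.
have ee5 : (i == i + 1) = false by lia.
have ee6 : (i + 1 == i - 1) = false by lia.
have ee7 : (i + 1 == i) = false by lia.
split; rewrite /diag.
- have [a [b [la lb h]]] := hk i1 i2; move: la lb h; rewrite /mat -E1 -E2 => la lb h.
  rewrite -la labP.1 la -addrA -lb labP.1; move: h.
  by rewrite /entry ee1 ee2 ee3 mulr1n !mulr0n mul1r !mul0r !addr0.
- have [a [b [la lb h]]] := hk i1 i1; move: la lb h; rewrite /mat -E1 => la lb h.
  have ab : a = b by apply: (lab_inj labP); rewrite la lb.
  rewrite addr0 -la labP.1; move: h; rewrite -ab.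
  by rewrite /entry eqxx ee4 ee5 mulr1n !mulr0n mul1r !mul0r addr0 add0r.
- have [a [b [la lb h]]] := hk i1 i3; move: la lb h; rewrite /mat -E1 -E3 => la lb h.
  rewrite -la labP.1 la -addrA -lb labP.1; move: h.
  by rewrite /entry eqxx ee6 ee7 mulr1n !mulr0n mul1r !mul0r !add0r.
Qed.

Lemma far_window A u v w e (N K : nat) : has_windows A -> coefs U V W u v w -> 0 < e ->
  exists k : int, (forall j : int, (absz j <= N.+1)%N -> dom (k + j) /\ (K < absz (k + j)%R)%N) /\
    forall j : int, (absz j <= N)%N -> close e u v w (du A) (dv A) (dw A) j (k + j).
Proof.
move=> HA cf e0.
(* Two copies of the pattern, so far apart that one of them avoids [-K, K]. *)
pose len : nat := (N.+1 + N.+1).+1; pose sd : nat := (len + K + K).+1.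
pose c : int := N.+2%:Z.
pose dup (a : int -> R[i]) (i : int) := if i <= len%:Z then a (i - c) else a (i - sd%:Z - c).
have cf' : coefs U V W (dup u) (dup v) (dup w).
  by move=> i; rewrite /dup; case: ifP => _; exact: cf.
have n0 : (0 < len + sd)%N by rewrite /len.
have [k [kd kc]] := window_close HA n0 cf' e0.
have [hK|hK] := ltP (k + len%:Z) (- K%:Z).
  exists (k + c); split=> j hj; have cj : k + c + j = k + (c + j) by rewrite addrA.
    split; first by rewrite cj; apply: kd; rewrite /c /sd /len; lia.
    by move: hK; rewrite /c /len; lia.
  have h : 2 <= c + j <= (len + sd)%N%:Z - 1 by rewrite /c /sd /len; lia.
  have hl : c + j <= len%:Z by rewrite /c /len; lia.
  have := kc _ h; rewrite -cj /close /dup hl.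
  by have -> : c + j - c = j by rewrite addrAC addrN add0r.
exists (k + sd%:Z + c); split=> j hj; have cj : k + sd%:Z + c + j = k + (sd%:Z + c + j).
- by rewrite !addrA.
- split; first by rewrite cj; apply: kd; rewrite /c /sd /len; lia.
  by move: hK; rewrite /c /sd /len; lia.
- by rewrite !addrA.
- have h : 2 <= sd%:Z + c + j <= (len + sd)%N%:Z - 1 by rewrite /c /sd /len; lia.
  have hl : (sd%:Z + c + j <= len%:Z) = false by rewrite /c /sd /len; lia.
  have := kc _ h; rewrite -cj /close /dup hl.
  by have -> : sd%:Z + c + j - sd%:Z - c = j by lia.
Qed.

(** Reflection turns a null vector for U, V, W into one for W, V, U, which is a null vector of the
    transpose of a matrix over U, V, W. Near-maximality of the entry moved to 0 gives the bound
    2. *)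
Lemma not_nullfreeT : ~ nullfree U V W [set setT] -> exists u v w y,
  [/\ coefs U V W u v w, bdd y 2, y 0 = 1 & forall i, jacT u v w y i = 0].
Proof.
move=> nnf; have : ~ nullfree W V U [set setT] by move=> /nullfreeT_opp.
move=> /not_nullfree[u [v [w [D [y [M [i0 [cf /= DE yM _ [hy yi0]]]]]]]]].
have y0 : 0 < normc (y i0) by rewrite normc_gt0; apply/eqP.
have [k hk] := near_sup (f := fun i => normc (y i)) yM y0.
have yk : 0 < normc (y k) by have := hk i0; lra.
have cf' := coefs_tr (coefs_transl k cf).
exists (fun i => transl k w (i - 1)), (transl k v), (fun i => transl k u (i + 1)),
  (fun i => (y k)^-1 * transl k y i); split.
- exact: cf'.
- by move=> i; rewrite normcM normcV mulrC ler_pdivrMr //; exact: hk.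
- by rewrite /transl add0r mulVf // -normc_gt0.
- move=> i; rewrite /jacT (_ : (fun i => _) = transl k u); last first.
    by apply: funext => j; rewrite subrK.
  rewrite (_ : (fun i => transl k w (i + 1 - 1)) = transl k w); last first.
    by apply: funext => j; rewrite addrK.
  by rewrite jacZ jac_transl hy ?mulr0 // DE.
Qed.

End Windows.

(** * Cutting off a null vector of the transpose *)

Section Annihilation.
Variables (R : realType) (I : choiceType) (lab : I -> int) (unlab : int -> option I).
Hypothesis labP : labelling lab unlab.
Variables (U V W : set R[i]) (u0 v0 w0 : R[i]).
Hypotheses (Uc : compact (U : set R[i]^o)) (Vc : compact (V : set R[i]^o))
  (Wc : compact (W : set R[i]^o)) (Uu : U u0) (Vv : V v0) (Ww : W w0).
Implicit Types (A : I -> I -> R[i]) (z : I -> R[i]).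

Local Notation ext := (extend unlab).
Local Notation dom := (domain unlab).
Local Notation du A := (diag unlab (-1) u0 A).
Local Notation dv A := (diag unlab 0 v0 A).
Local Notation dw A := (diag unlab 1 w0 A).

(** Y vanishes at the ends of the range, so moving the matrix to the other factor leaves no boundary
    terms. *)
Lemma sum_by_parts (u v w Y x : int -> R[i]) (H : nat) :
  (forall j : int, (H <= absz j)%N -> Y j = 0) ->
  \sum_(m < (H + H).+1) Y (- H%:Z + m%:Z) * jac u v w x (- H%:Z + m%:Z) =
  \sum_(m < (H + H).+1) jacT u v w Y (- H%:Z + m%:Z) * x (- H%:Z + m%:Z).
Proof.
move=> YH.
transitivity (\sum_(m < (H + H).+1) \sum_(b < (H + H).+1) Y (- H%:Z + m%:Z) *
    (entry u v w (- H%:Z + m%:Z) (- H%:Z + b%:Z) * x (- H%:Z + b%:Z))).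
  apply: eq_bigr => m _; rewrite -mulr_sumr.
  have [hm|hm] := leqP H (absz (- H%:Z + m%:Z)); first by rewrite YH // !mul0r.
  by rewrite sum_entry //; move: hm; clear; lia.
rewrite exchange_big; apply: eq_bigr => b _ /=.
rewrite -(@sum_entryT R u v w Y (- H%:Z) (- H%:Z + b%:Z) (H + H).+1) => [|i hi].
  by rewrite mulr_suml; apply: eq_bigr => m _; rewrite mulrA.
by apply: YH; move: hi; clear; lia.
Qed.

Section Weight.
Variables (q : R) (N : nat).
Hypotheses (q0 : 0 < q) (q1 : q < 1).

(** Subtracting q^N makes the cut-off at |j| = N continuous, so that the increments between
    neighbours keep the bound (q^-1 - 1) q^|j| across it ([weight_lip]). *)
Definition weight (j : int) : R := if (absz j <= N)%N then q ^+ absz j - q ^+ N else 0.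

Lemma weight_ge0 j : 0 <= weight j.
Proof.
rewrite /weight; case: ifP => // jN.
by rewrite subr_ge0; apply: ler_wiXn2l => //; exact: ltW.
Qed.

Lemma weight_le j : weight j <= q ^+ absz j.
Proof.
rewrite /weight; case: ifP => _; last by rewrite exprn_ge0 // ltW.
by rewrite gerBl exprn_ge0 // ltW.
Qed.

Lemma weight_ge j : q ^+ absz j <= weight j + q ^+ N.
Proof.
rewrite /weight; case: ifPn => [_|]; first by rewrite subrK.
by rewrite -ltnNge add0r => /ltnW jN; apply: ler_wiXn2l => //; exact: ltW.
Qed.

Lemma weight_lip j j' : (absz j <= (absz j').+1)%N -> (absz j' <= (absz j).+1)%N ->
  `|weight j' - weight j| <= (q^-1 - 1) * q ^+ absz j'.
Proof.
have q01 : 0 < q < 1 by rewrite q0.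
have B : 0 <= (q^-1 - 1) * q ^+ absz j'.
  by rewrite mulr_ge0 ?exprn_ge0 ?(ltW q0) // subr_ge0 invf_ge1 // ltW.
move=> h1 h2; have := expr_dist_le q01 h1 h2; rewrite /weight.
have [j'N|Nj'] := leqP (absz j') N; have [jN|Nj] := leqP (absz j) N => H.
- by rewrite opprB addrA subrK.
- have -> : absz j' = N by lia.
  by rewrite subrr subr0 normr0 (_ : N = absz j') //; lia.
- have -> : absz j = N by lia.
  by rewrite subrr subr0 normr0.
- by rewrite subr0 normr0.
Qed.

End Weight.

(** After summation by parts the functional acts on z through the transposed matrix applied to the
    weighted y. As y is null for the transposed pattern, two errors remain: the deviation of A from
    the pattern, three entries times e times the bound 2 for the weighted y, hence 6 e; and the
    commutator with the weight, which involves the two off-diagonals and has the factor q^-1 - 1. *)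
Lemma weighted_annihilation A : tridiagonal lab U V W A -> has_windows lab U V W A ->
  ~ nullfree U V W [set setT] ->
  exists2 K : R, 0 < K & exists y : int -> R[i], [/\ bdd y 2, y 0 = 1 &
    forall q (N K0 : nat) e, 0 < q -> q < 1 -> 0 < e -> exists k : int,
    (forall j : int, (absz j <= N.+1)%N -> dom (k + j) /\ (K0 < absz (k + j)%R)%N) /\
    forall z, normc (\sum_(m < (N.+1 + N.+1).+1) (weight q N (- N.+1%:Z + m%:Z))%:C *
        y (- N.+1%:Z + m%:Z) * ext (mxop A z) (k + (- N.+1%:Z + m%:Z))) <=
      \sum_(m < (N.+1 + N.+1).+1)
        (6 * e + K * (q^-1 - 1) *
          (q ^+ absz (- N.+1%:Z + m%:Z - 1)%R * normc (y (- N.+1%:Z + m%:Z - 1)) +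
           q ^+ absz (- N.+1%:Z + m%:Z + 1)%R * normc (y (- N.+1%:Z + m%:Z + 1)))) *
        normc (ext z (k + (- N.+1%:Z + m%:Z)))].
Proof.
move=> AM HA /not_nullfreeT[u [v [w [y [cf yM y0 hy]]]]].
have [K1 K10 hU] := compact_normc_bounded Uc.
have [K2 K20 hW] := compact_normc_bounded Wc.
exists (K1 + K2); first lra.
exists y; split=> // q N K0 e q0 q1 e0.
have [k [kd kc]] := far_window labP u0 v0 w0 N K0 HA cf e0.
exists k; split=> // z.
pose Y (j : int) : R[i] := (weight q N j)%:C * y j.
have Y0 j : (N.+1 <= absz j)%N -> Y j = 0.
  by move=> jN; rewrite /Y /weight leqNgt jN /= mul0r.
have Y2 j : normc (Y j) <= 2.
  rewrite normcM normc_real ger0_norm ?weight_ge0 //.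
  have := weight_le N q0 j; have : q ^+ absz j <= 1 by rewrite exprn_ile1 // ltW.
  have := weight_ge0 N q0 q1 j; have := yM j; have := normc_ge0 (y j).
  move: (weight q N j) (normc (y j)) (q ^+ _) => a b c *; nra.
pose a := transl k (du A); pose b := transl k (dv A); pose c := transl k (dw A).
have -> : \sum_(m < (N.+1 + N.+1).+1) (weight q N (- N.+1%:Z + m%:Z))%:C *
        y (- N.+1%:Z + m%:Z) * ext (mxop A z) (k + (- N.+1%:Z + m%:Z)) =
    \sum_(m < (N.+1 + N.+1).+1) jacT a b c Y (- N.+1%:Z + m%:Z) *
      transl k (ext z) (- N.+1%:Z + m%:Z).
  rewrite -sum_by_parts //; apply: eq_bigr => m _; congr (_ * _).
  have hm : (absz (- N.+1%:Z + m%:Z)%R <= N.+1)%N by have := ltn_ord m; clear; lia.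
  have [kdm _] := kd _ hm; have [i ik] := domP labP kdm.
  rewrite ik (ext_lab labP) (mxop_jac labP u0 v0 w0 _ _ AM) -ik jac_transl.
  by rewrite [X in jac _ _ _ _ X]addrC.
apply: le_trans (le_normc_sum _ _ _) _; apply: ler_sum => m _.
have hm : (absz (- N.+1%:Z + m%:Z)%R <= N.+1)%N by have := ltn_ord m; clear; lia.
rewrite normcM /transl [X in normc (ext z X)]addrC ler_wpM2r ?normc_ge0 //.
move: (- N.+1%:Z + m%:Z) hm => j hj {m}.
have near_true (t s : int -> R[i]) j' : ((absz j' <= N)%N -> normc (s j' - t (k + j')) <= e) ->
    normc ((t (k + j') - s j') * Y j') <= 2 * e.
  move=> h; have [jN|/Y0 ->] := leqP (absz j') N; last first.
    by rewrite mulr0 normc0 mulr_ge0 // ltW.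
  rewrite normcM normc_distC mulrC; apply: ler_pM; rewrite ?normc_ge0 //; exact: h.
have comm (s : int -> R[i]) (K : R) j' : (forall i, normc (s i) <= K) ->
    (absz j <= (absz j').+1)%N -> (absz j' <= (absz j).+1)%N ->
    normc (s j' * ((weight q N j' - weight q N j)%:C * y j')) <=
    K * (q^-1 - 1) * (q ^+ absz j' * normc (y j')).
  move=> sK h1 h2; rewrite !normcM normc_real -mulrA mulrA.
  have := weight_lip N q0 q1 h1 h2 => h.
  rewrite -mulrA; apply: ler_pM; rewrite ?normc_ge0 ?mulr_ge0 ?normc_ge0 //.
  by rewrite mulrA ler_wpM2r ?normc_ge0.
have -> : jacT a b c Y j =
    (dw A (k + (j - 1)) - w (j - 1)) * Y (j - 1) + (dv A (k + j) - v j) * Y j +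
    (du A (k + (j + 1)) - u (j + 1)) * Y (j + 1) +
    (w (j - 1) * ((weight q N (j - 1) - weight q N j)%:C * y (j - 1)) +
     u (j + 1) * ((weight q N (j + 1) - weight q N j)%:C * y (j + 1))).
  have := hy j; rewrite /jacT /jac /a /b /c /transl /Y !rmorphB /=.
  rewrite (addrC (j - 1) k) (addrC (j + 1) k) (addrC j k) => e1.
  rewrite -[LHS]subr0 -(mulr0 (weight q N j)%:C) -{}e1; ring.
apply: le_trans (le_normcD _ _) _; apply: lerD.
  apply: le_trans (normc_add3 _ _ _) _.
  have h1 := near_true (dw A) w (j - 1) (fun h => let: And3 _ _ h := kc _ h in h).
  have h2 := near_true (dv A) v j (fun h => let: And3 _ h _ := kc _ h in h).
  have h3 := near_true (du A) u (j + 1) (fun h => let: And3 h _ _ := kc _ h in h).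
  lra.
apply: le_trans (le_normcD _ _) _; rewrite mulrDr; apply: lerD.
  apply: le_trans (comm w K2 (j - 1) _ _ _) _; [|lia|lia|].
    by move=> i; apply: hW; case: (cf i).
  rewrite ler_wpM2r ?mulr_ge0 ?normc_ge0 ?exprn_ge0 ?(ltW q0) //.
  by rewrite ler_wpM2r ?subr_ge0 ?invf_ge1 ?(ltW q1) //; lra.
apply: le_trans (comm u K1 (j + 1) _ _ _) _; [|lia|lia|].
  by move=> i; apply: hU; case: (cf i).
rewrite ler_wpM2r ?mulr_ge0 ?normc_ge0 ?exprn_ge0 ?(ltW q0) //.
by rewrite ler_wpM2r ?subr_ge0 ?invf_ge1 ?(ltW q1) //; lra.
Qed.

End Annihilation.

(** * Almost annihilated functionals on l^p *)

Section AlmostAnnihilated.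
Variables (R : realType) (I : choiceType) (lab : I -> int) (unlab : int -> option I).
Hypothesis labP : labelling lab unlab.
Variables (U V W : set R[i]) (u0 v0 w0 : R[i]).
Hypotheses (Uc : compact (U : set R[i]^o)) (Vc : compact (V : set R[i]^o))
  (Wc : compact (W : set R[i]^o)) (Uu : U u0) (Vv : V v0) (Ww : W w0).
Implicit Types (A : I -> I -> R[i]) (z : I -> R[i]).

Local Notation ext := (extend unlab).
Local Notation dom := (domain unlab).

(** The growth of the annihilation bound in the radius M. It may be nonlinear: [infinite_codim]
    relies on Phi M being the same number for all functionals. *)
Definition Phi (p : \bar R) (M : R) : R :=
  match p with r%:E%E => 1 + M `^ r | _ => M end.

(* Splits l^p mass at height d; it replaces Hoelder's inequality. *)
Lemma young_split (r t d : R) : 1 <= r -> 0 <= t -> 0 < d ->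
  t <= d + (d `^ (r - 1))^-1 * t `^ r.
Proof.
move=> r1 t0 d0; have dr : 0 < d `^ (r - 1) by exact: powR_gt0.
have [td|dt] := leP t d.
  by apply: le_trans td _; rewrite lerDl mulr_ge0 ?powR_ge0 // invr_ge0 ltW.
apply: le_trans (_ : t <= (d `^ (r - 1))^-1 * t `^ r) _; last by rewrite lerDr ltW.
rewrite mulrC ler_pdivlMr // -(@mulr_powRB1 _ t r) //; last by lra.
rewrite ler_wpM2l //; apply: ge0_ler_powR; rewrite ?nnegrE //; [lra|exact: ltW|exact: ltW].
Qed.

(** Serves to sum q^N over the sites of a window of length 2N + 3. With q <= t^2, one factor t^N
    absorbs N, since N t^N is at most the sum of the t^i for i < N. *)
Lemma linear_expr_small (q e : R) : 0 < q -> q < 1 -> 0 < e ->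
  exists N : nat, (2 * N%:R + 5) * q ^+ N <= e.
Proof.
move=> q0 q1 e0; pose t := (1 + q) / 2.
have t0 : 0 < t by rewrite /t; lra.
have t1 : t < 1 by rewrite /t; lra.
have qt : q <= t ^+ 2 by rewrite /t expr2; have := sqr_ge0 (1 - q); rewrite expr2; lra.
have c0 : 0 < 2 / (1 - t) + 5 by rewrite addr_gt0 // divr_gt0 //; lra.
have [N hN] := expr_small t0 t1 (divr_gt0 e0 c0); exists N.
have Nt : N%:R * t ^+ N <= (1 - t)^-1.
  apply: (@le_trans _ _ (\sum_(i < N) t ^+ i)).
    rewrite -[N in N%:R]card_ord -sum1_card natr_sum mulr_suml; apply: ler_sum => i _.
    by rewrite mul1r; apply: ler_wiXn2l; rewrite ?(ltW t0) ?(ltW t1) // ltnW.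
  rewrite -[leRHS]mul1r ler_pdivlMr ?subr_gt0 //.
  by have := subrX1 t N; have := exprn_ge0 N (ltW t0); lra.
have qN : q ^+ N <= t ^+ N * t ^+ N.
  by rewrite -expr2 -exprM mulnC exprM; apply: lerXn2r; rewrite ?nnegrE ?exprn_ge0 // ltW.
have tN0 := exprn_ge0 N (ltW t0).
have tN1 : t ^+ N <= 1 by rewrite exprn_ile1 // ltW.
apply: (@le_trans _ _ ((2 / (1 - t) + 5) * t ^+ N)); last by rewrite mulrC -ler_pdivlMr.
have N0 : (0 : R) <= N%:R by rewrite ler0n.
apply: (@le_trans _ _ ((2 * N%:R + 5) * (t ^+ N * t ^+ N))).
  by rewrite ler_wpM2l // addr_ge0 // mulr_ge0.
move: Nt tN0 tN1 N0; move: ((1 - t)^-1) (t ^+ N) (N%:R) => a b c; nra.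
Qed.

Lemma sum_succ (g : int -> R) (H : nat) : (forall j : int, (H <= absz j)%N -> g j = 0) ->
  \sum_(m < (H + H).+1) g (- H%:Z + m%:Z + 1) = \sum_(m < (H + H).+1) g (- H%:Z + m%:Z).
Proof.
move=> g0; rewrite big_ord_recr [RHS]big_ord_recl /= (g0 (- H%:Z + (H + H)%N%:Z + 1)); last by lia.
rewrite (g0 (- H%:Z + 0)) ?addr0 ?add0r; last by lia.
by apply: eq_bigr => m _; congr (g _); rewrite /bump /=; lia.
Qed.

Lemma sum_pred (g : int -> R) (H : nat) : (forall j : int, (H <= absz j)%N -> g j = 0) ->
  \sum_(m < (H + H).+1) g (- H%:Z + m%:Z - 1) = \sum_(m < (H + H).+1) g (- H%:Z + m%:Z).
Proof.
move=> g0; rewrite big_ord_recl [RHS]big_ord_recr /= (g0 (- H%:Z + (H + H)%N%:Z)); last by lia.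
rewrite (g0 (- H%:Z + 0 - 1)) ?addr0 ?add0r; last by lia.
by apply: eq_bigr => m _; congr (g _); rewrite /bump /=; lia.
Qed.

Lemma inv_gap (c q : R) : q = 1 - c -> 0 < c -> c <= 2^-1 -> 0 < q^-1 - 1 <= 2 * c.
Proof.
move=> -> c0 c1; have q0 : 0 < 1 - c by lra.
have e : (1 - c)^-1 * (1 - c) = 1 by rewrite mulVf // gt_eqF.
move: e; move: ((1 - c)^-1) => t e; have t0 : 0 < t by nra.
apply/andP; split; nra.
Qed.

(** The test vector is the unit at the centre k. In the error terms |z| is split by [young_split]
    into a height d and a multiple D of |z|^r, the latter summable to D M^r. With c = 1 - q the
    weights q^|j| sum to at most 2 / c, while the commutator has a factor of at most 2 c; so the
    first part is made small by d and the second by c. *)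
Lemma annihilated_fin (r : R) A : 1 <= r -> tridiagonal lab U V W A ->
  has_windows lab U V W A -> ~ nullfree U V W [set setT] ->
  almost_annihilated lab unlab r%:E%E (mxop A) (Phi r%:E%E).
Proof.
move=> r1 AM HA nnf.
have [K K0 [y [y2 y0 H]]] := weighted_annihilation labP u0 v0 w0 Uc Wc AM HA nnf.
move=> e Kf e0.
have b1 : 0 < 224 * K by lra.
(* The height d precedes c because D depends on d. The first part becomes 56 K d = e / 4, the second
   is at most M^r times e / 2. *)
pose d := e / (224 * K); have d0 : 0 < d by exact: divr_gt0 e0 b1.
have dE : 224 * K * d = e by rewrite /d mulrC; apply: divfK; rewrite gt_eqF.
pose D := (d `^ (r - 1))^-1; have D0 : 0 < D by rewrite invr_gt0 powR_gt0.
pose c := Num.min 2^-1 (e / (56 * K * D)).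
have b2 : 0 < 56 * K * D by apply: mulr_gt0 D0; lra.
have c0 : 0 < c by rewrite lt_min invr_gt0 ltr0n (divr_gt0 e0 b2).
have c1 : c <= 2^-1 by rewrite ge_min lexx.
have c2 : 56 * K * c * D <= e.
  have : c <= e / (56 * K * D) by rewrite ge_min lexx orbT.
  by rewrite (ler_pdivlMr _ _ b2); lra.
pose q := 1 - c; have q0 : 0 < q by rewrite /q; lra.
have q1 : q < 1 by rewrite /q; lra.
have q2 : 2^-1 <= q by rewrite /q; lra.
have /andP[dl0 dl1] := inv_gap (erefl q) c0 c1.
have [N hN] := expr_small q0 q1 (e := 2^-1) ltac:(lra).
(* The deviation from the pattern is made comparable to the commutator term at every site of the
   window. The constant 14 below is 6 for it and 4 for each neighbour, where |y| <= 2 and the weight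
   is at most 2 q^|j|. *)
pose es := K * (q^-1 - 1) * q ^+ N.+1.
have es0 : 0 < es by rewrite !mulr_gt0 // exprn_gt0.
have [k [kd kz]] := H q N Kf es q0 q1 es0.
pose om := weight q N 0; have omE : om = 1 - q ^+ N by rewrite /om /weight /= expr0.
have om2 : 2^-1 <= om by rewrite omE; lra.
have om0 : 0 < om by apply: lt_le_trans om2; rewrite invr_gt0 ltr0n.
exists (k - N.+1%:Z), (N.+1 + N.+1).+1,
  (fun t => (om^-1)%:C * ((weight q N (t - k))%:C * y (t - k))), (fun t => (t == k)%:R).
have jE m : k - N.+1%:Z + m%:Z = k + (- N.+1%:Z + m%:Z) by rewrite addrA.
have jkE m : k - N.+1%:Z + m%:Z - k = - N.+1%:Z + m%:Z by rewrite jE addrAC addrN add0r.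
split.
- move=> m hm; rewrite jE; have hj : (absz (- N.+1%:Z + m%:Z)%R <= N.+1)%N.
    by move: hm; clear; lia.
  by have [] := kd _ hj.
- by move=> t ht; case: eqP => // tk; case: ht; rewrite tk; clear; lia.
- have [kdom _] := kd 0 isT; rewrite addr0 in kdom; split.
    by move=> t nt; case: eqP => // tk; case: nt; rewrite tk.
  have [i ki] := domP labP kdom.
  rewrite (_ : res _ _ = fun j => (j == i)%:R); first exact: lp_delta.
  by apply: funext => j; rewrite /res ki (inj_eq (lab_inj labP)).
- under eq_bigr => m _ do rewrite mulrC.
  rewrite (sum_window _ _ _ (fun t => (om^-1)%:C * ((weight q N (t - k))%:C * y (t - k)))).
  rewrite ifT; last by clear; lia.
  rewrite subrr y0 mulr1 -rmorphM mulVf ?gt_eqF //.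
move=> z M M0 zM.
rewrite (eq_bigr (fun m : 'I_((N.+1 + N.+1).+1) => (om^-1)%:C *
   ((weight q N (- N.+1%:Z + m%:Z))%:C * y (- N.+1%:Z + m%:Z) *
     ext (mxop A z) (k + (- N.+1%:Z + m%:Z))))); last first.
  by move=> m _; rewrite /= jkE jE -[LHS]mulrA.
rewrite -mulr_sumr normcM normc_real ger0_norm ?invr_ge0 ?(ltW om0) //.
rewrite mulrC ler_pdivrMr //.
apply: le_trans (kz z) _.
apply: (@le_trans _ _ (\sum_(m < (N.+1 + N.+1).+1) 14 * (K * (q^-1 - 1)) *
    (q ^+ absz (- N.+1%:Z + m%:Z)%R * d +
     D * normc (ext z (k + (- N.+1%:Z + m%:Z))) `^ r))).
  apply: ler_sum => m _.
  have hm : (absz (- N.+1%:Z + m%:Z)%R <= N.+1)%N by have := ltn_ord m; clear; lia.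
  move: (- N.+1%:Z + m%:Z) hm => j hj.
  have hq (a : nat) : (absz j <= a.+1)%N -> q ^+ a <= 2 * q ^+ absz j.
    move=> ja; have : q ^+ a.+1 <= q ^+ absz j.
      by apply: ler_wiXn2l; rewrite ?(ltW q0) ?(ltW q1).
    rewrite exprS; have := exprn_ge0 a (ltW q0); move: (q ^+ a) (q ^+ _) => x x' *; nra.
  have h1 := hq _ (_ : (absz j <= (absz (j - 1)%R).+1)%N).
  have h2 := hq _ (_ : (absz j <= (absz (j + 1)%R).+1)%N).
  have {}h1 := h1 ltac:(clear; lia); have {}h2 := h2 ltac:(clear; lia).
  have h3 : q ^+ N.+1 <= q ^+ absz j by apply: ler_wiXn2l; rewrite ?(ltW q0) ?(ltW q1).
  have h4 := young_split r1 (normc_ge0 (ext z (k + j))) d0; rewrite -/D in h4.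
  have h5 : 0 <= q ^+ absz j <= 1 by rewrite exprn_ge0 ?exprn_ile1 ?ltW.
  have y1 := y2 (j - 1); have y3 := y2 (j + 1).
  have := normc_ge0 (y (j - 1)); have := normc_ge0 (y (j + 1)).
  have := exprn_ge0 (absz (j - 1)) (ltW q0); have := exprn_ge0 (absz (j + 1)) (ltW q0).
  have KD : 0 <= K * (q^-1 - 1) by rewrite mulr_ge0 // ltW.
  have zr := powR_ge0 (normc (ext z (k + j))) r.
  have zn := normc_ge0 (ext z (k + j)).
  rewrite /es; move: (q ^+ N.+1) (q ^+ absz (j - 1)) (q ^+ absz (j + 1)) (q ^+ absz j)
    (normc (y (j - 1))) (normc (y (j + 1))) (normc (ext z (k + j)) `^ r)
    (normc (ext z (k + j))) h1 h2 h3 h4 h5 y1 y3 zr zn.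
  move: (K * _) KD => KD KD0 qn qa qb qj ya yb zr zn h1 h2 h3 h4 /andP[h5 h6] y1 y3 zr0 zn0.
  move=> qb0 qa0 yb0 ya0.
  have t1 : qa * ya <= 4 * qj by nra.
  have t2 : qb * yb <= 4 * qj by nra.
  have t3 : 6 * (KD * qn) + KD * (qa * ya + qb * yb) <= 14 * KD * qj.
    have : KD * qn <= KD * qj by rewrite ler_wpM2l.
    have : KD * (qa * ya + qb * yb) <= KD * (8 * qj) by rewrite ler_wpM2l //; lra.
    by move=> *; lra.
  apply: le_trans (ler_wpM2r zn0 t3) _.
  rewrite -[leLHS]mulrA; apply: ler_wpM2l; rewrite ?mulr_ge0 //.
  have : qj * zn <= qj * (d + D * zn `^ r) by rewrite ler_wpM2l.
  have : qj * (D * zn `^ r) <= 1 * (D * zn `^ r) by rewrite ler_wpM2r // mulr_ge0 // ltW.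
  by move=> *; lra.
rewrite -mulr_sumr big_split /= -mulr_suml -mulr_sumr.
have S1 : \sum_(m < (N.+1 + N.+1).+1) q ^+ absz (- N.+1%:Z + m%:Z)%R <= 2 / c.
  have -> : c = 1 - q by rewrite /q; ring.
  rewrite -(big_map (fun m : 'I_((N.+1 + N.+1).+1) => - N.+1%:Z + m%:Z) predT
    (fun j => q ^+ absz j)).
  apply: geometric_abs_le => //; rewrite map_inj_uniq ?index_enum_uniq //.
  by move=> m m' /addrI [/val_inj].
have S2 : \sum_(m < (N.+1 + N.+1).+1) normc (ext z (k + (- N.+1%:Z + m%:Z))) `^ r <= M `^ r.
  have /choice[im him] : forall m : 'I_((N.+1 + N.+1).+1),
      exists i, k + (- N.+1%:Z + m%:Z) = lab i.
    move=> m; have hm : (absz (- N.+1%:Z + m%:Z)%R <= N.+1)%N by have := ltn_ord m; clear; lia.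
    by have [/(domP labP)] := kd _ hm.
  rewrite (eq_bigr (fun m => normc (z (im m)) `^ r)) => [|m _]; last first.
    by rewrite him (ext_lab labP).
  rewrite -(big_map im predT (fun i => normc (z i) `^ r)); apply: zM.
  rewrite map_inj_uniq ?index_enum_uniq // => m m' e1.
  have := him m; rewrite e1 -him => /addrI /addrI [/val_inj ->] //.
have Mr := powR_ge0 M r.
have h1 : 14 * (K * (q^-1 - 1)) * (2 / c * d + D * M `^ r) <= e / 2 * (1 + M `^ r).
  apply: (@le_trans _ _ (14 * (K * (2 * c)) * (2 / c * d + D * M `^ r))).
    rewrite ler_wpM2r //.
      apply: addr_ge0; last exact: mulr_ge0 (ltW D0) Mr.
      by apply: mulr_ge0 (ltW d0); apply: divr_ge0 (ltW c0); rewrite ler0n.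
    by rewrite ler_wpM2l ?ler0n // ler_wpM2l // ltW.
  have -> : 14 * (K * (2 * c)) * (2 / c * d + D * M `^ r) =
      (224 * K * d) / 4 + (56 * K * c * D) / 2 * M `^ r by field; rewrite gt_eqF.
  rewrite dE mulrDr mulr1; apply: lerD; first by lra.
  by rewrite ler_wpM2r // ler_wpM2r.
have h2 : 14 * (K * (q^-1 - 1)) * ((\sum_(m < (N.+1 + N.+1).+1)
    q ^+ absz (- N.+1%:Z + m%:Z)%R) * d + D *
    \sum_(m < (N.+1 + N.+1).+1) normc (ext z (k + (- N.+1%:Z + m%:Z))) `^ r) <=
    14 * (K * (q^-1 - 1)) * (2 / c * d + D * M `^ r).
  apply: ler_wpM2l; first by rewrite mulr_ge0 ?ler0n // mulr_ge0 // ltW.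
  by apply: lerD; [rewrite ler_wpM2r // ltW|rewrite ler_wpM2l // ltW].
apply: le_trans h2 (le_trans h1 _).
rewrite [leRHS]mulrAC /=; apply: ler_wpM2r; first by rewrite addr_ge0.
by apply: ler_wpM2l om2; exact: ltW.
Qed.


(** Here the l^1 norm of the error counts, and against a unit test vector the estimate would stay of
    order 1, as weights of sum 2 / c meet a factor c. The test vector therefore follows the phases
    of y over the entire window, and the functional is normalised by T, the weighted l^1 mass of y:
    the error before normalisation is at most a multiple of c T. *)
Lemma annihilated_infty A : tridiagonal lab U V W A ->
  has_windows lab U V W A -> ~ nullfree U V W [set setT] ->
  almost_annihilated lab unlab +oo%E (mxop A) (Phi +oo%E).
Proof.
move=> AM HA nnf.
have [K K0 [y [y2 y0 H]]] := weighted_annihilation labP u0 v0 w0 Uc Wc AM HA nnf.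
move=> e Kf e0.
pose c := Num.min 2^-1 (e / (10 * K)).
have b2 : 0 < 10 * K by lra.
have c0 : 0 < c by rewrite lt_min invr_gt0 ltr0n (divr_gt0 e0 b2).
have c1 : c <= 2^-1 by rewrite ge_min lexx.
have c2 : 10 * K * c <= e.
  have : c <= e / (10 * K) by rewrite ge_min lexx orbT.
  by rewrite (ler_pdivlMr _ _ b2); lra.
pose q := 1 - c; have q0 : 0 < q by rewrite /q; lra.
have q1 : q < 1 by rewrite /q; lra.
have /andP[dl0 dl1] := inv_gap (erefl q) c0 c1.
(* The weights fall short of q^|j| by at most q^N at each of the 2N + 3 sites, so with |y| <= 2 the
   sums of [h] exceed T by at most 1/2 <= T. *)
have [N hN] := linear_expr_small q0 q1 (e := 4^-1) ltac:(lra).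
have NN : (0 : R) <= N%:R by rewrite ler0n.
have qN0 := exprn_ge0 N (ltW q0).
pose n : nat := (N.+1 + N.+1).+1.
have nE : n%:R = 2 * N%:R + 3 :> R.
  by rewrite /n -[(N.+1 + N.+1).+1%:R]natr1 natrD -[N.+1%:R]natr1; ring.
pose es := K * (q^-1 - 1) / (12 * n%:R).
have es0 : 0 < es by rewrite divr_gt0 // mulr_gt0.
have esE : 6 * es * n%:R = K * (q^-1 - 1) / 2.
  by rewrite /es; field; rewrite nE gt_eqF //; lra.
have [k [kd kz]] := H q N Kf es q0 q1 es0.
pose g (j : int) := weight q N j * normc (y j).
have g0 j : 0 <= g j by rewrite mulr_ge0 ?normc_ge0 // weight_ge0.
pose T := \sum_(m < n) g (- N.+1%:Z + m%:Z).
have gz (j : int) : (N.+1 <= absz j)%N -> g j = 0.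
  by move=> jN; rewrite /g /weight leqNgt jN mul0r.
have T2 : 2^-1 <= T.
  have hm : (N.+1 < n)%N by rewrite /n ltnS leq_addr.
  rewrite /T (bigD1 (Ordinal hm)) //= addNr; apply: ler_wpDr; first exact: sumr_ge0.
  by rewrite /g y0 normc1 mulr1 /weight /= expr0; nra.
have T0 : 0 < T by apply: lt_le_trans T2; rewrite invr_gt0 ltr0n.
(* Where y j = 0 the quotient is 0, and y j * sg j = |y j| still holds. *)
pose sg (j : int) : R[i] := if (absz j <= N.+1)%N then (y j)^*%C / (normc (y j))%:C else 0.
have sg1 j : normc (sg j) <= 1.
  rewrite /sg; case: ifP => _; last by rewrite normc0.
  rewrite normcM normcV normc_conjc normc_real ger0_norm ?normc_ge0 //.
  have [->|yj] := eqVneq (normc (y j)) 0; first by rewrite mul0r.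
  by rewrite divff.
have sgE j : (absz j <= N.+1)%N -> y j * sg j = (normc (y j))%:C.
  move=> jN; rewrite /sg jN mulrA mulr_conjc expr2 rmorphM /=.
  have [->|yj] := eqVneq (normc (y j)) 0; first by rewrite mulr0 mul0r.
  by rewrite mulfK //; apply: contraNneq yj => /complexI ->.
exists (k - N.+1%:Z), n,
  (fun t => (T^-1)%:C * ((weight q N (t - k))%:C * y (t - k))), (fun t => sg (t - k)).
have jE m : k - N.+1%:Z + m%:Z = k + (- N.+1%:Z + m%:Z) by rewrite addrA.
have jkE m : k - N.+1%:Z + m%:Z - k = - N.+1%:Z + m%:Z by rewrite jE addrAC addrN add0r.
have hj (m : 'I_n) : (absz (- N.+1%:Z + m%:Z)%R <= N.+1)%N.
  by have := ltn_ord m; rewrite /n; clear; lia.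
split.
- move=> m hm; rewrite jE; have [] := kd _ (hj (Ordinal hm)); done.
- move=> t ht; rewrite /sg ifF //; apply/negP => h; apply: ht; move: h; rewrite /n; clear; lia.
- split; last by move=> i; exact: sg1.
  move=> t nt; rewrite /sg; case: ifP => // ht; case: nt.
  by have [] := kd _ ht; rewrite addrCA addrN addr0.
- rewrite (eq_bigr (fun m : 'I_n => (T^-1 * g (- N.+1%:Z + m%:Z))%:C)).
    by rewrite -rmorph_sum -mulr_sumr /= mulVf ?gt_eqF.
  move=> m _; rewrite jkE -!mulrA (sgE _ (hj m)) /g -!rmorphM //.
move=> z M M0 zM.
rewrite (eq_bigr (fun m : 'I_n => (T^-1)%:C *
   ((weight q N (- N.+1%:Z + m%:Z))%:C * y (- N.+1%:Z + m%:Z) *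
     ext (mxop A z) (k + (- N.+1%:Z + m%:Z))))); last first.
  by move=> m _; rewrite /= jkE jE -[LHS]mulrA.
rewrite -mulr_sumr normcM normc_real ger0_norm ?invr_ge0 ?(ltW T0) //.
rewrite mulrC ler_pdivrMr //.
apply: le_trans (kz z) _.
have KD : 0 <= K * (q^-1 - 1) by rewrite mulr_ge0 // ltW.
pose h (j : int) := q ^+ absz j * normc (y j).
have h0 j : 0 <= h j by rewrite mulr_ge0 ?normc_ge0 ?exprn_ge0 // ltW.
have hg j : h j <= g j + 2 * q ^+ N.
  rewrite /h /g; have := weight_ge N q0 q1 j; have := y2 j; have := normc_ge0 (y j).
  have := weight_ge0 N q0 q1 j.
  move: (weight q N j) (normc (y j)) (q ^+ absz j) (q ^+ N) qN0 => a b d f *; nra.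
have S1 : \sum_(m < n) h (- N.+1%:Z + m%:Z - 1) <= 2 * T.
  apply: (@le_trans _ _ (\sum_(m < n) (g (- N.+1%:Z + m%:Z - 1) + 2 * q ^+ N))).
    by apply: ler_sum => m _.
  rewrite big_split /= (sum_pred gz) sumr_const card_ord -[_ *+ n]mulr_natr nE.
  rewrite -/T; move: hN qN0 T2; nra.
have S2 : \sum_(m < n) h (- N.+1%:Z + m%:Z + 1) <= 2 * T.
  apply: (@le_trans _ _ (\sum_(m < n) (g (- N.+1%:Z + m%:Z + 1) + 2 * q ^+ N))).
    by apply: ler_sum => m _.
  rewrite big_split /= (sum_succ gz) sumr_const card_ord -[_ *+ n]mulr_natr nE.
  rewrite -/T; move: hN qN0 T2; nra.
apply: (@le_trans _ _ (\sum_(m < n) (6 * es + K * (q^-1 - 1) *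
   (h (- N.+1%:Z + m%:Z - 1) + h (- N.+1%:Z + m%:Z + 1))) * M)).
  apply: ler_sum => m _; apply: ler_wpM2l.
    apply: addr_ge0; first by apply: mulr_ge0 (ltW es0); rewrite ler0n.
    by apply: mulr_ge0 KD _; apply: addr_ge0; exact: h0.
  by apply: normc_ext_le.
rewrite -mulr_suml big_split /= sumr_const card_ord -(mulr_natr (6 * es) n) esE.
rewrite -mulr_sumr big_split /=.
rewrite [leRHS]mulrAC /=; apply: ler_wpM2r => //.
apply: (@le_trans _ _ (5 * (K * (q^-1 - 1)) * T)).
  have : K * (q^-1 - 1) * (\sum_(m < n) h (- N.+1%:Z + m%:Z - 1) +
      \sum_(m < n) h (- N.+1%:Z + m%:Z + 1)) <= K * (q^-1 - 1) * (2 * T + 2 * T).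
    by apply: ler_wpM2l => //; exact: lerD.
  have : K * (q^-1 - 1) * 2^-1 <= K * (q^-1 - 1) * T by apply: ler_wpM2l.
  lra.
rewrite ler_wpM2r ?(ltW T0) //; apply: le_trans c2.
have : K * (q^-1 - 1) <= K * (2 * c) by rewrite ler_wpM2l // ltW.
lra.
Qed.

Lemma annihilated p A : (1 <= p)%E -> tridiagonal lab U V W A ->
  has_windows lab U V W A -> ~ nullfree U V W [set setT] ->
  almost_annihilated lab unlab p (mxop A) (Phi p).
Proof.
case: p => [r||] //; first by rewrite lee_fin; exact: annihilated_fin.
by move=> _; exact: annihilated_infty.
Qed.

End AlmostAnnihilated.

(** * Pseudoergodic matrices *)

Section Labels.

Definition unlabZ (k : int) : option int := Some k.
Definition unlabN (k : int) : option nat := if 1 <= k then Some (absz (k - 1)) else None.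

Lemma labellingZ : labelling labZ unlabZ.
Proof. by split=> // k i []. Qed.

Lemma labellingN : labelling labN unlabN.
Proof.
split=> [i|k i]; rewrite /labN /unlabN; first by congr Some; lia.
by case: ifP => // k1 [<-]; lia.
Qed.

Lemma domZ : domain unlabZ = setT.
Proof. exact/seteqP. Qed.

Lemma domN : domain unlabN = [set k | 1 <= k].
Proof.
by apply/seteqP; split=> k; rewrite /domain /unlabN /=; case: ifP.
Qed.

End Labels.

Section FiniteMatrices.
Variables (R : realType) (p : \bar R).
Hypothesis p1 : (1 <= p)%E.

Lemma entry_le_opnorm (I : choiceType) (E : I -> I -> R[i]) (e : R) i j : 0 <= e ->
  (opnorm p (mxop E) <= e%:E)%E -> normc (E i j) <= e.
Proof.
move=> e0 h; pose x (k : I) : R[i] := (k == j)%:R.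
have x1 : (lpnorm p x <= 1%:E)%E by apply/lpnorm_le => //; exact: lp_delta.
have Ex : lple p (mxop E x) e.
  apply/lpnorm_le => //; apply: le_trans h; apply: ereal_sup_ubound.
  by exists x.
have := lple_bdd p1 e0 Ex i; rewrite /mxop.
rewrite -(@fsbig_widen _ _ _ _ [set j]) // => [|k [_ /= kj]].
  by rewrite fsbig_set1 /x eqxx mulr1.
by rewrite /x; case: eqP => // _; rewrite mulr0.
Qed.

Lemma mxop_ord n (E : 'I_n -> 'I_n -> R[i]) x i : mxop E x i = \sum_(j < n) E i j * x j.
Proof.
rewrite /mxop (_ : setT = [set` index_enum 'I_n]); last first.
  by apply/seteqP; split=> j _ //=; exact: mem_index_enum.
by rewrite -fsbig_seq // index_enum_uniq.
Qed.

Lemma opnorm_entries n (E : 'I_n -> 'I_n -> R[i]) (e : R) : (0 < n)%N -> 0 <= e ->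
  (forall i j, normc (E i j) <= e) -> (opnorm p (mxop E) <= (n%:R * (n%:R * e))%:E)%E.
Proof.
move=> n0 e0 hE; have nR : (1 : R) <= n%:R by rewrite ler1n.
have ne0 : 0 <= n%:R * e by rewrite mulr_ge0.
apply: opnorm_le => // [|x x1]; first by rewrite mulr_ge0.
have xb := lple_bdd p1 ler01 x1.
have Eb i : normc (mxop E x i) <= n%:R * e.
  rewrite mxop_ord; apply: le_trans (le_normc_sum _ _ _) _.
  rewrite mulr_natl -[n in _ *+ n]card_ord -sumr_const; apply: ler_sum => j _.
  by rewrite normcM -[e]mulr1; apply: ler_pM; rewrite ?normc_ge0.
rewrite /lple; case: p p1 => [r||] // => [|_ i]; last first.
  by apply: le_trans (Eb i) _; rewrite ler_peMl.
rewrite lee_fin => r1 s us; have r0 : 0 <= r by lra.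
apply: (@le_trans _ _ (\sum_(i <- s) (n%:R * e) `^ r)).
  by apply: ler_sum => i _; apply: ge0_ler_powR; rewrite ?nnegrE ?normc_ge0.
rewrite big_const_seq count_predT iter_addr_0 -(mulr_natl _ (size s)) [leRHS]powRM ?ler0n //.
rewrite ler_wpM2r ?powR_ge0 //; apply: (@le_trans _ _ n%:R); last exact: le1r_powR.
rewrite ler_nat -[leqRHS]card_ord -(card_uniqP us); exact: max_card.
Qed.

End FiniteMatrices.

Section Pseudoergodic.
Variables (R : realType) (p : \bar R).
Hypothesis p1 : (1 <= p)%E.
Variables (U V W : set R[i]).
Hypotheses (U0 : U !=set0) (V0 : V !=set0) (W0 : W !=set0).

Lemma PsiE_windows A : PsiE p U V W A -> has_windows labZ U V W A.
Proof.
move=> [_ h] n B e n0 BM e0; have [k hk] := h n B e n0 BM e0.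
exists k => i j; exists (k + labI i), (k + labI j); split=> //.
exact: (@entry_le_opnorm _ _ p1 _ _ _ i j (ltW e0) (ltW hk)).
Qed.

Lemma PsiEplus_windows A : PsiEplus p U V W A -> has_windows labN U V W A.
Proof.
move=> [_ h] n B e n0 BM e0; have [k hk] := h n B e n0 BM e0.
exists k%:Z => i j; exists (k + i)%N, (k + j)%N; rewrite /labN /labI; split; [lia|lia|].
exact: (@entry_le_opnorm _ _ p1 _ _ _ i j (ltW e0) (ltW hk)).
Qed.

(** An index (a, b, n) names a point of X within 1 / (n + 1) of the rational point a + ib if there
    is one, and x0 otherwise. The index set is countable, so finite words of indices have codes. *)
Lemma dense_family (X : set R[i]) : X !=set0 -> exists d : rat * rat * nat -> R[i],
  (forall l, X (d l)) /\ forall z e, X z -> 0 < e -> exists l, normc (z - d l) <= e.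
Proof.
move=> [x0 Xx0]; pose c (l : rat * rat * nat) : R[i] := (ratr l.1.1 +i* ratr l.1.2)%C.
have H l : exists z, X z /\ ((exists y, X y /\ normc (c l - y) <= l.2.+1%:R^-1) ->
    normc (c l - z) <= l.2.+1%:R^-1).
  have [[y [Xy hy]]|h] := pselect (exists y, X y /\ normc (c l - y) <= l.2.+1%:R^-1).
    by exists y.
  by exists x0.
have [d hd] := choice H; exists d; split=> [l|z e Xz e0]; first by case: (hd l).
pose n := Num.truncn (2 / e); have n0 : (0 : R) < n.+1%:R by rewrite ltr0n.
have ne : 2 * n.+1%:R^-1 <= e.
  rewrite ler_pdivrMr // mulrC -ler_pdivrMr //; apply: ltW; exact: truncnS_gt.
have near_rat (a : R) : exists s : rat, `|ratr s - a| <= n.+1%:R^-1 / 2.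
  have ha : a < a + n.+1%:R^-1 / 2 by rewrite ltrDl.
  have [s] := rat_in_itvoo ha; rewrite in_itv /= => /andP[h1 h2].
  exists s; rewrite ger0_norm ?subr_ge0 ?(ltW h1) //.
  by rewrite lerBlDl ltW.
have [s1 h1] := near_rat (complex.Re z); have [s2 h2] := near_rat (complex.Im z).
have hz : normc (c (s1, s2, n) - z) <= n.+1%:R^-1.
  apply: le_trans (normc_le_Re_Im _) _; rewrite (splitr n.+1%:R^-1).
  by move: h1 h2; rewrite /c; clear; case: z => a b; exact: lerD.
exists (s1, s2, n); have [_ hl] := hd (s1, s2, n).
have {}hl : normc (c (s1, s2, n) - d (s1, s2, n)) <= n.+1%:R^-1.
  exact: hl (ex_intro _ z (conj Xz hz)).
have -> : z - d (s1, s2, n) = (c (s1, s2, n) - d (s1, s2, n)) - (c (s1, s2, n) - z) by ring.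
apply: le_trans (le_normcB _ _) (le_trans (lerD hl hz) _).
by apply: le_trans ne; rewrite mulr_natl mulr2n.
Qed.

Local Notation letter := ((rat * rat * nat) * (rat * rat * nat) * (rat * rat * nat))%type.

(* The block [2^t, 2^(t+1)) of positions spells the word with code t. *)
Definition spell (i : int) : letter :=
  let m := absz i in let t := trunc_log 2 m in
  nth ((0, 0, 0%N), (0, 0, 0%N), (0, 0, 0%N)) (odflt [::] (unpickle t : option (seq letter)))
    (m - 2 ^ t)%N.

(** Block t has 2^t places, so a code t at least as large as the length of w suffices. Padding w
    gives infinitely many distinct codes, and one of them is large enough. *)
Lemma spell_word (w : seq letter) : exists t, forall m x0, (m < size w)%N ->
  spell (2 ^ t + m)%N%:Z = nth x0 w m.
Proof.
pose x : letter := ((0, 0, 0%N), (0, 0, 0%N), (0, 0, 0%N)).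
pose f (n : nat) := pickle (w ++ nseq n x).
have finj : injective f.
  move=> a b /(pcan_inj (@pickleK _)) /(congr1 size).
  by rewrite !size_cat !size_nseq => /addnI.
have [n hn] : exists n, (size w <= f n)%N.
  apply: contrapT => h; have := @uniq_leq_size _ (map f (iota 0 (size w).+1)) (iota 0 (size w)).
  rewrite map_inj_uniq // iota_uniq size_map !size_iota ltnn => /(_ isT) => h2.
  suff : false by []; apply: h2 => _ /mapP[a _ ->]; rewrite mem_iota /= add0n ltnNge.
  by apply/negP => ha; apply: h; exists a.
exists (f n) => m x0 mw; rewrite /spell; cbv zeta; rewrite absz_nat.
have -> : trunc_log 2 (2 ^ f n + m) = f n.
  apply: trunc_log_eq => //; rewrite leq_addr expnS mul2n -addnn ltn_add2l.
  by apply: leq_trans (ltn_expl _ _) => //; rewrite ltnS ltnW // (leq_trans mw).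
rewrite addKn /f pickleK /= nth_cat mw; exact: set_nth_default.
Qed.

(** One letter names the three coefficients of a row, so a finite matrix is approximated row by row
    by a word; the entries missing in the first and last row get an arbitrary letter. *)
Lemma pseudoergodic_triple : exists u v w : int -> R[i], coefs U V W u v w /\
  forall (n : nat) (B : 'I_n -> 'I_n -> R[i]) (e : R), Mfin U V W B -> 0 < e ->
  exists t, forall i j : 'I_n,
    normc (B i j - entry u v w (2 ^ t + i)%N%:Z (2 ^ t + j)%N%:Z) <= e.
Proof.
have [dU [hU aU]] := dense_family U0; have [dV [hV aV]] := dense_family V0.
have [dW [hW aW]] := dense_family W0.
exists (fun i => dU (spell i).1.1), (fun i => dV (spell i).1.2), (fun i => dW (spell i).2).
split=> [i|n B e BM e0]; first by split.
have H (i : 'I_n) : exists l : letter, forall j : 'I_n,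
    [/\ labI j = labI i - 1 -> normc (B i j - dU l.1.1) <= e,
        labI j = labI i -> normc (B i j - dV l.1.2) <= e &
        labI j = labI i + 1 -> normc (B i j - dW l.2) <= e].
  have labI_inj : injective (@labI n) by move=> a b [/val_inj].
  have [l1 h1] : exists l, forall j, labI j = labI i - 1 -> normc (B i j - dU l) <= e.
    have [[j hj]|h] := pselect (exists j : 'I_n, labI j = labI i - 1); last first.
      by exists (0, 0, 0%N) => j hj; case: h; exists j.
    have [BU _ _ _] := BM i j; have [l hl] := aU _ _ (BU hj) e0.
    by exists l => j'; rewrite -hj => /labI_inj ->.
  have [l2 h2] : exists l, normc (B i i - dV l) <= e.
    by have [_ BV _ _] := BM i i; exact: aV (BV erefl) e0.
  have [l3 h3] : exists l, forall j, labI j = labI i + 1 -> normc (B i j - dW l) <= e.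
    have [[j hj]|h] := pselect (exists j : 'I_n, labI j = labI i + 1); last first.
      by exists (0, 0, 0%N) => j hj; case: h; exists j.
    have [_ _ BW _] := BM i j; have [l hl] := aW _ _ (BW hj) e0.
    by exists l => j'; rewrite -hj => /labI_inj ->.
  by exists (l1, l2, l3) => j; split=> [/h1|/labI_inj ->|/h3].
have [l hl] := choice H.
have [t ht] := spell_word [seq l i | i <- enum 'I_n].
exists t => i j.
have si : spell (2 ^ t + i)%N%:Z = l i.
  have iw : (i < size [seq l i | i <- enum 'I_n])%N by rewrite size_map size_enum_ord.
  by rewrite (ht i (l i) iw) (nth_map i) ?nth_ord_enum // size_enum_ord.
rewrite /entry si; have [b1 b2 b3] := hl i j; have [_ _ _ b4] := BM i j.
rewrite /labI in b1 b2 b3 b4.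
have [e1|e1] := eqVneq (j : nat) i.
  have -> : ((2 ^ t + j)%N%:Z == (2 ^ t + i)%N%:Z - 1) = false by lia.
  have -> : ((2 ^ t + j)%N%:Z == (2 ^ t + i)%N%:Z) = true by lia.
  have -> : ((2 ^ t + j)%N%:Z == (2 ^ t + i)%N%:Z + 1) = false by lia.
  by rewrite mulr1n !mulr0n mul1r !mul0r addr0 add0r; apply: b2; lia.
have [e2|e2] := eqVneq (j.+1 : nat) i.
  have -> : ((2 ^ t + j)%N%:Z == (2 ^ t + i)%N%:Z - 1) = true by lia.
  have -> : ((2 ^ t + j)%N%:Z == (2 ^ t + i)%N%:Z) = false by lia.
  have -> : ((2 ^ t + j)%N%:Z == (2 ^ t + i)%N%:Z + 1) = false by lia.
  by rewrite mulr1n !mulr0n mul1r !mul0r !addr0; apply: b1; lia.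
have [e3|e3] := eqVneq (j : nat) i.+1.
  have -> : ((2 ^ t + j)%N%:Z == (2 ^ t + i)%N%:Z - 1) = false by lia.
  have -> : ((2 ^ t + j)%N%:Z == (2 ^ t + i)%N%:Z) = false by lia.
  have -> : ((2 ^ t + j)%N%:Z == (2 ^ t + i)%N%:Z + 1) = true by lia.
  by rewrite mulr1n !mulr0n mul1r !mul0r !add0r; apply: b3; lia.
have -> : ((2 ^ t + j)%N%:Z == (2 ^ t + i)%N%:Z - 1) = false by lia.
have -> : ((2 ^ t + j)%N%:Z == (2 ^ t + i)%N%:Z) = false by lia.
have -> : ((2 ^ t + j)%N%:Z == (2 ^ t + i)%N%:Z + 1) = false by lia.
by rewrite !mulr0n !mul0r !addr0 subr0 b4 ?normc0 ?(ltW e0) //; lia.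
Qed.

Lemma small_opnorm n (E : 'I_n -> 'I_n -> R[i]) (e : R) : (0 < n)%N -> 0 < e ->
  (forall i j, normc (E i j) <= e / 2 / (n%:R * n%:R)) -> (opnorm p (mxop E) < e%:E)%E.
Proof.
move=> n0 e0 h; have nR : (0 : R) < n%:R by rewrite ltr0n.
have h0 : 0 <= e / 2 / (n%:R * n%:R) by rewrite !divr_ge0 ?mulr_ge0 // ltW.
apply: le_lt_trans (opnorm_entries p1 n0 h0 h) _; rewrite lte_fin.
have -> : n%:R * (n%:R * (e / 2 / (n%:R * n%:R))) = e / 2 by field; rewrite gt_eqF.
lra.
Qed.

(** Needed wherever a statement on one pseudoergodic operator is derived from one on all
    operators. *)
Lemma PsiE_nonempty : exists A, PsiE p U V W A.
Proof.
have [u [v [w [cf h]]]] := pseudoergodic_triple.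
exists (mat labZ u v w); split; first exact: mat_tridiagonal.
move=> n B e n0 BM e0; have nR : (0 : R) < n%:R by rewrite ltr0n.
have e20 : 0 < e / 2 / (n%:R * n%:R) by rewrite !divr_gt0 ?mulr_gt0.
(* The labels of a finite matrix start at 1, the block at 2^t. *)
have [t ht] := h n B _ BM e20; exists ((2 ^ t)%N%:Z - 1).
apply: small_opnorm => // i j; have := ht i j; rewrite /mat /labZ /labI.
have -> : (2 ^ t)%N%:Z - 1 + i.+1%:Z = (2 ^ t + i)%N%:Z :> int by lia.
by have -> : (2 ^ t)%N%:Z - 1 + j.+1%:Z = (2 ^ t + j)%N%:Z :> int by lia.
Qed.

Lemma PsiEplus_nonempty : exists A, PsiEplus p U V W A.
Proof.
have [u [v [w [cf h]]]] := pseudoergodic_triple.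
exists (mat labN u v w); split; first exact: mat_tridiagonal.
move=> n B e n0 BM e0; have nR : (0 : R) < n%:R by rewrite ltr0n.
have e20 : 0 < e / 2 / (n%:R * n%:R) by rewrite !divr_gt0 ?mulr_gt0.
have [t ht] := h n B _ BM e20; exists (2 ^ t).-1.
apply: small_opnorm => // i j; have := ht i j; rewrite /mat /labN.
have -> : ((2 ^ t).-1 + i).+1 = (2 ^ t + i)%N by lia.
by have -> : ((2 ^ t).-1 + j).+1 = (2 ^ t + j)%N by lia.
Qed.

End Pseudoergodic.

(** * Fredholm index and the three cases *)

Section FredholmIndex.
Variables (R : realType) (I : choiceType) (p : \bar R).
Hypothesis p1 : (1 <= p)%E.
Implicit Types (T : (I -> R[i]) -> (I -> R[i])) (X Y : set (I -> R[i])).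

Lemma quotient_dim0 X Y : X `<=` Y -> quotient_dim X Y 0.
Proof.
move=> XY; exists (fun=> 0); split=> [[]//|x Xx]; exists (fun=> 0); split.
  by rewrite big_ord0 subr0; exact: XY.
by move=> c _; apply: funext => -[].
Qed.

Lemma quotient_dim0_sub X Y : quotient_dim X Y 0 -> X `<=` Y.
Proof. by move=> [e [_ h]] x /h[c [+ _]]; rewrite big_ord0 subr0. Qed.

(** With n > 0 the zero vector would have two coefficient families, 0 and that of e 0. *)
Lemma quotient_dim_trivial X Y n : X 0 -> Y 0 -> (forall x, X x -> Y (- x)) ->
  quotient_dim X Y n -> n = 0%N.
Proof.
case: n => // n X0 Y0 XY [e [eX h]]; have [c [_ cu]] := h 0 X0.
have e1 : c = (fun=> 0).
  by apply: cu; rewrite big1 ?subr0 // => k _; rewrite scale0r.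
have e2 : c = (fun k => (k == ord0)%:R).
  apply: cu; rewrite big_ord_recl /= scale1r big1 => [|k _]; last by rewrite scale0r.
  by rewrite addr0 sub0r; exact: XY.
have := congr1 (fun f => f ord0) (etrans (esym e2) e1) => /= /eqP.
by rewrite oner_eq0.
Qed.

Lemma lp0 : lp p (0 : I -> R[i]).
Proof.
apply/lpP => //; exists 0 => //; rewrite /lple; case: p p1 => [r||] // => [|_ i].
  rewrite lee_fin => r1 s us; rewrite big1 ?powR_ge0 // => i _.
  by rewrite normc0 powR0 //; lra.
by rewrite normc0.
Qed.

Lemma bounded_operator0 T : bounded_operator p T -> T 0 = 0.
Proof.
case=> _ lin _; have := lin (-1) 0 0 lp0 lp0.
by rewrite scaler0 addr0 scaleN1r addNr.
Qed.

Lemma lpN x : lp p x -> lp p (- x : I -> R[i]).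
Proof. by move=> xl; rewrite -[- x]addr0 -scaleN1r; apply: lpD lp0. Qed.

Lemma invertible_fredholm T k : invertible p T -> fredholm_of_index p T k <-> k = 0.
Proof.
move=> [Tb [S [Sb hS]]]; have T0 := bounded_operator0 Tb.
have inj x : null_space p T x -> x = 0.
  move=> [xl Tx]; have [_ <-] := hS x xl; have [_ S0] := hS 0 lp0.
  by rewrite Tx -{1}T0.
have surj x : lp p x -> (T @` lp p) x.
  move=> xl; exists (S x); first by case: Sb => + _ _; exact.
  by have [] := hS x xl.
split=> [[_ [a [b [ha hb ->]]]]|->].
  have -> : a = 0%N.
    apply: quotient_dim_trivial ha => //; first by split; [exact: lp0|].
    by move=> x /inj ->; rewrite oppr0.
  have -> // : b = 0%N.
  apply: quotient_dim_trivial hb; [exact: lp0|by exists 0 => //; exact: lp0|].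
  by move=> x /lpN; exact: surj.
split=> //; exists 0%N, 0%N; split=> //; apply: quotient_dim0; last exact: surj.
by move=> x /inj ->.
Qed.

Lemma not_fredholm0_surj T x : bounded_operator p T -> (forall b, lp p b -> (T @` lp p) b) ->
  lp p x -> T x = 0 -> x <> 0 -> ~ fredholm_of_index p T 0.
Proof.
move=> Tb surj xl Tx x0 [_ [a [b [ha hb]]]].
have -> : b = 0%N.
  apply: quotient_dim_trivial hb; [exact: lp0| |by move=> y /lpN; exact: surj].
  by exists 0; [exact: lp0|exact: bounded_operator0].
move=> e; have a0 : a = 0%N by lia.
by move: ha; rewrite a0 => /quotient_dim0_sub/(_ x) h; apply: x0; exact: h (conj xl Tx).
Qed.

Lemma not_fredholm0_inj T y : bounded_operator p T ->
  (forall x, lp p x -> T x = 0 -> x = 0) -> lp p y -> ~ (T @` lp p) y ->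
  ~ fredholm_of_index p T 0.
Proof.
move=> Tb inj yl ny [_ [a [b [ha hb]]]].
have -> : a = 0%N.
  apply: quotient_dim_trivial ha => //.
    by split; [exact: lp0|exact: bounded_operator0].
  by move=> x [xl Tx]; rewrite /= (inj x) // oppr0.
move=> e; have b0 : b = 0%N by lia.
by move: hb; rewrite b0 => /quotient_dim0_sub/(_ y yl).
Qed.

End FredholmIndex.

(** * Instability of the finite sections in the cases of index 1 and -1 *)

Section Stability.
Variable R : realType.
Implicit Types (u v w x z : int -> R[i]) (U V W : set R[i]).

(** A consequence of the full FSM in which no p occurs and which is invariant under reflection, so
    that index -1 reduces to index 1. The vector x decays exponentially, hence lies in every l^p. *)
Definition stable_sections u v w := forall (q : R) x, 0 < q -> q < 1 ->
  (forall j, normc (x j) <= q ^+ absz j) ->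
  exists c (N : nat), forall n : nat, (N <= n)%N ->
    (exists y, [/\ supp [set k : int | (absz k <= n)%N] y, bdd y c &
       forall k : int, (absz k <= n)%N -> jac u v w y k = jac u v w x k]) /\
    (forall d, supp [set k : int | (absz k <= n)%N] d ->
       (forall k : int, (absz k <= n)%N -> jac u v w d k = 0) -> forall k, d k = 0).

Lemma stable_sections_opp u v w : stable_sections u v w ->
  stable_sections (fun i => w (- i)) (fun i => v (- i)) (fun i => u (- i)).
Proof.
move=> H q x q0 q1 xq; have [|c [N h]] := H q (fun i => x (- i)) q0 q1.
  by move=> j; have := xq (- j); rewrite abszN.
exists c, N => n Nn; have [[y [yD yc hy]] hu] := h n Nn; split.
  exists (fun i => y (- i)); split=> [k /= nk|k|k hk].
  - by apply: yD; rewrite /= abszN.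
  - exact: yc.
  - have E : (fun i => x (- - i)) = x by apply: funext => i; rewrite opprK.
    have := @jac_opp _ u v w (fun i => x (- i)) k; rewrite E => ->.
    by rewrite jac_opp hy // abszN.
move=> d dD hd k; rewrite -(opprK k); apply: (hu (fun i => d (- i))) => [i /= ni|i hi].
  by apply: dD; rewrite /= abszN.
have E : (fun i => d (- - i)) = d by apply: funext => j; rewrite opprK.
have := @jac_opp _ u v w (fun i => d (- i)) (- i); rewrite opprK E => <-.
by apply: hd; rewrite abszN.
Qed.

(** Let z be the kernel vector starting at -n, and x j = q^j on the right. Cutting off at n changes
    the images of both only in row n of the section, so z(n+1) (y - x) + x(n+1) z, restricted to the
    window, is null for the section and vanishes. At the site -n, where x = 0 and |z| >= 1 / K, this
    reads |y(-n)| |z(n+1)| >= q^(n+1) / K. As |z(n+1)| <= C q^(2n+2), y is unbounded in n. *)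
Lemma unstable_plus U V W u v w : compact (U : set R[i]^o) -> compact (V : set R[i]^o) ->
  compact (W : set R[i]^o) -> nullfree U V W [set setT] -> nullfree U V W downc ->
  ~ nullfree U V W upc -> coefs U V W u v w -> ~ stable_sections u v w.
Proof.
move=> Uc Vc Wc nf ndown nup cf H.
have [K K0 hK] := compact_normc_bounded Wc.
have [C [q [C0 q0 q1 hz]]] := kernel_right Uc Vc Wc nf ndown nup.
pose x (j : int) : R[i] := if 0 <= j then (q ^+ absz j)%:C else 0.
have xq j : normc (x j) <= q ^+ absz j.
  rewrite /x; case: ifP => _; last by rewrite normc0 exprn_ge0 // ltW.
  by rewrite normc_real ger0_norm // exprn_ge0 // ltW.
have [c [N h]] := H q x q0 q1 xq.
pose c' := `|c| + 1; have c'0 : 0 < c' by rewrite /c' ltr_pwDr.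
have cc : c <= c' by rewrite /c'; have := ler_norm c; lra.
have e0 : 0 < (2 * (C * c' * K))^-1 by rewrite invr_gt0 !mulr_gt0.
have [m hm] := expr_small q0 q1 e0.
have [n nE] : exists n, n = (N + m).+1 by exists (N + m).+1.
have [|[y [yD yc hy]] hu] := h n; first by rewrite nE; clear; lia.
(* The choice j = -n - 1 lets z start at the left end -n of the section with row -n already null;
   the normalisation w j * z (j + 1) = 1 keeps z (-n) away from 0. *)
have [z [z0 zC zn w1]] := hz u v w (- n.+1%:Z) cf.
have znn : - n.+1%:Z + 1 = - n%:Z :> int by clear; lia.
rewrite znn in w1.
pose win (k : int) : bool := (absz k <= n)%N.
pose x' k := if win k then x k else 0; pose z' k := if win k then z k else 0.
have xx' k : win k -> jac u v w x' k = jac u v w x k - (k == n%:Z)%:R * (w n%:Z * x (n%:Z + 1)).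
  move=> hk; rewrite /jac /x' hk; have -> : (if win (k - 1) then x (k - 1) else 0) = x (k - 1).
    case: ifPn => // nk; rewrite /x ifF //.
    by move: hk nk; rewrite /win; clear; lia.
  case: (k =P n%:Z) => [->|kn].
    have -> : win (n%:Z + 1) = false by rewrite /win; clear; lia.
    by rewrite mulr1n mul1r mulr0 addr0 addrK.
  have -> : win (k + 1) by move: hk kn; rewrite /win; clear; lia.
  by rewrite mulr0n mul0r subr0.
have zz' k : win k -> jac u v w z' k = - ((k == n%:Z)%:R * (w n%:Z * z (n%:Z + 1))).
  move=> hk; have nk : - n.+1%:Z < k by move: hk; rewrite /win; clear; lia.
  have := zn k nk; rewrite /jac /z' hk.
  have -> : (if win (k - 1) then z (k - 1) else 0) = z (k - 1).
    case: ifPn => // nk1; rewrite z0 //.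
    by move: hk nk1; rewrite /win; clear; lia.
  case: (k =P n%:Z) => [->|kn].
    have -> : win (n%:Z + 1) = false by rewrite /win; clear; lia.
    by rewrite mulr1n mul1r mulr0 addr0 => /eqP; rewrite addr_eq0 => /eqP.
  have -> : win (k + 1) by move: hk kn; rewrite /win; clear; lia.
  by rewrite mulr0n mul0r oppr0.
pose d k := z (n%:Z + 1) * (y k - x' k) + x (n%:Z + 1) * z' k.
have d0 : forall k, d k = 0.
  apply: hu => [k /= nk|k hk].
    have nk' : win k = false by apply/negP.
    by rewrite /d yD //= /x' /z' nk' subrr !mulr0 addr0.
  transitivity (z (n%:Z + 1) * (jac u v w y k - jac u v w x' k) +
      x (n%:Z + 1) * jac u v w z' k); first by rewrite /jac /d; ring.
  by rewrite hy // xx' // zz' //; ring.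
have wn : win (- n%:Z) by rewrite /win; clear; lia.
have xn0 : x (- n%:Z) = 0 by rewrite /x ifF // nE; clear; lia.
have := d0 (- n%:Z); rewrite /d /x' /z' wn xn0 subr0 => /eqP.
rewrite addr_eq0 => /eqP /(congr1 (@normc R)); rewrite normcN !normcM => e.
have xe : normc (x (n%:Z + 1)) = q ^+ n.+1.
  have -> : x (n%:Z + 1) = (q ^+ absz (n%:Z + 1))%:C by [].
  rewrite normc_real ger0_norm; last by rewrite exprn_ge0 // ltW.
  by congr (q ^+ _); clear; lia.
rewrite xe in e.
have h1 : normc (z (n%:Z + 1)) <= C * (q ^+ n.+1 * q ^+ n.+1).
  apply: le_trans (zC _) _; rewrite ler_wpM2l ?(ltW C0) // -exprD.
  by apply: ler_wiXn2l; rewrite ?(ltW q0) ?(ltW q1) //; clear; lia.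
have h2 : 1 <= K * normc (z (- n%:Z)).
  rewrite -(@normc1 R) -w1 normcM ler_wpM2r ?normc_ge0 //.
  by apply: hK; case: (cf (- n.+1%:Z)).
have h3 : normc (y (- n%:Z)) <= c' := le_trans (yc _) cc.
have qn : 0 < q ^+ n.+1 by exact: exprn_gt0.
have h4 : q ^+ n.+1 <= C * (q ^+ n.+1 * q ^+ n.+1) * c' * K.
  apply: (@le_trans _ _ (q ^+ n.+1 * (K * normc (z (- n%:Z))))).
    by rewrite ler_peMr // ltW.
  rewrite mulrCA mulrC -e; apply: ler_wpM2r; first exact: ltW.
  by apply: ler_pM; rewrite ?normc_ge0.
have h5 : 1 <= C * c' * K * q ^+ n.+1.
  rewrite -(ler_pM2l qn) mulr1; apply: le_trans h4 _.
  by rewrite le_eqVlt; apply/orP; left; apply/eqP; ring.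
have h6 : q ^+ n.+1 <= q ^+ m by apply: ler_wiXn2l; rewrite ?(ltW q0) ?(ltW q1) // nE; clear; lia.
have h7 : C * c' * K * q ^+ n.+1 <= 2^-1.
  apply: (@le_trans _ _ (C * c' * K * (2 * (C * c' * K))^-1)).
    by rewrite ler_wpM2l ?(le_trans h6) // !mulr_ge0 // ltW.
  by rewrite invfM mulrCA divff ?mulr1 // gt_eqF // !mulr_gt0.
have : (1 : R) <= 2^-1 := le_trans h5 h7.
by rewrite leNgt invf_lt1 // ltr1n.
Qed.

Lemma unstable_minus U V W u v w : compact (U : set R[i]^o) -> compact (V : set R[i]^o) ->
  compact (W : set R[i]^o) -> nullfree U V W [set setT] -> nullfree U V W upc ->
  ~ nullfree U V W downc -> coefs U V W u v w -> ~ stable_sections u v w.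
Proof.
move=> Uc Vc Wc nf nup ndown cf /stable_sections_opp.
apply: (unstable_plus Wc Vc Uc (nullfreeT_opp nf) _ _ (coefs_opp cf)).
- by apply/nullfree_upc_opp.
- by rewrite nullfree_upc_opp.
Qed.

End Stability.

(** * The three cases and the operators of the theorem *)

Section Trichotomy.
Variables (R : realType) (p : \bar R) (U V W : set R[i]).
Hypotheses (p1 : (1 <= p)%E) (U0 : U !=set0) (V0 : V !=set0) (W0 : W !=set0).
Hypotheses (Uc : compact (U : set R[i]^o)) (Vc : compact (V : set R[i]^o))
  (Wc : compact (W : set R[i]^o)).

Lemma convc_domZ : convc (domain unlabZ).
Proof. by rewrite domZ. Qed.

Lemma convc_domN : convc (domain unlabN).
Proof. by rewrite domN => i j k /= i1 _ /andP[ij _]; apply: le_trans ij. Qed.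

Lemma upc_domN : upc (domain unlabN).
Proof. by rewrite domN => i j /= i1 ij; apply: le_trans ij. Qed.

Lemma nullfreeT_upc : nullfree U V W upc -> nullfree U V W [set setT].
Proof. by apply: nullfree_sub => D -> i j. Qed.

Section Stable.
Hypotheses (nup : nullfree U V W upc) (ndown : nullfree U V W downc).

(** The constants are common to all matrices and all intervals, which is the source of the uniform
    bounds for inverses and finite sections. *)
Lemma convex_bounds : exists C q C' q' : R, [/\ 0 < C, 0 < q & q < 1] /\
  [/\ 0 < C', 0 < q' & q' < 1] /\ forall u v w D, coefs U V W u v w -> convc D ->
    inj_bound u v w D C q /\ dual_bound u v w D D C' q'.
Proof.
have nconv := nullfree_convc nup ndown.
have nconv' : nullfree W V U convc.
  by apply: nullfree_sub (nullfree_opp nconv); exact: oppc_convc.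
have [C [q [C0 q0 q1 h]]] := exp_bound Uc Vc Wc admissible_convc nconv.
have [C' [q' [C'0 q'0 q'1 h']]] := dual_boundW Uc Vc Wc admissible_convc nconv'.
exists C, q, C', q'; split=> //; split=> // u v w D cf Dc; split; last exact: h'.
by move=> x M s i xM xD s0; exact: h cf Dc xM xD s0.
Qed.

Lemma stable_invertible (I : choiceType) (lab : I -> int) unlab A :
  labelling lab unlab -> convc (domain unlab) -> tridiagonal lab U V W A ->
  invertible p (mxop A).
Proof.
move=> labP dc AM; have [u0 Uu] := U0; have [v0 Vv] := V0; have [w0 Ww] := W0.
have [C [q [C' [q' [[C0 q0 q1] [[C'0 q'0 q'1] h]]]]]] := convex_bounds.
have cf := coefs_diag labP Uu Vv Ww AM; have [hI hD] := h _ _ _ _ cf dc.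
exact: (invertible_mxop labP p1 Uc Vc Wc Uu Vv Ww AM C'0 q'0 q'1 hI hD).
Qed.

Lemma stable_inverse_bound (I : choiceType) (lab : I -> int) unlab :
  labelling lab unlab -> convc (domain unlab) -> exists c : R, forall A S,
  tridiagonal lab U V W A -> is_inverse p (mxop A) S -> (opnorm p S <= c%:E)%E.
Proof.
move=> labP dc; have [u0 Uu] := U0; have [v0 Vv] := V0; have [w0 Ww] := W0.
have [C [q [C' [q' [[C0 q0 q1] [_ h]]]]]] := convex_bounds.
exists (2 * C * (2 / (1 - q))) => A S AM AS.
have cf := coefs_diag labP Uu Vv Ww AM; have [hI _] := h _ _ _ _ cf dc.
exact: (inverse_bound labP p1 AM C0 q0 q1 hI AS).
Qed.

Lemma stable_fsm (I : choiceType) (lab : I -> int) unlab A (l r : nat -> int) :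
  labelling lab unlab -> convc (domain unlab) ->
  (forall n k, l n <= k <= r n -> domain unlab k) ->
  (forall k : nat, \forall n \near \oo, forall i, (absz (lab i) <= k)%N ->
     l n <= lab i <= r n) ->
  tridiagonal lab U V W A -> fsm_applies p lab l r A.
Proof.
move=> labP dc lrd lrl AM; have [u0 Uu] := U0; have [v0 Vv] := V0; have [w0 Ww] := W0.
have [C [q [C' [q' [[C0 q0 q1] [[C'0 q'0 q'1] h]]]]]] := convex_bounds.
have cf := coefs_diag labP Uu Vv Ww AM.
apply: (fsm_of_bounds labP p1 Uc Vc Wc Uu Vv Ww lrd lrl AM C'0 q'0 q'1 C0 q0 q1 dc).
  by move=> D Dc; case: (h _ _ _ _ cf Dc).
by move=> D Dc; case: (h _ _ _ _ cf Dc).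
Qed.

Lemma stable_full_fsm A : M U V W A -> full_fsm p A.
Proof.
apply: (stable_fsm labellingZ convc_domZ) => [n k _|k]; first by rewrite domZ.
by exists k => // n /= kn i; rewrite /labZ; lia.
Qed.

Lemma stable_full_fsm_plus A : Mplus U V W A -> full_fsm_plus p A.
Proof.
apply: (stable_fsm labellingN convc_domN) => [n k /andP[k1 _]|k]; first by rewrite domN.
by exists k => // n /= kn i; rewrite /labN; lia.
Qed.

End Stable.

Lemma first_basis_lp : lple p (fun i : nat => (i == 0%N)%:R : R[i]) 1.
Proof. exact: lp_delta. Qed.

Lemma plus_kernel A : nullfree U V W [set setT] -> nullfree U V W downc ->
  ~ nullfree U V W upc -> Mplus U V W A ->
  exists z, [/\ lp p z, mxop A z = 0 & z 0%N <> 0].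
Proof.
move=> nf ndown nup AM; have [u0 Uu] := U0; have [v0 Vv] := V0; have [w0 Ww] := W0.
have cf := coefs_diag labellingN Uu Vv Ww AM.
have [C [q [C0 q0 q1 hz]]] := kernel_right Uc Vc Wc nf ndown nup.
have [z [z0 zC zn w1]] := hz _ _ _ 0 cf.
have zD : supp (domain unlabN) z by rewrite domN => k /= nk; apply: z0; lia.
exists (res labN z); split.
- apply/lpP => //; exists (2 * C * (2 / (1 - q)) * 1).
    by rewrite !mulr_ge0 ?invr_ge0 ?subr_ge0 // ltW.
  (* Exponential decay means domination by the first basis vector, which lies in every l^p. *)
  apply: (lple_dom_lab labellingN p1 (ltW C0) ler01 q0 q1 _ first_basis_lp) => i s s0 hs.
  apply: le_trans (zC (labN i)) _; rewrite ler_wpM2l ?(ltW C0) //.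
  apply: le_trans (hs 0%N); rewrite eqxx normc1 mulr1.
  by apply: ler_wiXn2l; rewrite ?(ltW q0) ?(ltW q1) // /labN; lia.
- apply: funext => i; rewrite (mxop_jac labellingN u0 v0 w0 _ _ AM).
  by rewrite /jac !(ext_res labellingN zD); apply: zn; rewrite /labN; lia.
- rewrite /res => z1; move: w1; rewrite add0r -[1%R : int]/(labN 0) z1 mulr0.
  by move=> /esym/eqP; rewrite oner_eq0.
Qed.

Lemma plus_surj A : nullfree U V W downc -> Mplus U V W A ->
  forall b, lp p b -> (mxop A @` lp p) b.
Proof.
move=> ndown AM b /lpP[//|M M0 bM].
have [u0 Uu] := U0; have [v0 Vv] := V0; have [w0 Ww] := W0.
have cf := coefs_diag labellingN Uu Vv Ww AM.
have nup' : nullfree W V U upc by apply/nullfree_upc_opp.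
have [C [q [C0 q0 q1 h]]] := dual_boundW Uc Vc Wc admissible_upc nup'.
have [C' C'0 hs] := surj_mxop labellingN p1 AM C0 q0 q1 (h _ _ _ _ cf upc_domN).
have [x xM Ax] := hs b M M0 bM; exists x => //.
by apply/lpP => //; exists (C' * M) => //; exact: mulr_ge0.
Qed.

Lemma plus_bounded A : Mplus U V W A -> bounded_operator p (mxop A).
Proof.
have [u0 Uu] := U0; have [v0 Vv] := V0; have [w0 Ww] := W0.
exact: (bounded_mxop labellingN p1 Uc Vc Wc Uu Vv Ww).
Qed.

Lemma plus_first A x : nullfree U V W [set setT] -> Mplus U V W A -> lp p x ->
  mxop A x = 0 -> x 0%N = 0 -> x = 0.
Proof.
move=> nf AM /lpP[//|M M0 xM] Ax x0.
have [u0 Uu] := U0; have [v0 Vv] := V0; have [w0 Ww] := W0.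
have cf := coefs_diag labellingN Uu Vv Ww AM.
have xb := normc_ext_le unlabN M0 (lple_bdd p1 M0 xM).
have H : forall k, extend unlabN x k = 0.
  apply: (null_up_first nf cf xb) => [k k0|k k1|].
  - by apply: (supp_ext (unlab := unlabN)); rewrite domN /=; lia.
  - have kd : domain unlabN k by rewrite domN.
    have [i ->] := domP labellingN kd.
    by rewrite -(mxop_jac labellingN _ _ _ _ _ AM) Ax.
  - by rewrite -[1%R : int]/(labN 0) (ext_lab labellingN).
by apply: funext => i; rewrite -(ext_lab labellingN) H.
Qed.

(** Null vectors are determined by their first entry ([plus_first]), so the kernel is spanned by the
    vector of [plus_kernel]. *)
Lemma fredholm_plus A : nullfree U V W [set setT] -> nullfree U V W downc ->
  ~ nullfree U V W upc -> Mplus U V W A ->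
  fredholm_of_index p (mxop A) 1 /\ ~ fredholm_of_index p (mxop A) 0.
Proof.
move=> nf ndown nup AM; have [z [zl Az z0]] := plus_kernel nf ndown nup AM.
have Ab := plus_bounded AM; have surj := plus_surj ndown AM.
split; last first.
  by apply: (not_fredholm0_surj p1 Ab surj zl Az) => ze; apply: z0; rewrite ze.
split=> //; exists 1%N, 0%N; split=> //; last exact: quotient_dim0.
exists (fun=> z); split=> // x [xl Ax].
have z0' : z 0%N != 0 by apply/eqP.
have Alin := let: And3 _ h _ := Ab in h.
exists (fun=> x 0%N / z 0%N); split=> [|c].
  rewrite big_ord1 /=; apply: (plus_first nf AM).
  - by rewrite addrC -scaleNr; exact: lpD.
  - by rewrite addrC -scaleNr Alin // Az Ax scaler0 addr0.
  - by rewrite -[LHS]/(x 0%N - x 0%N / z 0%N * z 0%N) divfK // subrr.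
rewrite big_ord1 => /(congr1 (fun f => f 0%N)) h; apply: funext => k.
have {}h : x 0%N - c ord0 * z 0%N = 0 by exact: h.
move/eqP: h; rewrite subr_eq0 => /eqP ->; rewrite mulfK // (_ : k = ord0) //.
by apply: val_inj; case: k => [[]].
Qed.

Lemma minus_inj A : nullfree U V W upc -> Mplus U V W A ->
  forall x, lp p x -> mxop A x = 0 -> x = 0.
Proof.
move=> nup AM x xl Ax; have [u0 Uu] := U0; have [v0 Vv] := V0; have [w0 Ww] := W0.
have cf := coefs_diag labellingN Uu Vv Ww AM.
have [C [q [C0 q0 q1 h]]] := exp_bound Uc Vc Wc admissible_upc nup.
apply: (inj_mxop labellingN p1 AM (C := C) (q := q) _ xl Ax).
by move=> y M s i yM yD s0; exact: h cf upc_domN yM yD s0.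
Qed.

Lemma minus_not_range A : nullfree U V W upc -> ~ nullfree U V W downc -> Mplus U V W A ->
  ~ (mxop A @` lp p) (fun i : nat => (i == 0%N)%:R).
Proof.
move=> nup ndown AM [z /lpP[//|M M0 zM] Az].
have [u0 Uu] := U0; have [v0 Vv] := V0; have [w0 Ww] := W0.
have cf := coefs_diag labellingN Uu Vv Ww AM.
have zb := normc_ext_le unlabN M0 (lple_bdd p1 M0 zM).
apply: (delta_unsolvable Uc Vc Wc (nullfreeT_upc nup) nup ndown cf zb) => [i i0|i i1].
  by apply: (supp_ext (unlab := unlabN)); rewrite domN /=; lia.
have idom : domain unlabN i by rewrite domN.
have [j ->] := domP labellingN idom.
by rewrite -(mxop_jac labellingN _ _ _ _ _ AM) Az.
Qed.

(** Without its first equation the system is solvable, since the rows from 2 on touch only sites of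
    N and inherit the dual bound from Z. What is then wrong in the first row is a multiple of the
    first basis vector. *)
Lemma minus_codim A : nullfree U V W [set setT] -> Mplus U V W A -> forall f, lp p f ->
  exists c, (mxop A @` lp p) (f - c *: (fun i : nat => (i == 0%N)%:R)).
Proof.
move=> nf AM f /lpP[//|M M0 fM].
have [u0 Uu] := U0; have [v0 Vv] := V0; have [w0 Ww] := W0.
have cf := coefs_diag labellingN Uu Vv Ww AM.
have [C [q [C0 q0 q1 h]]] := dual_boundW Uc Vc Wc admissibleT (nullfreeT_opp nf).
have hd := dual_bound_rows (D := [set k | 2 <= k]) (E := domain unlabN) (h _ _ _ _ cf erefl).
have fb := normc_ext_le unlabN M0 (lple_bdd p1 M0 fM).
have [|z [zD zs hz]] := solve C0 q0 q1 (hd _) fb.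
  by move=> i j /= i2 ij; rewrite domN /=; lia.
pose q2 := (1 + q) / 2.
have q20 : 0 < q2 by rewrite /q2; lra.
have q21 : q2 < 1 by rewrite /q2; lra.
have C20 : 0 <= C * (2 / (1 - q2)).
  by rewrite mulr_ge0 ?divr_ge0 ?subr_ge0 // ltW.
have zl : lp p (res labN z).
  apply/lpP => //; exists (2 * (C * (2 / (1 - q2))) * (2 / (1 - q2)) * M).
    by rewrite !mulr_ge0 ?invr_ge0 ?subr_ge0 // ltW.
  apply: (lple_dom_lab labellingN p1 C20 M0 q20 q21 _ fM) => i s s0 hs.
  apply: zs => // j /= j2; have jd : domain unlabN j by rewrite domN /=; lia.
  by have [k ->] := domP labellingN jd; rewrite (ext_lab labellingN); exact: hs.
exists (f 0%N - mxop A (res labN z) 0%N); exists (res labN z) => //.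
apply: funext => i.
rewrite -[RHS]/(f i - (f 0%N - mxop A (res labN z) 0%N) * (i == 0%N)%:R).
case: i => [|i]; first by rewrite eqxx mulr1 subKr.
rewrite mulr0 subr0 (mxop_jac labellingN u0 v0 w0 _ _ AM) -(ext_lab labellingN) -hz.
  by rewrite /jac !(ext_res labellingN zD).
by rewrite /labN /=; lia.
Qed.

(** The first basis vector spans the quotient: two different coefficients for one f would put it
    into the range, against [minus_not_range]. *)
Lemma fredholm_minus A : nullfree U V W upc -> ~ nullfree U V W downc -> Mplus U V W A ->
  fredholm_of_index p (mxop A) (-1) /\ ~ fredholm_of_index p (mxop A) 0.
Proof.
move=> nup ndown AM; have nf := nullfreeT_upc nup.
have Ab := plus_bounded AM; have inj := minus_inj nup AM.
have nr := minus_not_range nup ndown AM.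
pose delta (i : nat) : R[i] := (i == 0%N)%:R.
have dl : lp p delta by apply/lpP => //; exists 1 => //; exact: first_basis_lp.
split; last exact: (not_fredholm0_inj p1 Ab inj dl nr).
split=> //; exists 0%N, 1%N; split=> //.
  by apply: quotient_dim0 => x [xl Ax]; exact: inj.
have Alin := let: And3 _ h _ := Ab in h.
exists (fun=> delta); split=> // f fl.
have [c hc] := minus_codim nf AM fl; exists (fun=> c); split=> [|c']; rewrite big_ord1 //.
move: hc => [x xl Ax] [y yl Ay]; apply: funext => k.
have -> : k = ord0 by apply: val_inj; case: k => [[]].
apply: contrapT => /eqP cc; apply: nr; have d0 : c' ord0 - c != 0.
  by rewrite subr_eq0 eq_sym.
exists ((c' ord0 - c)^-1 *: (-1 *: y + x)).
  by rewrite -[_ *: _]addr0; apply: lpD (lp0 _ _) => //; exact: lpD.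
rewrite -[X in mxop A X]addr0 Alin; [|exact: lpD|exact: lp0].
rewrite (bounded_operator0 p1 Ab) addr0 Alin // Ax Ay; apply: funext => i.
transitivity ((c' ord0 - c)^-1 * ((-1) * (f i - c' ord0 * delta i) + (f i - c * delta i))).
  by [].
rewrite (_ : -1 * _ + _ = (c' ord0 - c) * delta i); last by ring.
by rewrite mulKf.
Qed.

Lemma stable_of_fsm A : M U V W A -> full_fsm p A ->
  forall u0 v0 w0, U u0 -> V v0 -> W w0 ->
  stable_sections (diag unlabZ (-1) u0 A) (diag unlabZ 0 v0 A) (diag unlabZ 1 w0 A).
Proof.
move=> AM [Ainv huniq hcvg] u0 v0 w0 Uu Vv Ww q x q0 q1 xq.
have Ab := Ainv.1.
have lrd (n : nat) (k : int) : - n%:Z <= k <= n%:Z -> domain unlabZ k by rewrite domZ.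
have xl : lp p x.
  apply/lpP => //; exists (2 * 1 * (2 / (1 - q)) * 1).
    by rewrite !mulr_ge0 ?invr_ge0 ?subr_ge0 // ltW.
  apply: (lple_dom_lab labellingZ p1 ler01 ler01 q0 q1 _ (lp_delta p1 (0 : int))) => i s s0 hs.
  rewrite mul1r; apply: le_trans (xq i) _.
  by have := hs 0; rewrite eqxx normc1 mulr1 /labZ subr0.
have bl : lp p (mxop A x) by case: Ab => + _ _; exact.
have [N _ hN] := huniq.
pose D (n : nat) : set int := [set i | - n%:Z <= labZ i <= n%:Z].
have H (n : nat) : exists y, (N <= n)%N -> trunc_sol A (D n) (mxop A x) y.
  have [Nn|_] := leqP N n; last by exists 0.
  by have [y [hy _]] := hN n Nn _ bl; exists y.
have [xn hxn] := choice H.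
have cvg := hcvg (mxop A x) x xn bl xl erefl (ex_intro2 _ _ N I (fun n => hxn n)).
(* For p < oo the bound 2 comes from the errors, eventually of norm at most 1, and from |x| <= 1. *)
have [c [N' hc]] : exists c (N' : nat), forall n, (N' <= n)%N -> forall k, normc (xn n k) <= c.
  move: cvg; rewrite /fsm_cvg; case: eqP => [pE [[c [N' _ hN']] _]|_].
    exists `|c|, N' => n /hN' h k; apply: (lple_bdd p1 (normr_ge0 c)).
    by apply/(lpnorm_le p1 _ (normr_ge0 c)); apply: le_trans h _; rewrite lee_fin ler_norm.
  move=> /fine_cvgP[[N1 _ h1] /cvgrPdist_le/(_ 1 ltr01)[N2 _ h2]].
  exists 2, (maxn N1 N2) => n; rewrite geq_max => /andP[/h1 fin /h2 /=].
  rewrite sub0r normrN => h k.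
  have h3 : (lpnorm p (xn n - x)%R <= 1%:E)%E.
    by rewrite -(fineK fin) lee_fin; apply: le_trans (ler_norm _) h.
  have /(_ k) h4 := lple_bdd p1 ler01 (iffLR (lpnorm_le p1 _ ler01) h3).
  have -> : xn n k = (xn n - x) k + x k.
    by rewrite -[(xn n - x) k]/(xn n k - x k) subrK.
  apply: le_trans (le_normcD _ _) _.
  have h5 : normc (x k) <= 1 by apply: le_trans (xq k) _; rewrite exprn_ile1 // ltW.
  by move: (lerD h4 h5).
exists c, (maxn N N') => n; rewrite geq_max => /andP[Nn N'n].
have Dn (k : int) : (absz k <= n)%N = (- n%:Z <= k <= n%:Z) by lia.
split.
  exists (xn n); have [yD hy] := iffLR (trunc_solP labellingZ u0 v0 w0 lrd _ _ _ AM) (hxn n Nn).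
  split=> [k /= nk|k|k hk].
  - by apply: (yD k) => /=; rewrite -Dn.
  - exact: hc.
  - rewrite hy; last by rewrite /= -Dn.
    by rewrite /extend /= (mxop_jac labellingZ u0 v0 w0 _ _ AM).
move=> d dD hd k; have [y [_ yu]] := hN n Nn 0 (lp0 int p1).
have E (e : int -> R[i]) : supp [set k : int | (absz k <= n)%N] e ->
    (forall k : int, (absz k <= n)%N -> jac (diag unlabZ (-1) u0 A) (diag unlabZ 0 v0 A)
      (diag unlabZ 1 w0 A) e k = 0) -> y = e.
  move=> eD he; apply: yu; apply/(trunc_solP labellingZ u0 v0 w0 lrd _ _ _ AM).
  split=> [j /= nj|j /= hj]; first by apply: eD; rewrite /= Dn.
  by apply: he; rewrite Dn.
rewrite -(E d dD hd) (E (fun=> 0)) // => j _.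
by rewrite /jac !mulr0 !addr0.
Qed.

Lemma nullfreeT_of_codim (I : choiceType) (lab : I -> int) unlab A (b : nat) :
  labelling lab unlab -> tridiagonal lab U V W A -> has_windows lab U V W A ->
  quotient_dim (lp p) (mxop A @` lp p) b -> nullfree U V W [set setT].
Proof.
move=> labP AM HA hb; apply: contrapT => nnf.
have [u0 Uu] := U0; have [v0 Vv] := V0; have [w0 Ww] := W0.
have ann := annihilated labP u0 v0 w0 Uc Wc p1 AM HA nnf.
apply: (infinite_codim labP p1 _ ann hb) => a x y.
exact: (mxop_linear labP u0 v0 w0).
Qed.

Lemma PsiE_nullfreeT A : PsiE p U V W A -> invertible p (mxop A) ->
  nullfree U V W [set setT].
Proof.
move=> AE [Ab [S [Sb hS]]]; apply: (nullfreeT_of_codim labellingZ AE.1 (b := 0)).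
  exact: (PsiE_windows p1 AE).
apply: quotient_dim0 => x xl; exists (S x); first by case: Sb => + _ _; exact.
by case: (hS x xl).
Qed.

Lemma trichotomy : nullfree U V W [set setT] ->
  [\/ nullfree U V W upc /\ nullfree U V W downc,
      nullfree U V W downc /\ ~ nullfree U V W upc |
      nullfree U V W upc /\ ~ nullfree U V W downc].
Proof.
move=> nf; have [hu|hu] := pselect (nullfree U V W upc).
  have [hd|hd] := pselect (nullfree U V W downc); first by constructor 1.
  by constructor 3.
by constructor 2; split=> //; case: (nullfree_up_or_down nf).
Qed.

End Trichotomy.

Theorem theorem3p1 (R : realType) (U V W : set R[i]) (p : \bar R)
  (U0 : U !=set0) (V0 : V !=set0) (W0 : W !=set0)
  (Uc : compact (U : set R[i]^o)) (Vc : compact (V : set R[i]^o))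
  (Wc : compact (W : set R[i]^o)) (p1 : (1 <= p)%E) :
  [<-> (* a *) exists2 A, PsiE p U V W A & full_fsm p A;
       (* b *) exists2 A, PsiEplus p U V W A & full_fsm_plus p A;
       (* c *) forall A, Mplus U V W A -> invertible p (mxop A);
       (* d *) (forall A, Mplus U V W A -> invertible p (mxop A)) /\
               (exists c : R, forall A S, Mplus U V W A ->
                  is_inverse p (mxop A) S -> (opnorm p S <= c%:E)%E);
       (* e *) exists2 A, PsiEplus p U V W A & invertible p (mxop A);
       (* f *) ~ Sigma_plus p U V W 0;
       (* g *) exists2 A, PsiEplus p U V W A & fredholm_of_index p (mxop A) 0;
       (* h *) forall A, Mplus U V W A -> fredholm_of_index p (mxop A) 0;
       (* i *) compatible p U V W /\ kappa p U V W = 0;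
       (* j *) forall A, M U V W A -> full_fsm p A;
       (* k *) forall A, Mplus U V W A -> full_fsm_plus p A].
Proof.
have [AZ AZE] := PsiE_nonempty p1 U0 V0 W0.
have [AN ANE] := PsiEplus_nonempty p1 U0 V0 W0.
(* The case of index 0, through which the cycle passes wherever one operator has to speak for
   all. *)
pose stable := nullfree U V W upc /\ nullfree U V W downc.
have inv_stable A : PsiE p U V W A -> invertible p (mxop A) -> nullfree U V W [set setT].
  exact: PsiE_nullfreeT.
have cinv : stable -> forall A, Mplus U V W A -> invertible p (mxop A).
  move=> [nu nd] A AM.
  exact: (stable_invertible p1 U0 V0 W0 Uc Vc Wc nu nd labellingN convc_domN AM).
have Zinv : stable -> forall A, M U V W A -> invertible p (mxop A).
  move=> [nu nd] A AM.
  exact: (stable_invertible p1 U0 V0 W0 Uc Vc Wc nu nd labellingZ convc_domZ AM).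
have stable_k : stable -> forall A, Mplus U V W A -> full_fsm_plus p A.
  by move=> [nu nd] A; exact: stable_full_fsm_plus.
have fred0 A : invertible p (mxop A) -> fredholm_of_index p (mxop A) 0.
  by move=> h; apply/invertible_fredholm.
have g_stable : (exists2 A, PsiEplus p U V W A & fredholm_of_index p (mxop A) 0) -> stable.
  move=> [A AE hf]; have [_ [a [b [_ hb _]]]] := hf.
  have nf := nullfreeT_of_codim p1 U0 V0 W0 Uc Wc labellingN AE.1
    (PsiEplus_windows p1 AE) hb.
  have [//|[nd nu]|[nu nd]] := trichotomy nf.
    by have [_ []] := fredholm_plus p1 U0 V0 W0 Uc Vc Wc nf nd nu AE.1.
  by have [_ []] := fredholm_minus p1 U0 V0 W0 Uc Vc Wc nu nd AE.1.
have e_stable : (exists2 A, PsiEplus p U V W A & invertible p (mxop A)) -> stable.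
  by move=> [A AE Ai]; apply: g_stable; exists A => //; exact: fred0.
have c_stable : (forall A, Mplus U V W A -> invertible p (mxop A)) -> stable.
  by move=> h; apply: e_stable; exists AN => //; apply: h; exact: ANE.1.
have a_stable : (exists2 A, PsiE p U V W A & full_fsm p A) -> stable.
  move=> [A AE Af]; have Ai : invertible p (mxop A) by case: Af.
  have nf := inv_stable A AE Ai.
  have [u0 Uu] := U0; have [v0 Vv] := V0; have [w0 Ww] := W0.
  have cf := coefs_diag labellingZ Uu Vv Ww AE.1.
  have st := stable_of_fsm p1 AE.1 Af Uu Vv Ww.
  have [//|[nd nu]|[nu nd]] := trichotomy nf.
    by case: (unstable_plus Uc Vc Wc nf nd nu cf st).
  by case: (unstable_minus Uc Vc Wc nf nu nd cf st).
have i_stable : compatible p U V W /\ kappa p U V W = 0 -> stable.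
  move=> [comp]; have nf := inv_stable AZ AZE (comp AZ AZE.1).
  have [//|[nd nu]|[nu nd]] := trichotomy nf.
    have h B := fredholm_plus p1 U0 V0 W0 Uc Vc Wc nf nd nu (A := B).
    (* All operators have index 1, so [kappa] is an index of [AN] and not the default value; were it
       0, [AN] would have index 0, which [fredholm_plus] excludes. *)
    rewrite /kappa; case: xgetP => [k -> hk k0|/(_ 1) []]; last by move=> B /h[].
    by have [_ []] := h AN ANE.1; rewrite -k0; exact: hk ANE.1.
  have h B := fredholm_minus p1 U0 V0 W0 Uc Vc Wc nu nd (A := B).
  rewrite /kappa; case: xgetP => [k -> hk k0|/(_ (-1)) []]; last by move=> B /h[].
  by have [_ []] := h AN ANE.1; rewrite -k0; exact: hk ANE.1.
have f_iff : ~ Sigma_plus p U V W 0 <-> forall A, Mplus U V W A -> invertible p (mxop A).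
  have E A : (fun i j : nat => A i j - (if i == j then 0 else 0)) = A :> (nat -> nat -> R[i]).
    by apply: funext => i; apply: funext => j; rewrite if_same subr0.
  split=> [h A AM|h [A AM]]; last by rewrite /spec /= E; apply; exact: h.
  by apply: contrapT => Ai; apply: h; exists A => //; rewrite /spec /= E.
tfae.
- move=> /a_stable st; exists AN => //; exact: stable_k st _ ANE.1.
- move=> [A AE [Ai _ _]]; apply: cinv; apply: e_stable; by exists A.
- move=> h; split=> //; have [nu nd] := c_stable h.
  have [c hc] := stable_inverse_bound p1 U0 V0 W0 Uc Vc Wc nu nd labellingN convc_domN.
  by exists c => A S; exact: hc.
- by move=> [h _]; exists AN => //; apply: h; exact: ANE.1.
- by move=> /e_stable/cinv/f_iff.
- by move=> /f_iff h; exists AN => //; apply: fred0; apply: h; exact: ANE.1.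
- by move=> /g_stable st A AM; apply: fred0; exact: cinv.
- move=> h; have st : stable by apply: g_stable; exists AN => //; apply: h; exact: ANE.1.
  split; first exact: Zinv.
  (* The default value of [kappa] is 0 as well, so only a genuine common index k has to be
     examined. *)
  rewrite /kappa; case: xgetP => [k _ hk|//].
  by apply: (invertible_fredholm p1 k (cinv st AN ANE.1)).1; exact: hk ANE.1.
- by move=> /i_stable [nu nd] A; exact: stable_full_fsm.
- move=> h; apply: stable_k; apply: a_stable; exists AZ => //; apply: h; exact: AZE.1.
- move=> h; have st : stable.
    apply: e_stable; exists AN => //; by have [] := h AN ANE.1.
  have [nu nd] := st; exists AZ => //; exact: (stable_full_fsm p1 U0 V0 W0 Uc Vc Wc nu nd AZE.1).
Qed.
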